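(* For every knot or link $K$, $$\mathrm{Rib}(K) \le \alpha_4(K),$$ where $\mathrm{Rib}(K)$ is the ribbonlength of $K$ and $\alpha_4(K)$ is the four-page index of $K$.
   Context: Ribbonlength. A folded ribbon knot (or link) $K_w$ of width $w>0$ is obtained by folding a long thin rectangular strip of width $w$ (one closed-up strip for each component) into a planar configuration such that: (1) the ribbon is flat and its fold lines are disjoint; (2) the core (centerline) of $K_w$ is a finite union of straight line segments which, together with the over/under crossing information, is a piecewise linear diagram representing the knot or link type of $K$. $\mathrm{Len}(K_w)$ is the total length of the ribbon, i.e. of its core. Let $[K]_w$ be the set of folded ribbon knots of width $w$ representing $K$. The ribbonlength is $$\mathrm{Rib}(K)=\inf_{K'_w\in[K]_w}\frac{\mathrm{Len}(K'_w)}{w}$$ (independent of $w$). Four-page index. Consider the open book decomposition of $\mathbb{R}^3$ whose binding is a straight line (the binding axis) and whose pages are the half-planes bounded by it. A four-page presentation of $K$ is an embedding of $K$ (in its ambient isotopy class) into the union of pages of this open book such that exactly four pages meet $K$, and each page contains finitely many pairwise disjoint properly embedded arcs of $K$ (with endpoints on the binding axis). The number of arcs equals the number of points where $K$ meets the binding axis. The four-page index $\alpha_4(K)$ is the minimal number of arcs among all four-page presentations of $K$. *)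

(* Defs.v *)
From HB Require Import structures.
From mathcomp Require Import all_boot all_order all_algebra.
From mathcomp Require Import all_classical all_reals all_analysis.
Import Order.TTheory GRing.Theory Num.Theory.
Import numFieldNormedType.Exports.

Set Implicit Arguments.
Unset Strict Implicit.
Unset Printing Implicit Defensive.

Local Open Scope classical_set_scope.
Local Open Scope ring_scope.

Notation plane R := (R * R)%type.

(* Points are ((x, y), z): the first component is the vertical projection, the
   second one is the height above the plane of projection. *)
Notation space3 R := ((R * R) * R)%type.

Definition ambient_isotopic (R : realType) (K L : set (space3 R)) : Prop :=
  exists H G : R -> space3 R -> space3 R,
    [/\ {within `[0, 1] `*` setT, continuous (fun p => H p.1 p.2)},
        forall t, t \in `[0, 1] ->
          [/\ continuous (H t), continuous (G t),
              cancel (H t) (G t) & cancel (G t) (H t)],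
        forall p, H 0 p = p
      & H 1 @` K = L].

(* k disjoint closed polygons; each one is parametrized so that its N edges are
   traversed at constant speed during the N equal subintervals of [0, 1].  A
   common N is no restriction, since an edge may be subdivided. *)
Definition polygonal_link (R : realType) (P : set (space3 R)) : Prop :=
  exists (k N : nat) (c : 'I_k -> R -> space3 R),
    [/\ (0 < k)%N /\ (0 < N)%N,
        forall i, c i 0 = c i 1,
        forall i (j : 'I_N) (u : R), u \in `[0, 1] ->
          c i ((j%:R + u) / N%:R) =
          (1 - u) *: c i (j%:R / N%:R) + u *: c i (j.+1%:R / N%:R),
        forall i j s t, s \in `[0, 1[ -> t \in `[0, 1[ ->
          c i s = c j t -> i = j /\ s = t
      & P = \bigcup_i (c i @` `[0, 1[)].

(* Knots and links are tame, unoriented and have at least one component. *)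
Definition is_link (R : realType) (K : set (space3 R)) : Prop :=
  exists2 P, polygonal_link P & ambient_isotopic P K.

(* A closed strip of length l and width w is the band of all (t, s) with
   |s| <= w / 2, modulo (t, s) ~ (t + l, s) (an annulus) or, if [twisted],
   (t, s) ~ (t + l, - s) (a Moebius band).  All data below live on the
   universal cover: the fold lines in the strip are the segments
   t = crease_pos i + crease_slope i * s, for i ranging over int, with
   [ncreases] of them modulo the identification.  [fold] is the resulting map
   into the plane, and [height] records which of several superposed points of
   the ribbon lies above the others. *)
Record folded_strip (R : realType) := FoldedStrip {
  strip_length : R;
  twisted : bool;
  ncreases : nat;
  crease_pos : int -> R;
  crease_slope : int -> R;
  fold : R * R -> plane R;
  height : R * R -> R }.

Definition band (R : realType) (w : R) : set (R * R) :=
  [set p | `|p.2| <= w / 2].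

Definition flip (R : realType) (S : folded_strip R) (s : R) : R :=
  (-1) ^+ twisted S * s.

Definition crease (R : realType) (S : folded_strip R) (i : int) (s : R) : R :=
  crease_pos S i + crease_slope S i * s.

Definition panel (R : realType) (w : R) (S : folded_strip R) (i : int) :
    set (R * R) :=
  band w `&` [set p | crease S i p.2 <= p.1 <= crease S (i + 1) p.2].

Definition sqdist (R : realType) (p q : plane R) : R :=
  (p.1 - q.1) ^+ 2 + (p.2 - q.2) ^+ 2.

(* The fold lines are pairwise disjoint in the strip, and the strip is mapped
   rigidly between consecutive fold lines: [fold] is then either a reflection or
   a rigid continuation across each crease.  The latter case only amounts to
   listing a superfluous crease. *)
Definition flat_folded (R : realType) (w : R) (S : folded_strip R) : Prop :=
  [/\ 0 < strip_length S /\ (0 < ncreases S)%N,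
      forall i s, crease S (i + (ncreases S)%:Z) (flip S s) =
                  crease S i s + strip_length S,
      forall i s, `|s| <= w / 2 -> crease S i s < crease S (i + 1) s,
      forall i p q, panel w S i p -> panel w S i q ->
        sqdist (fold S p) (fold S q) = sqdist p q
    & forall p, band w p ->
        fold S (p.1 + strip_length S, flip S p.2) = fold S p].

(* The ribbon is layered without passing through itself: the fold map and the
   height together embed the closed strips in space.  Different sheets of paper
   over one point of the plane hence have different heights. *)
Definition layered (R : realType) (w : R) (k : nat)
    (S : 'I_k -> folded_strip R) : Prop :=
  [/\ forall i, {within band w, continuous (height (S i))},
      forall i p, band w p ->
        height (S i) (p.1 + strip_length (S i), flip (S i) p.2) =
        height (S i) p
    & forall i j p q,
        band w p -> band w q ->
        p.1 \in `[0, strip_length (S i)[ -> q.1 \in `[0, strip_length (S j)[ ->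
        fold (S i) p = fold (S j) q -> height (S i) p = height (S j) q ->
        i = j /\ p = q].

Definition core_domain (R : realType) (k : nat) (S : 'I_k -> folded_strip R) :
    set ('I_k * R) :=
  [set x | x.2 \in `[0, strip_length (S x.1)[].

Definition core_proj (R : realType) (k : nat) (S : 'I_k -> folded_strip R)
    (x : 'I_k * R) : plane R :=
  fold (S x.1) (x.2, 0).

(* Regularity of the core as a diagram: finitely many multiple points, all of
   them double points in the interior of two edges.  Since the edges are
   straight, such isolated double points are transversal crossings. *)
Definition regular_core (R : realType) (k : nat)
    (S : 'I_k -> folded_strip R) : Prop :=
  [/\ finite_set [set xy : ('I_k * R) * ('I_k * R) |
        [/\ core_domain S xy.1, core_domain S xy.2, xy.1 <> xy.2
          & core_proj S xy.1 = core_proj S xy.2]],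
      forall x y z, core_domain S x -> core_domain S y -> core_domain S z ->
        core_proj S x = core_proj S y -> core_proj S y = core_proj S z ->
        [\/ x = y, y = z | x = z]
    & forall x y i, core_domain S x -> core_domain S y -> x <> y ->
        core_proj S x = core_proj S y -> x.2 <> crease_pos (S x.1) i].

(* The link described by the core diagram with its crossing information. *)
Definition core_link (R : realType) (k : nat) (S : 'I_k -> folded_strip R) :
    set (space3 R) :=
  [set (core_proj S x, height (S x.1) (x.2, 0)) | x in core_domain S].

Definition folded_ribbon (R : realType) (w : R) (K : set (space3 R)) (k : nat)
    (S : 'I_k -> folded_strip R) : Prop :=
  [/\ forall i, flat_folded w (S i), layered w S, regular_core S
    & ambient_isotopic (core_link S) K].

Definition ribbon_length (R : realType) (k : nat)
    (S : 'I_k -> folded_strip R) : R :=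
  \sum_i strip_length (S i).

(* The width w is kept as a parameter; the value does not depend on it. *)
Definition ribbonlength (R : realType) (w : R) (K : set (space3 R)) : \bar R :=
  ereal_inf [set x | exists k (S : 'I_k -> folded_strip R),
    folded_ribbon w K S /\ x = (ribbon_length S / w)%:E].

(* The binding axis is the vertical line over the origin; a page is given by the
   unit vector u of its horizontal direction. *)
Definition axis (R : realType) : set (space3 R) := [set p | p.1 = (0, 0)].

Definition page (R : realType) (u : plane R) : set (space3 R) :=
  [set p | exists2 r : R, 0 <= r & p.1 = (r * u.1, r * u.2)].

Definition proper_arc (R : realType) (u : plane R) (A : set (space3 R)) : Prop :=
  exists c : R -> space3 R,
    [/\ {within `[0, 1], continuous c},
        {in `[0, 1] &, injective c},
        A = c @` `[0, 1],
        A `<=` page u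
      & forall t, t \in `[0, 1] -> (axis (c t) <-> t = 0 \/ t = 1)].

(* L is the union of the n arcs A j, the arc A j lying in the page number pg j;
   surjectivity of pg says that all four pages meet L outside the axis. *)
Definition four_page_arcs (R : realType) (L : set (space3 R)) (n : nat) : Prop :=
  exists (u : 'I_4 -> plane R) (pg : 'I_n -> 'I_4) (A : 'I_n -> set (space3 R)),
    [/\ injective u /\ (forall i, (u i).1 ^+ 2 + (u i).2 ^+ 2 = 1),
        forall i, exists j, pg j = i,
        forall j, proper_arc (u (pg j)) (A j),
        forall i j, i <> j -> pg i = pg j -> A i `&` A j = set0
      & L = \bigcup_j A j].

Definition four_page_presentation (R : realType) (K : set (space3 R)) (n : nat) :
    Prop :=
  exists2 L, ambient_isotopic L K & four_page_arcs L n.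

(* An infimum of natural numbers is attained if there is any, so this is the
   minimal number of arcs (and +oo without a four-page presentation). *)
Definition four_page_index (R : realType) (K : set (space3 R)) : \bar R :=
  ereal_inf [set n%:R%:E | n in four_page_presentation K].

(* Main.v *)
Require Import Defs.
From HB Require Import structures.
From mathcomp Require Import all_boot all_order all_algebra.
From mathcomp Require Import all_classical all_reals all_analysis.
From mathcomp Require Import ring lra zify.
Import Order.TTheory GRing.Theory Num.Theory.
Import numFieldNormedType.Exports.

Set Implicit Arguments.
Unset Strict Implicit.
Unset Printing Implicit Defensive.

Local Open Scope classical_set_scope.
Local Open Scope ring_scope.

(* Normalise the pages so that they point along the four coordinate half-axes.  As the
   link has only two strands at each of its points on the axis, the arcs can be oriented
   consistently, and arcs of one page have disjoint or nested height intervals.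
   The arc from level s to level t becomes a strip that runs along its page over a
   distance about w / 2, turns back by three folds, nearly parallel to each other and
   almost perpendicular to the arm, and returns to the axis; outer arcs of a page reach a
   little further than inner ones.  Above the axis the strip passes to the next page by a
   fold along a diagonal of a square of side w, or straight ahead if that page is opposite.
   Hence an arc costs w + O(T), where T is the slope of the folds of the tip.
   The strip passing the axis at level z is shifted by (eta z, eta z), with eta of order
   T ^ 2, so that the core is a regular diagram: it only crosses itself where the
   shifted arms of perpendicular pages meet near the axis.
   A shear depending on the height undoes these shifts.  The core then lies in four
   disjoint wedges around the pages, and inside each wedge it is moved to the given arcs
   by an isotopy fixing the rest (Klee's trick: arcs of a wedge are put at different
   slopes, slid to their final position, and flattened again). *)

(** * Ambient isotopies *)

(** Why the tip has three folds: one fold perpendicular to the arm would lay the core back on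
    itself, which is no diagram, and one oblique fold would turn the arm away from its page. A
    middle crease perpendicular to the arm, between two oblique creases that mirror each other,
    reverses the arm and displaces it sideways. For the creases to stay disjoint across the whole
    width, the panels between them need a length of order T w; the displacement is that length times
    a sine of order T. Hence the displacement has order T ^ 2 while the extra length has order T.
    Layers are kept apart by heights that follow the axis levels: different pages overlap only near
    the axis, where every strip is close to its own level, and arcs of one page are separated by
    height or by the reach of their tips. A presentation by arcs does not say how many arcs end at a
    point of the axis. That exactly two do comes from tameness: a polygonal link is locally a
    topological line, and homeomorphisms of space preserve this. *)

Section RealLimits.
Context {R : realType} {T : Type} {F : set_system T} {FF : Filter F}.
Implicit Types (f g : T -> R) (a b : R).

Lemma cvg_minr f g a b : f @ F --> a -> g @ F --> b ->
  Num.min (f x) (g x) @[x --> F] --> Num.min a b.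
Proof.
move=> fa gb; rewrite minr_absE; under eq_fun do rewrite minr_absE.
apply: cvgM; last exact: cvg_cst.
by apply: cvgB; [exact: cvgD|apply: cvg_norm; exact: cvgB].
Qed.

Lemma cvg_maxr f g a b : f @ F --> a -> g @ F --> b ->
  Num.max (f x) (g x) @[x --> F] --> Num.max a b.
Proof.
move=> fa gb; rewrite maxr_absE; under eq_fun do rewrite maxr_absE.
apply: cvgM; last exact: cvg_cst.
by apply: cvgD; [exact: cvgD|apply: cvg_norm; exact: cvgB].
Qed.

Lemma cvg_near_eq {U : topologicalType} (f g : T -> U) (l : U) :
  {near F, f =1 g} -> g @ F --> l -> f @ F --> l.
Proof.
move=> fg gl P lP; have gf : {near F, g =1 f} by apply: filterS fg => x ->.
exact: (near_eq_cvg gf (gl P lP)).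
Qed.

Lemma cvg_sumr {V : normedModType R} (I : Type) (s : seq I) (a : pred I)
    (f : I -> T -> V) (l : I -> V) : (forall i, f i @ F --> l i) ->
  \sum_(i <- s | a i) f i x @[x --> F] --> \sum_(i <- s | a i) l i.
Proof.
move=> fl; elim: s => [|i s IH].
  by rewrite big_nil; under eq_fun do rewrite big_nil; exact: cvg_cst.
rewrite big_cons; under eq_fun do rewrite big_cons.
by case: (a i) => //; apply: cvgD.
Qed.

Lemma cvg_div f g a b : b != 0 -> f @ F --> a -> g @ F --> b ->
  f x / g x @[x --> F] --> a / b.
Proof. by move=> b0 fa gb; apply: cvgM => //; exact: cvgV. Qed.

Lemma cvg_space3 (f : T -> space3 R) (p : space3 R) :
  (f x).1.1 @[x --> F] --> p.1.1 -> (f x).1.2 @[x --> F] --> p.1.2 ->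
  (f x).2 @[x --> F] --> p.2 -> f @ F --> p.
Proof.
move=> h1 h2 h3.
have -> : f = fun x => (((f x).1.1, (f x).1.2), (f x).2).
  by apply/funext => x; case: (f x) => -[].
case: p h1 h2 h3 => -[a b] c /= h1 h2 h3.
exact: (cvg_pair (cvg_pair h1 h2) h3).
Qed.

Lemma cvg_fst_of {U V : topologicalType} (f : T -> U * V) (p : U * V) :
  f @ F --> p -> (f x).1 @[x --> F] --> p.1.
Proof. by case: p => a b fp; apply: (cvg_comp _ _ fp); exact: cvg_fst. Qed.

Lemma cvg_snd_of {U V : topologicalType} (f : T -> U * V) (p : U * V) :
  f @ F --> p -> (f x).2 @[x --> F] --> p.2.
Proof. by case: p => a b fp; apply: (cvg_comp _ _ fp); exact: cvg_snd. Qed.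

Lemma cvg_prod_of {U V : topologicalType} (f : T -> U * V) (p : U * V) :
  (f x).1 @[x --> F] --> p.1 -> (f x).2 @[x --> F] --> p.2 -> f @ F --> p.
Proof.
move=> h1 h2.
have -> : f = fun x => ((f x).1, (f x).2) by apply/funext => x; case: (f x).
by case: p h1 h2 => a b h1 h2; exact: (cvg_pair h1 h2).
Qed.

End RealLimits.

(** One limit rule per head symbol of the function. The cases with a bare [Order.max _],
    [GRing.add _] and so on catch eta-reduced functions. Side conditions such as nonzero
    denominators are left to the caller. *)
Ltac cts1 :=
  lazymatch goal with
  | |- cvg_to (nbhs (fmap ?g _)) _ =>
    lazymatch g with
    | (fun x => x) => exact: cvg_id
    | @fst _ _ => exact: cvg_fst
    | @snd _ _ => exact: cvg_snd
    | (fun _ => ?c) => exact: cvg_cst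
    | (fun x => fst (@?f x)) => apply: cvg_fst_of
    | (fun x => snd (@?f x)) => apply: cvg_snd_of
    | (fun x => ((@?a x, @?b x), @?c x)) => apply: cvg_space3
    | (fun x => (@?a x, @?b x)) => apply: cvg_prod_of
    | (fun x => GRing.add (@?a x) (@?b x)) => apply: cvgD
    | (fun x => GRing.opp (@?a x)) => apply: cvgN
    | (fun x => GRing.inv (@?a x)) => apply: cvgV
    | (fun x => GRing.mul (@?a x) (@?b x)) => apply: cvgM
    | (fun x => Order.min (@?a x) (@?b x)) => apply: cvg_minr
    | (fun x => Order.max (@?a x) (@?b x)) => apply: cvg_maxr
    | (fun x => Num.norm (@?a x)) => apply: cvg_norm
    | Order.max _ => apply: cvg_maxr
    | Order.min _ => apply: cvg_minr
    | GRing.add _ => apply: cvgD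
    | GRing.mul _ => apply: cvgM
    | GRing.opp => apply: cvgN
    | (fun x => ?h (@?a x)) =>
        match goal with H : continuous h |- _ => refine (continuous_cvg _ (@H _) _) end
    | ?h => match goal with H : continuous h |- _ => exact (@H _) end
    end
  end.
Ltac cts := repeat (first [assumption | cts1]; cbn beta iota delta [fst snd]).

Lemma within_continuous_comp {T U V : topologicalType} (B : set U) (A : set T)
    (f : T -> U) (g : U -> V) :
  {within A, continuous f} -> {within B, continuous g} -> f @` A `<=` B ->
  {within A, continuous (g \o f)}.
Proof.
move=> /subspace_continuousP cf /subspace_continuousP cg AB.
apply/subspace_continuousP => x Ax; apply: (@cvg_comp _ _ _ f g _ (within B (nbhs (f x)))).
  move=> P /= WP; have /= := cf x Ax _ WP; rewrite /nbhs /= /within /=.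
  apply: (@filterS _ (nbhs x)) => y Py Ay; apply: Py => //.
  by apply: AB; exists y.
by apply: cg; apply: AB; exists x.
Qed.

Section Isotopies.
Context {R : realType}.
Notation E3 := (space3 R).

Definition isotopy (H G : R -> E3 -> E3) : Prop :=
  [/\ {within `[0, 1] `*` setT, continuous (fun p : R * E3 => H p.1 p.2)},
      forall t, t \in `[0, 1] ->
        [/\ continuous (H t), continuous (G t),
            cancel (H t) (G t) & cancel (G t) (H t)]
    & forall p, H 0 p = p].

(** Separating the motion of space from the set that is moved turns ambient isotopy into a class of
    homeomorphisms closed under composition, inversion and conjugation. *)
Definition isotopic_to_id (f : E3 -> E3) : Prop :=
  exists H G, isotopy H G /\ H 1 = f.

Lemma isotopic_ambient f (K : set E3) :
  isotopic_to_id f -> ambient_isotopic K (f @` K).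
Proof. by move=> [H [G [[h1 h2 h3] <-]]]; exists H, G. Qed.

Lemma ambient_isotopicE (K L : set E3) :
  ambient_isotopic K L <-> exists2 f, isotopic_to_id f & f @` K = L.
Proof.
split; last by move=> [f fi <-]; exact: isotopic_ambient.
by move=> [H [G [h1 h2 h3 h4]]]; exists (H 1) => //; exists H, G.
Qed.

Lemma isotopic_to_id_id : isotopic_to_id id.
Proof.
exists (fun _ => id), (fun _ => id); split=> //; split=> //.
- apply: continuous_subspaceT => -[t p]; exact: cvg_snd.
- by move=> t _; split=> // x.
Qed.

Lemma isotopic_to_id_comp f g :
  isotopic_to_id f -> isotopic_to_id g -> isotopic_to_id (g \o f).
Proof.
move=> [H1 [G1 [[c1 b1 i1] <-]]] [H2 [G2 [[c2 b2 i2] <-]]].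
exists (fun t => H2 t \o H1 t), (fun t => G1 t \o G2 t); split=> //.
have in01 t : t \in `[0, 1] -> (`[0, 1]%classic : set R) t by [].
split.
- refine (@within_continuous_comp _ _ _ (`[0, 1] `*` setT : set (R * E3)%type) _
    (fun p : R * E3 => (p.1, H1 p.1 p.2)) (fun p => H2 p.1 p.2) _ c2 _).
    apply/subspace_continuousP => p Ap; apply: cvg_prod_of.
      by apply: cvg_within_filter; exact: cvg_fst.
    by move/subspace_continuousP: c1; exact.
  by move=> _ [p [pt _] <-]; split.
- move=> t t01; have [u1 u2 u3 u4] := b1 t t01; have [v1 v2 v3 v4] := b2 t t01.
  split; [| |exact: can_comp|exact: can_comp].
  + by move=> x; apply: continuous_comp; [exact: u1|exact: v1].
  + by move=> x; apply: continuous_comp; [exact: v2|exact: u2].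
- by move=> p /=; rewrite i1 i2.
Qed.

Lemma ambient_isotopic_trans (K L M : set E3) :
  ambient_isotopic K L -> ambient_isotopic L M -> ambient_isotopic K M.
Proof.
move=> /ambient_isotopicE[f fi <-] /ambient_isotopicE[g gi <-].
apply/ambient_isotopicE; exists (g \o f); first exact: isotopic_to_id_comp.
by rewrite image_comp.
Qed.

(** The family [G t] cannot serve as the isotopy, because nothing is assumed about its continuity in
    [t]. Running [H] backwards after [G 1] involves only the joint continuity of [H]. *)
Lemma isotopic_to_id_inv f : isotopic_to_id f ->
  exists2 g, isotopic_to_id g & cancel f g /\ cancel g f.
Proof.
move=> [H [G [[cH bH iH] <-]]].
have in1 : (1 : R) \in `[0, 1] by rewrite in_itv /= ler01 lexx.
have in0 : (0 : R) \in `[0, 1] by rewrite in_itv /= ler01 lexx.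
have [_ cG1 HK GK] := bH 1 in1.
have [_ _ HK0 GK0] := bH 0 in0.
have iG p : G 0 p = p by rewrite -[p in G 0 p]iH HK0.
have onem t : t \in `[0, 1] -> 1 - t \in (`[0, 1] : interval R).
  by rewrite !in_itv /= => /andP[? ?]; apply/andP; split; lra.
exists (G 1) => //.
exists (fun t => H (1 - t) \o G 1), (fun t => H 1 \o G (1 - t)); split.
- split.
  + refine (@within_continuous_comp _ _ _ (`[0, 1] `*` setT : set (R * E3)%type) _
      (fun p : R * E3 => (1 - p.1, G 1 p.2)) (fun p => H p.1 p.2) _ cH _).
      apply/subspace_continuousP => p Ap; apply: cvg_within_filter.
      apply: cvg_prod_of; last first.
        by apply: (continuous_cvg _ (cG1 _)); exact: cvg_snd.
      by apply: cvgB; [exact: cvg_cst|exact: cvg_fst].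
    by move=> _ [p [pt _] <-]; split => //; exact: onem.
  + move=> t t01; have [u1 u2 u3 u4] := bH _ (onem t t01).
    have [v1 v2 v3 v4] := bH 1 in1.
    split; [| |exact: can_comp|exact: can_comp].
    * by move=> x; apply: continuous_comp; [exact: v2|exact: u1].
    * by move=> x; apply: continuous_comp; [exact: u2|exact: v1].
  + by move=> p /=; rewrite subr0 GK.
- by apply/funext => p /=; rewrite subrr iH.
Qed.

Lemma ambient_isotopic_sym (K L : set E3) :
  ambient_isotopic K L -> ambient_isotopic L K.
Proof.
move=> /ambient_isotopicE[f fi <-]; apply/ambient_isotopicE.
have [g gi [fK gK]] := isotopic_to_id_inv fi.
exists g => //; rewrite image_comp; apply/seteqP; split => [_ [x Kx <-] /=|x Kx].
  by rewrite fK.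
by exists x => //=; rewrite fK.
Qed.

Lemma isotopic_to_id_conj f (r r' : E3 -> E3) :
  continuous r -> continuous r' -> cancel r r' -> cancel r' r ->
  isotopic_to_id f -> isotopic_to_id (r \o f \o r').
Proof.
move=> cr cr' rK r'K [H [G [[cH bH iH] <-]]].
exists (fun t => r \o H t \o r'), (fun t => r \o G t \o r'); split=> //; split.
- refine (@within_continuous_comp _ _ _ (`[0, 1] `*` setT : set (R * E3)%type) _
     (fun p : R * E3 => (p.1, r' p.2)) (fun p => r (H p.1 p.2)) _ _ _).
  + apply/subspace_continuousP => p Ap; apply: cvg_within_filter.
    apply: cvg_prod_of; first exact: cvg_fst.
    by apply: (continuous_cvg _ (cr' _)); exact: cvg_snd.
  + apply/subspace_continuousP => p Ap; apply: (continuous_cvg _ (cr _)).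
    by move/subspace_continuousP: cH; exact.
  + by move=> _ [p [pt _] <-]; split.
- move=> t t01; have [u1 u2 u3 u4] := bH t t01; split.
  + move=> x; apply: continuous_comp; first exact: cr'.
    by apply: continuous_comp; [exact: u1|exact: cr].
  + move=> x; apply: continuous_comp; first exact: cr'.
    by apply: continuous_comp; [exact: u2|exact: cr].
  + by move=> p /=; rewrite rK u3 r'K.
  + by move=> p /=; rewrite rK u4 r'K.
- by move=> p /=; rewrite iH r'K.
Qed.

Lemma isotopic_to_id_joint (H G : R -> E3 -> E3) :
  continuous (fun p : R * E3 => H p.1 p.2) ->
  (forall t, t \in `[0, 1] ->
     [/\ continuous (G t), cancel (H t) (G t) & cancel (G t) (H t)]) ->
  (forall p, H 0 p = p) -> isotopic_to_id (H 1).
Proof.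
move=> cH bH H0; exists H, G; split=> //; split => //.
  exact: continuous_subspaceT.
move=> t /bH[? ? ?]; split => // p.
apply: (@continuous_comp _ _ _ (fun p => (t, p)) (fun p => H p.1 p.2)).
  by apply: cvg_prod_of; [exact: cvg_cst|exact: cvg_id].
exact: cH.
Qed.

(** For a displacement multiplied by the time, joint continuity is automatic; only the inverses of
    the stages have to be supplied. *)
Lemma isotopic_to_id_straight (d : E3 -> E3) (G : R -> E3 -> E3) :
  continuous d ->
  (forall t, t \in `[0, 1] ->
    [/\ continuous (G t), cancel (fun p => p + t *: d p) (G t)
      & cancel (G t) (fun p => p + t *: d p)]) ->
  isotopic_to_id (fun p => p + d p).
Proof.
move=> cd bG.
have -> : (fun p => p + d p) = (fun t p => p + t *: d p) (1 : R).
  by apply/funext => p; rewrite scale1r.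
apply: (@isotopic_to_id_joint (fun t p => p + t *: d p) G) => //.
  move=> p; apply: cvgD; first exact: cvg_snd.
  apply: cvgZ; first exact: cvg_fst.
  by apply: (continuous_cvg _ (cd _)); exact: cvg_snd.
by move=> p; rewrite scale0r addr0.
Qed.

End Isotopies.

(** * Straightening arcs inside a wedge *)

Section FibreShift.
Context {R : realType}.
Notation E3 := (space3 R).
Implicit Types b c : R * R -> R.

(** A tent in homogeneous form: [A] and [B] are the distances of a point from the two ends of an
    interval, and the apex is where they are in the ratio [al : be]. The length of the interval
    never appears as a denominator, so intervals may shrink to a point. *)
Definition hat (al be A B : R) : R := Num.max 0 (Num.min (A / al) (B / be)).

Lemma hat0 (al be A B : R) : 0 < al -> 0 < be -> A <= 0 \/ B <= 0 -> hat al be A B = 0.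
Proof.
move=> al0 be0 h; rewrite /hat max_l // ge_min.
by case: h => h; [rewrite ler_pdivrMr // mul0r h|rewrite orbC ler_pdivrMr // mul0r h].
Qed.

Lemma hat_gt0 (al be A B : R) : 0 < al -> 0 < be -> 0 < A -> 0 < B ->
  [/\ 0 < hat al be A B, hat al be A B * al <= A & hat al be A B * be <= B].
Proof.
move=> al0 be0 A0 B0.
have m0 : 0 < Num.min (A / al) (B / be) by rewrite lt_min !divr_gt0.
rewrite /hat (max_r (ltW m0)); split => //; first by rewrite -ler_pdivlMr // ge_min lexx.
by rewrite -ler_pdivlMr // ge_min lexx orbT.
Qed.

(** The move is linear on either side of the apex and preserves whichever of [A / al], [B / be]
    realises the minimum. As the hat keeps its value, the move by [- e] undoes the move by [e]. *)
Lemma hat_shift (al be e A B : R) : 0 < al -> 0 < be -> 0 < al + e -> 0 < be - e ->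
  hat (al + e) (be - e) (A + hat al be A B * e) (B - hat al be A B * e) = hat al be A B.
Proof.
move=> al0 be0 al1 be1.
have [A0|A0] := leP A 0.
  by rewrite (hat0 al0 be0 (or_introl A0)) mul0r addr0 subr0 hat0 //; left.
have [B0|B0] := leP B 0.
  by rewrite (hat0 al0 be0 (or_intror B0)) mul0r addr0 subr0 hat0 //; right.
have [m0 mA mB] := hat_gt0 al0 be0 A0 B0.
have mE : hat al be A B = Num.min (A / al) (B / be).
  by rewrite /hat max_r // ltW // lt_min !divr_gt0.
move: m0 mA mB mE; set m := hat al be A B => m0 mA mB mE.
have A'm : m <= (A + m * e) / (al + e) by rewrite ler_pdivlMr //; lra.
have B'm : m <= (B - m * e) / (be - e) by rewrite ler_pdivlMr //; lra.
rewrite /hat max_r; last by rewrite le_min !(le_trans (ltW m0)).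
have [le|le] := leP (A / al) (B / be).
  have mE' : m * al = A by rewrite mE min_l // divfK // gt_eqF.
  have -> : A + m * e = m * (al + e) by rewrite -mE'; ring.
  by rewrite mulfK ?gt_eqF // min_l.
have mE' : m * be = B by rewrite mE min_r ?divfK ?gt_eqF // ltW.
have -> : B - m * e = m * (be - e) by rewrite -mE'; ring.
by rewrite mulfK ?gt_eqF // min_r.
Qed.

Definition tent (b A B : R) : R := hat (1 + b) (1 - b) A B.

Lemma tent_id (b c A B : R) : `|b| < 1 -> `|c| < 1 ->
  tent c (A + tent b A B * (c - b)) (B - tent b A B * (c - b)) = tent b A B.
Proof.
rewrite !ltr_norml => /andP[b1 b2] /andP[c1 c2]; rewrite {1}/tent.
have -> : 1 + c = 1 + b + (c - b) by ring.
have -> : 1 - c = 1 - b - (c - b) by ring.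
by apply: hat_shift; lra.
Qed.

Lemma tent0 (b A B : R) : `|b| < 1 -> A <= 0 \/ B <= 0 -> tent b A B = 0.
Proof. by rewrite ltr_norml => /andP[b1 b2]; apply: hat0; lra. Qed.

Lemma tent_peak (b x : R) : `|b| < 1 -> 0 <= x -> tent b (x + b * x) (x - b * x) = x.
Proof.
rewrite ltr_norml => /andP[b1 b2] x0; rewrite /tent /hat.
have -> : x + b * x = x * (1 + b) by ring.
have -> : x - b * x = x * (1 - b) by ring.
by rewrite !mulfK ?minxx ?max_r // gt_eqF //; lra.
Qed.

(** On each segment |y| <= x with x and z fixed this is the piecewise linear map that fixes both
    ends and takes the point of slope [b] to the point of slope [c]. *)
Definition fibre_shift b c (p : E3) : E3 :=
  ((p.1.1, p.1.2 + tent (b (p.1.1, p.2)) (p.1.1 + p.1.2) (p.1.1 - p.1.2) *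
      (c (p.1.1, p.2) - b (p.1.1, p.2))), p.2).

Lemma fibre_shiftK b c : (forall q, `|b q| < 1) -> (forall q, `|c q| < 1) ->
  cancel (fibre_shift b c) (fibre_shift c b).
Proof.
move=> hb hc [[x y] z]; rewrite /fibre_shift /=; congr (_, _, _).
rewrite addrA opprD addrA tent_id // -addrA -mulrDr.
by rewrite addrC [X in _ * X](_ : _ = 0) ?mulr0 ?add0r //; ring.
Qed.

Lemma fibre_shift_cont b c : (forall q, `|b q| < 1) ->
  continuous b -> continuous c -> continuous (fibre_shift b c).
Proof.
move=> hb cb cc p.
have := hb (p.1.1, p.2); rewrite ltr_norml => /andP[b1 b2].
by rewrite /continuous_at /fibre_shift /tent /hat; cts; rewrite gt_eqF //; lra.
Qed.

Lemma fibre_shift_out b c (p : E3) : (forall q, `|b q| < 1) -> p.1.1 <= `|p.1.2| ->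
  fibre_shift b c p = p.
Proof.
move=> hb; rewrite ler_normr => h; rewrite /fibre_shift tent0 //.
  by case: p {h} => -[x y] z /=; rewrite mul0r addr0.
by case/orP: h => h; [right|left]; lra.
Qed.

Lemma fibre_shift_val b c (x z : R) : (forall q, `|b q| < 1) -> 0 <= x ->
  fibre_shift b c ((x, b (x, z) * x), z) = ((x, c (x, z) * x), z).
Proof.
by move=> hb x0; rewrite /fibre_shift /= tent_peak //; congr (_, _, _); ring.
Qed.

Lemma fibre_shift_isotopic b c : (forall q, `|b q| < 1) -> (forall q, `|c q| < 1) ->
  continuous b -> continuous c -> isotopic_to_id (fibre_shift b c).
Proof.
move=> hb hc cb cc.
pose bt (t : R) q := b q + t * (c q - b q).
have -> : fibre_shift b c = fun p => p + (fibre_shift b c p - p).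
  by apply/funext => p; rewrite addrC subrK.
have bt1 t q : t \in `[0, 1] -> `|bt t q| < 1.
  rewrite in_itv /= => /andP[t0 t1]; have := hb q; have := hc q; rewrite /bt.
  rewrite !ltr_norml => /andP[c1 c2] /andP[b1 b2].
  have [->|tn0] := eqVneq t 0; first by apply/andP; split; lra.
  have tp : 0 < t by rewrite lt_neqAle eq_sym tn0.
  have k1 : 0 < t * (1 + c q) by apply: mulr_gt0 => //; lra.
  have k2 : 0 <= (1 - t) * (1 + b q) by apply: mulr_ge0; lra.
  have k3 : 0 < t * (1 - c q) by apply: mulr_gt0 => //; lra.
  have k4 : 0 <= (1 - t) * (1 - b q) by apply: mulr_ge0; lra.
  by apply/andP; split; lra.
have cbt t : continuous (bt t).
  by move=> q; rewrite /continuous_at /bt; cts.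
(* The displacement is proportional to [c - b], so every stage is again a fibre shift, with an
   explicit inverse. *)
have E t : (fun p => p + t *: (fibre_shift b c p - p)) = fibre_shift b (bt t).
  apply/funext => -[[x y] z]; rewrite /fibre_shift /bt /=.
  congr (_, _, _) => /=; last by rewrite subrr scaler0 addr0.
    by rewrite subrr scaler0 addr0.
  by rewrite /GRing.scale /=; ring.
apply: (@isotopic_to_id_straight _ _ (fun t => fibre_shift (bt t) b)).
  by move=> p; apply: cvgB; [exact: fibre_shift_cont|exact: cvg_id].
move=> t t01; rewrite E; split.
- by apply: fibre_shift_cont => // q; exact: bt1.
- by apply: fibre_shiftK => // q; exact: bt1.
- by apply: fibre_shiftK => // q; exact: bt1.
Qed.

End FibreShift.

(** * Slides along rays of constant slope *)

Section Slide.
Context {R : realType}.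
Notation E3 := (space3 R).

Definition ramp (P x : R) : R := Num.min 1 (x / P).

Lemma ramp_ge0 P x : 0 <= P -> 0 <= x -> 0 <= ramp P x.
Proof. by move=> P0 x0; rewrite /ramp le_min ler01 divr_ge0. Qed.

Lemma ramp_le1 P x : ramp P x <= 1.
Proof. by rewrite /ramp ge_min lexx. Qed.

Lemma ramp_mul P x : 0 < P -> 0 <= x -> ramp P x * P <= x.
Proof.
move=> P0 x0; apply: (@le_trans _ _ (x / P * P)).
  by rewrite ler_pM2r // /ramp ge_min lexx orbT.
by rewrite divfK // gt_eqF.
Qed.

Lemma ramp_shift_gt0 P D x : 0 < P -> 0 < P + D -> 0 < x -> 0 < x + ramp P x * D.
Proof.
move=> P0 PD x0; have k0 := ramp_ge0 (ltW P0) (ltW x0).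
have kx := ramp_mul P0 (ltW x0); set k := ramp P x in k0 kx *.
have [->|kn0] := eqVneq k 0; first by rewrite mul0r addr0.
have kp : 0 < k by rewrite lt_neqAle eq_sym kn0.
have : 0 < k * (P + D) by exact: mulr_gt0.
by rewrite mulrDr; lra.
Qed.

Lemma ramp_shift P D x : 0 < P -> 0 < P + D -> 0 < x ->
  ramp (P + D) (x + ramp P x * D) = ramp P x.
Proof.
move=> P0 PD x0; rewrite {2 3}/ramp.
have [xP|xP] := leP 1 (x / P).
  rewrite /ramp mul1r min_l // ler_pdivlMr // mul1r lerD2r.
  by move: xP; rewrite ler_pdivlMr // mul1r.
have -> : x + x / P * D = x / P * (P + D) by field; rewrite gt_eqF.
by rewrite /ramp mulfK ?gt_eqF // min_r // ltW.
Qed.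

Variables (P Dx Dz : R -> R).

(** On the ray of slope [th] the marked point at x = [P th] receives the full displacement, points
    nearer to the axis a proportional part, and points further out the full one again. Where
    [P th = 0] the ramp is 0, because a quotient by 0 is 0. *)
Definition slide_disp (p : E3) : E3 :=
  if p.1.1 <= 0 then 0 else
  let th := p.1.2 / p.1.1 in let k := ramp (P th) p.1.1 in
  ((k * Dx th, th * (k * Dx th)), k * Dz th).

Hypotheses (cP : continuous P) (cDx : continuous Dx) (cDz : continuous Dz).
Hypothesis P_ge0 : forall th, 0 <= P th.
Hypothesis P0x : forall th, P th = 0 -> Dx th = 0.
Hypothesis P0z : forall th, P th = 0 -> Dz th = 0.
Hypothesis Dx_out : forall th, 1 <= `|th| -> Dx th = 0.
Hypothesis Dz_out : forall th, 1 <= `|th| -> Dz th = 0.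

(** At x = 0 the slope has no limit, so continuity there needs a bound uniform in [th]. Near a slope
    with [P = 0] the factor [D] is small; near any other slope [P] is bounded below and the ramp is
    small. Compactness of the interval of slopes joins the two cases. *)
Lemma ramp_small (D : R -> R) : continuous D ->
  (forall th, P th = 0 -> D th = 0) -> (forall th, 1 <= `|th| -> D th = 0) ->
  forall e : R, 0 < e -> exists2 d : R, 0 < d &
    forall th x, 0 < x -> x < d -> `|ramp (P th) x * D th| < e.
Proof.
move=> cD PD0 Dout e e0.
have : \forall x \near (0 : R), `[-1, 1]%classic `<=`
    (fun th => 0 < x -> `|ramp (P th) x * D th| < e).
  have /compact_near_coveringP K := @segment_compact R (-1) 1.
  apply: (K R (nbhs (0 : R)) (fun x th => 0 < x -> `|ramp (P th) x * D th| < e)) => th _.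
  have kle th' x : 0 < x -> `|ramp (P th') x * D th'| <= `|D th'|.
    move=> x0; rewrite normrM ler_piMl // ger0_norm ?ramp_le1 //.
    exact: ramp_ge0 (P_ge0 _) (ltW x0).
  have [PE|Pn0] := eqVneq (P th) 0.
    have De : \forall th' \near th, `|D th'| < e.
      have cDth : D x @[x --> th] --> D th := cD th; move/cvgr_norm_lt: cDth; rewrite PD0 // normr0; exact.
    exists ([set th' | `|D th'| < e], setT); first by split => //; exact: filterT.
    by move=> [th' x] [/= h _] x0; apply: le_lt_trans h; exact: kle.
  have Pp : 0 < P th by rewrite lt_neqAle eq_sym Pn0 P_ge0.
  have PE : \forall th' \near th, P th / 2 < P th'.
    by have cPth : P x @[x --> th] --> P th := @cP th; move/cvgr_gt: cPth; apply; lra.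
  have DE : \forall th' \near th, `|D th'| < `|D th| + 1.
    by have cDth : D x @[x --> th] --> D th := cD th; move/cvgr_norm_lt: cDth; apply; lra.
  pose dl := e * (P th / 2) / (`|D th| + 1).
  have D1 : 0 < `|D th| + 1 by rewrite ltr_wpDl.
  have dl0 : 0 < dl by rewrite /dl !mulr_gt0 ?invr_gt0.
  have dE : \forall x \near (0 : R), x < dl by exact: lt_nbhsl.
  exists ([set th' | P th / 2 < P th' /\ `|D th'| < `|D th| + 1], [set x | x < dl]).
    by split => //=; apply: filterI.
  move=> [th' x] [/= [h1 h2] h3] x0.
  have P'0 : 0 < P th' by apply: lt_trans h1; lra.
  rewrite normrM ger0_norm; last exact: ramp_ge0 (P_ge0 _) (ltW x0).
  have k0 := ramp_ge0 (P_ge0 th') (ltW x0).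
  have kx : ramp (P th') x * (P th / 2) <= x.
    by apply: le_trans (ramp_mul P'0 (ltW x0)); rewrite ler_wpM2l // ltW.
  have : ramp (P th') x <= x / (P th / 2) by rewrite ler_pdivlMr //; lra.
  move=> kle'.
  apply: (@le_lt_trans _ _ (x / (P th / 2) * (`|D th| + 1))).
    by apply: ler_pM => //; exact: ltW.
  rewrite -ltr_pdivlMr // ltr_pdivrMr; last lra.
  by apply: (lt_le_trans h3); rewrite /dl mulrAC.
move=> /nbhs_ballP[d /= d0 H]; exists d => // th x x0 xd.
have [th1|th1] := leP 1 `|th|; first by rewrite Dout // mulr0 normr0.
apply: (H x) => //.
  by rewrite /ball /= sub0r normrN gtr0_norm.
by move: th1; rewrite ltr_norml /= in_itv /= => /andP[/ltW -> /ltW ->].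
Qed.

Lemma ramp_cont (D : R -> R) (p : E3) : continuous D ->
  (forall th, P th = 0 -> D th = 0) -> 0 < p.1.1 ->
  ramp (P (q.1.2 / q.1.1)) q.1.1 * D (q.1.2 / q.1.1) @[q --> p] -->
  ramp (P (p.1.2 / p.1.1)) p.1.1 * D (p.1.2 / p.1.1).
Proof.
move=> cD PD0 x0; set th := p.1.2 / p.1.1.
have cth : q.1.2 / q.1.1 @[q --> p] --> th by cts; rewrite gt_eqF.
have [PE|Pn0] := eqVneq (P th) 0; last first.
  by rewrite /ramp; cts.
(* Where [P] vanishes the ramp may jump, but it stays between 0 and 1 while [D] tends to 0. *)
rewrite PD0 // mulr0.
apply/cvgr0Pnorm_lt => e e0.
have De : \forall q \near p, `|D (q.1.2 / q.1.1)| < e.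
  have /cvgr_norm_lt : D (q.1.2 / q.1.1) @[q --> p] --> D th by cts.
  by rewrite PD0 // normr0; apply.
have xp : \forall q \near p, 0 < q.1.1.
  have : q.1.1 @[q --> p] --> p.1.1 by cts.
  by move/cvgr_gt; apply.
near=> q; apply: (@le_lt_trans _ _ `|D (q.1.2 / q.1.1)|); last by near: q.
have q0 : 0 < q.1.1 by near: q.
rewrite normrM ler_piMl // ger0_norm ?ramp_le1 //.
exact: ramp_ge0 (P_ge0 _) (ltW q0).
Unshelve. all: by end_near. Qed.

Lemma slide_disp_cont : continuous slide_disp.
Proof.
move=> p; rewrite /continuous_at {2}/slide_disp.
have [x0|x0] := leP p.1.1 0.
  have key e : 0 < e -> \forall q \near p, [/\ `|(slide_disp q).1.1| < e,
      `|(slide_disp q).1.2| < e & `|(slide_disp q).2| < e].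
    move=> e0; have [d1 d10 h1] := ramp_small cDx P0x Dx_out e0.
    have [d2 d20 h2] := ramp_small cDz P0z Dz_out e0.
    have xd : \forall q \near p, q.1.1 < Num.min d1 d2.
      have : q.1.1 @[q --> p] --> p.1.1 by cts.
      by move/cvgr_lt; apply; rewrite lt_min; apply/andP; split; exact: le_lt_trans x0 _.
    near=> q; have := near xd q; rewrite lt_min => /(_ _)/andP[//|q1 q2].
    rewrite /slide_disp; have [q0|q0] := leP q.1.1 0; first by rewrite /= normr0.
    split => /=; [exact: h1| |exact: h2].
    set th := q.1.2 / q.1.1; have [th1|th1] := leP 1 `|th|.
      by rewrite Dx_out // !mulr0 normr0.
    rewrite normrM; apply: (@le_lt_trans _ _ `|ramp (P th) q.1.1 * Dx th|).
      by rewrite ler_piMl // ltW.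
    exact: h1.
  apply: cvg_space3; apply/cvgr0Pnorm_lt => e e0; near=> q.
  - by have [] := near (key e e0) q.
  - by have [] := near (key e e0) q.
  - by have [] := near (key e e0) q.
have xp : \forall q \near p, 0 < q.1.1.
  have : q.1.1 @[q --> p] --> p.1.1 by cts.
  by move/cvgr_gt; apply.
have E : \forall q \near p, slide_disp q =
    ((ramp (P (q.1.2 / q.1.1)) q.1.1 * Dx (q.1.2 / q.1.1),
      q.1.2 / q.1.1 * (ramp (P (q.1.2 / q.1.1)) q.1.1 * Dx (q.1.2 / q.1.1))),
      ramp (P (q.1.2 / q.1.1)) q.1.1 * Dz (q.1.2 / q.1.1)).
  by near=> q; rewrite /slide_disp leNgt (near xp q).
apply: (cvg_near_eq E).
have h1 := ramp_cont cDx P0x x0; have h2 := ramp_cont cDz P0z x0.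
have cth : q.1.2 / q.1.1 @[q --> p] --> p.1.2 / p.1.1 by cts; rewrite gt_eqF.
by apply: cvg_space3 => //=; apply: cvgM.
Unshelve. all: by end_near. Qed.

End Slide.

Section SlideIsotopy.
Context {R : realType}.
Notation E3 := (space3 R).

(** The inverse is a slide with opposite displacements whose ramp ends at the new position [P + Dx]
    of the marked point. Slopes are preserved, so both slides read the same [th]. *)
Lemma slide_dispK (P Dx Dz : R -> R) (p : E3) :
  (forall th, 0 <= P th) -> (forall th, P th = 0 -> Dx th = 0) ->
  (forall th, P th = 0 -> Dz th = 0) -> (forall th, 0 < P th -> 0 < P th + Dx th) ->
  let p' := p + slide_disp P Dx Dz p in
  p' + slide_disp (fun th => P th + Dx th) (fun th => - Dx th) (fun th => - Dz th) p' = p.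
Proof.
move=> P0 Px Pz PD p'; rewrite {}/p'.
case: p => -[x y] z; rewrite {1 3}/slide_disp /=.
have [x0|x0] := leP x 0.
  by rewrite addr0 /slide_disp /= x0 addr0.
set th := y / x; set k := ramp (P th) x.
have [PE|Pn0] := eqVneq (P th) 0.
  rewrite Px // Pz // !mulr0 addr0 /slide_disp /= leNgt x0 /= -/th Px // Pz //.
  by rewrite oppr0 !mulr0 addr0.
have Pp : 0 < P th by rewrite lt_neqAle eq_sym Pn0 P0.
have x'0 : 0 < x + k * Dx th by exact: ramp_shift_gt0 (PD _ _) _.
rewrite /slide_disp /= leNgt x'0 /=.
have -> : (y + th * (k * Dx th)) / (x + k * Dx th) = th.
  by rewrite /th; field; rewrite !gt_eqF.
have -> : ramp (P th + Dx th) (x + k * Dx th) = k by exact: ramp_shift (PD _ _) _.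
by congr (_, _, _) => /=; ring.
Qed.

Variables (P Q W : R -> R).
Hypotheses (cP : continuous P) (cQ : continuous Q) (cW : continuous W).
Hypotheses (P_ge0 : forall th, 0 <= P th) (Q_ge0 : forall th, 0 <= Q th).
Hypothesis PQ0 : forall th, P th = 0 <-> Q th = 0.
Hypothesis P0W : forall th, P th = 0 -> W th = 0.
Hypothesis Pout : forall th, 1 <= `|th| -> P th = 0.

Definition slide (p : E3) : E3 :=
  p + slide_disp P (fun th => Q th - P th) W p.

Lemma slide_isotopic : isotopic_to_id slide.
Proof.
pose Dx th := Q th - P th; pose Dz := W.
have cDx : continuous Dx by move=> th; rewrite /continuous_at /Dx; cts.
have cDz : continuous Dz by [].
have P0x th : P th = 0 -> Dx th = 0.
  by move=> h; rewrite /Dx h (proj1 (PQ0 th) h) subrr.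
have P0z th : P th = 0 -> Dz th = 0 by exact: P0W.
have scE t p : t *: slide_disp P Dx Dz p =
    slide_disp P (fun th => t * Dx th) (fun th => t * Dz th) p.
  case: p => -[x y] z; rewrite /slide_disp /=; case: ifP => _; first by rewrite scaler0.
  by congr (_, _, _); rewrite /= /GRing.scale /=; ring.
pose Pt t th := P th + t * Dx th.
have Pt0 t th : t \in `[0, 1] -> 0 < P th -> 0 < Pt t th.
  rewrite in_itv /= => /andP[t0 t1] Pp; rewrite /Pt /Dx.
  have Qp : 0 < Q th.
    by rewrite lt_neqAle Q_ge0 andbT eq_sym; apply/eqP => /PQ0 h; rewrite h ltxx in Pp.
  have -> : P th + t * (Q th - P th) = (1 - t) * P th + t * Q th by ring.
  have [->|tn0] := eqVneq t 0; first by rewrite subr0 mul1r mul0r addr0.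
  rewrite ltr_wpDl ?mulr_ge0 ?subr_ge0 // mulr_gt0 //.
  by rewrite lt_neqAle eq_sym tn0.
have Pt0' t th : t \in `[0, 1] -> Pt t th = 0 -> P th = 0.
  move=> t01 E; apply/eqP; case: eqP => // /eqP h.
  have : 0 < P th by rewrite lt_neqAle eq_sym h P_ge0.
  by move/(Pt0 _ _ t01); rewrite E ltxx.
have PtE t th : P th = 0 -> Pt t th = 0 by move=> h; rewrite /Pt h P0x // mulr0 addr0.
apply: (@isotopic_to_id_straight _ _
  (fun t p => p + slide_disp (Pt t) (fun th => - (t * Dx th)) (fun th => - (t * Dz th)) p)).
  apply: slide_disp_cont => // th /Pout h; [exact: P0x|exact: P0z].
move=> t t01; split.
- move=> p; apply: cvgD; first exact: cvg_id.
  apply: slide_disp_cont.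
  + by move=> th; rewrite /continuous_at /Pt; cts.
  + by move=> th; rewrite /continuous_at; cts.
  + by move=> th; rewrite /continuous_at; cts.
  + move=> th; have [h|h] := eqVneq (P th) 0; first by rewrite PtE.
    by apply/ltW/Pt0 => //; rewrite lt_neqAle eq_sym h P_ge0.
  + by move=> th /(Pt0' _ _ t01) /P0x ->; rewrite mulr0 oppr0.
  + by move=> th /(Pt0' _ _ t01) /P0z ->; rewrite mulr0 oppr0.
  + by move=> th /Pout /P0x ->; rewrite mulr0 oppr0.
  + by move=> th /Pout /P0z ->; rewrite mulr0 oppr0.
- move=> p; rewrite scE; apply: slide_dispK => // th.
  + by move/P0x ->; rewrite mulr0.
  + by move/P0z ->; rewrite mulr0.
  + exact: Pt0.
- move=> p; rewrite scE.
  have := @slide_dispK (Pt t) (fun th => - (t * Dx th)) (fun th => - (t * Dz th)) p.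
  have -> : (fun th => Pt t th + - (t * Dx th)) = P.
    by apply/funext => th; rewrite /Pt; ring.
  have E f : (fun th : R => - - (t * f th)) = (fun th => t * f th).
    by apply/funext => th; rewrite opprK.
  rewrite !E; apply.
  + move=> th; have [h|h] := eqVneq (P th) 0; first by rewrite PtE.
    by apply/ltW/Pt0 => //; rewrite lt_neqAle eq_sym h P_ge0.
  + by move=> th /(Pt0' _ _ t01) /P0x ->; rewrite mulr0 oppr0.
  + by move=> th /(Pt0' _ _ t01) /P0z ->; rewrite mulr0 oppr0.
  + move=> th h; have -> : Pt t th + - (t * Dx th) = P th by rewrite /Pt; ring.
    rewrite lt_neqAle P_ge0 andbT eq_sym; apply/eqP => h0.
    by rewrite PtE // ltxx in h.
Qed.

Lemma slide_out (p : E3) : p.1.1 <= `|p.1.2| -> slide p = p.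
Proof.
case: p => -[x y] z /= h; rewrite /slide /slide_disp /=.
have [x0|x0] := leP x 0; first by rewrite addr0.
have th1 : 1 <= `|y / x|.
  by rewrite normrM normfV (gtr0_norm x0) ler_pdivlMr // mul1r.
have PE := Pout th1.
by rewrite P0W // PE (proj1 (PQ0 _) PE) subrr !mulr0 addr0.
Qed.

Lemma slide_val th z : slide ((P th, th * P th), z) = ((Q th, th * Q th), z + W th).
Proof.
rewrite /slide /slide_disp /=; have [h|h] := leP (P th) 0.
  have PE : P th = 0 by apply/eqP; rewrite eq_le h P_ge0.
  by rewrite addr0 PE (proj1 (PQ0 _) PE) P0W // addr0.
have n0 : P th != 0 by rewrite gt_eqF.
rewrite mulfK // /ramp divff // minxx !mul1r.
by congr (_, _, _) => /=; ring.
Qed.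

End SlideIsotopy.

(** * Extension of functions from disjoint arcs to the plane *)

Section PathFamilies.
Context {R : realType} {J : finType}.

(** Disjointness of the arcs makes the prescribed values a function on their union, which is
    compact; Tietze's theorem extends it with the same bound. *)
Lemma extend_from_arcs (a : pred J) (g : J -> R -> R * R) (v : J -> R -> R) (M : R) :
  0 < M -> (forall j, continuous (g j)) -> (forall j, continuous (v j)) ->
  (forall j j' (u u' : R), a j -> a j' -> u \in `[0, 1] -> u' \in `[0, 1] ->
     g j u = g j' u' -> j = j' /\ u = u') ->
  (forall j (u : R), u \in `[0, 1] -> `|v j u| <= M) ->
  exists b : R * R -> R, [/\ continuous b, forall q, `|b q| <= M &
     forall j (u : R), a j -> u \in `[0, 1] -> b (g j u) = v j u].
Proof.
move=> M0 cg cv inj vM.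
pose A := \bigcup_(j in [set j | a j]) (g j @` `[0, 1]).
have [f fE] : {f : R * R -> R | forall j (u : R), a j -> u \in `[0, 1] -> f (g j u) = v j u}.
  pose S q := [set ju : J * R | [/\ a ju.1, ju.2 \in `[0, 1] & g ju.1 ju.2 = q]].
  have dec q : {w | (exists ju, S q ju) -> exists2 ju, S q ju & w = v ju.1 ju.2}.
    apply: cid; have [[ju h]|h] := pselect (exists ju, S q ju).
      by exists (v ju.1 ju.2) => _; exists ju.
    by exists 0.
  exists (fun q => projT1 (dec q)) => j u aj u01.
  have := projT2 (dec (g j u)); case; first by exists (j, u).
  move=> [j' u'] /= [aj' u'01 E] ->.
  by have [/= -> ->] := inj _ _ _ _ aj' aj u'01 u01 E.
have compim j (C : set R) : closed C -> compact (g j @` (`[0, 1] `&` C)).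
  move=> cC; apply: continuous_compact; first exact: continuous_subspaceT.
  by apply: compact_closedI => //; exact: segment_compact.
have hR2 : hausdorff_space (R * R)%type by exact: norm_hausdorff.
have clA : closed A.
  apply: closed_bigcup; first exact: finite_finset.
  move=> j _; apply: compact_closed => //.
  by rewrite -[`[0, 1]%classic]setIT; apply: compim; exact: closedT.
(* The preimage of a closed set is a finite union of images of compact sets of parameters, so no
   continuous inverse of [g j] has to be built. *)
have cf : {within A, continuous f}.
  apply/continuous_closedP => C cC; apply/closed_subspaceP.
  exists (\bigcup_(j in [set j | a j]) (g j @` (`[0, 1] `&` (v j @^-1` C)))).
    apply: closed_bigcup; first exact: finite_finset.
    move=> j _; apply: compact_closed => //; apply: compim.
    by apply: closed_comp => // u _; exact: cv.
  apply/seteqP; split => q [].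
    move=> [j aj [u [u01 vu] <-]] Aq; split => //.
    by move: vu; rewrite /preimage /= -(fE _ _ aj u01).
  move=> fq [j aj [u u01 gE]]; split; last by exists j => //; exists u.
  exists j => //; exists u => //; split => //.
  by rewrite /preimage /= -(fE _ _ aj u01) gE.
have fM q : A q -> `|f q| <= M by move=> [j aj [u u01 <-]]; rewrite fE //; exact: vM.
have [b [fb cb bM]] := continuous_bounded_extension (@pseudometric_normal R _) clA M0 cf fM.
exists b; split => // j u aj u01; rewrite -fb ?fE // inE.
by exists j => //; exists u.
Qed.

End PathFamilies.

Section WedgeIsotopy.
Context {R : realType} {J : finType}.
Notation E3 := (space3 R).

Definition clamp (u : R) : R := Num.min 1 (Num.max 0 u).

Lemma clamp_in u : clamp u \in `[0, 1].
Proof. by rewrite in_itv /= le_min le_max lexx ler01 /= ge_min lexx. Qed.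

Lemma clamp_id u : u \in `[0, 1] -> clamp u = u.
Proof. by rewrite in_itv /= => /andP[u0 u1]; rewrite /clamp max_r // min_r. Qed.

Lemma clamp_le0 u : u <= 0 -> clamp u = 0.
Proof. by move=> u0; rewrite /clamp max_l // min_r. Qed.

Lemma clamp_ge1 u : 1 <= u -> clamp u = 1.
Proof. by move=> u1; rewrite /clamp max_r ?min_l // (le_trans ler01). Qed.

Lemma clamp_cont : continuous clamp.
Proof. by move=> u; rewrite /continuous_at /clamp; cts. Qed.

Let N : R := #|J|%:R.
(** The arc of rank k owns the slopes from (3k + 1) / (3N + 3) to (3k + 2) / (3N + 3), all strictly
    inside the wedge and with gaps in between. [slot_time] inverts this and is clamped, so that at a
    slope owned by one arc all others stand at one of their endpoints. *)
Let slot (j : J) (u : R) : R := (3 * (enum_rank j : nat)%:R + 1 + u) / (3 * N + 3).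
Let slot_time (j : J) (th : R) : R :=
  clamp ((3 * N + 3) * th - (3 * (enum_rank j : nat)%:R + 1)).

Let N3 : 0 < 3 * N + 3.
Proof. by rewrite ltr_wpDl // mulr_ge0 // /N ler0n. Qed.

Let slotK j u : u \in `[0, 1] -> slot_time j (slot j u) = u.
Proof.
move=> u01; rewrite /slot_time /slot -[RHS]clamp_id //; congr clamp.
by field; rewrite gt_eqF.
Qed.

Let slot_other j j' u : u \in `[0, 1] -> j' != j ->
  slot_time j' (slot j u) = 0 \/ slot_time j' (slot j u) = 1.
Proof.
rewrite in_itv /= => /andP[u0 u1] jj'; rewrite /slot_time.
have -> : (3 * N + 3) * slot j u = 3 * (enum_rank j : nat)%:R + 1 + u.
  by rewrite /slot; field; rewrite gt_eqF.
have : (enum_rank j' : nat) != enum_rank j.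
  by apply: contra jj' => /eqP/val_inj/enum_rank_inj/eqP.
rewrite neq_ltn => /orP[h|h].
  right; apply: clamp_ge1; have : (enum_rank j' : nat)%:R + 1 <= (enum_rank j : nat)%:R :> R.
    by rewrite natr1 ler_nat.
  by lra.
left; apply: clamp_le0; have : (enum_rank j : nat)%:R + 1 <= (enum_rank j' : nat)%:R :> R.
  by rewrite natr1 ler_nat.
by lra.
Qed.

Let slot_out j th : 1 <= `|th| -> slot_time j th = 0 \/ slot_time j th = 1.
Proof.
have kN : (enum_rank j : nat)%:R + 1 <= N by rewrite natr1 ler_nat.
have k0 : 0 <= (enum_rank j : nat)%:R :> R by rewrite ler0n.
rewrite ler_normr => /orP[h|h].
  by right; apply: clamp_ge1; have : (3 * N + 3) * 1 <= (3 * N + 3) * th;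
    [rewrite ler_pM2l|lra].
left; apply: clamp_le0; have : (3 * N + 3) * 1 <= (3 * N + 3) * - th; last lra.
by rewrite ler_pM2l.
Qed.

Let slot_lt1 j u : u \in `[0, 1] -> `|slot j u| <= (3 * N + 2) / (3 * N + 3).
Proof.
rewrite in_itv /= => /andP[u0 u1].
have kN : (enum_rank j : nat)%:R + 1 <= N by rewrite natr1 ler_nat.
have k0 : 0 <= (enum_rank j : nat)%:R :> R by rewrite ler0n.
rewrite /slot ger0_norm; last by rewrite divr_ge0 //; lra.
by rewrite ler_pM2r ?invr_gt0 //; lra.
Qed.

Let slot_cont j : continuous (slot j).
Proof. by move=> u; rewrite /continuous_at /slot; cts; rewrite gt_eqF. Qed.

Let slot_time_cont j : continuous (slot_time j).
Proof.
move=> th; rewrite /continuous_at /slot_time; apply: (continuous_cvg _ (@clamp_cont _)).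
by cts.
Qed.

Variable a : pred J.
Variables (xB zB tB xA zA : J -> R -> R) (c : R).
Hypotheses (cxB : forall j, continuous (xB j)) (czB : forall j, continuous (zB j)).
Hypotheses (ctB : forall j, continuous (tB j)).
Hypotheses (cxA : forall j, continuous (xA j)) (czA : forall j, continuous (zA j)).
Hypothesis injB : forall j j' (u u' : R), a j -> a j' -> u \in `[0, 1] -> u' \in `[0, 1] ->
  xB j u = xB j' u' -> zB j u = zB j' u' -> j = j' /\ u = u'.
Hypothesis injA : forall j j' (u u' : R), a j -> a j' -> u \in `[0, 1] -> u' \in `[0, 1] ->
  xA j u = xA j' u' -> zA j u = zA j' u' -> j = j' /\ u = u'.
Hypothesis xB_ge0 : forall j (u : R), a j -> u \in `[0, 1] -> 0 <= xB j u.
Hypothesis xA_ge0 : forall j (u : R), a j -> u \in `[0, 1] -> 0 <= xA j u.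
Hypothesis xB_eq0 : forall j (u : R), a j -> u \in `[0, 1] -> (xB j u = 0 <-> u = 0 \/ u = 1).
Hypothesis xA_eq0 : forall j (u : R), a j -> u \in `[0, 1] -> (xA j u = 0 <-> u = 0 \/ u = 1).
Hypotheses (z0E : forall j, a j -> zB j 0 = zA j 0) (z1E : forall j, a j -> zB j 1 = zA j 1).
Hypotheses (c_gt0 : 0 < c) (c_lt1 : c < 1).
Hypothesis tBc : forall j (u : R), u \in `[0, 1] -> `|tB j u| <= c.

(* Klee's trick: first give each arc its own range of slopes y / x inside the
   wedge, then move it at constant slope, and finally flatten it again. *)
Lemma wedge_isotopy : exists f : E3 -> E3, [/\ isotopic_to_id f,
   forall p, p.1.1 <= `|p.1.2| -> f p = p &
   forall j (u : R), a j -> u \in `[0, 1] ->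
     f ((xB j u, tB j u * xB j u), zB j u) = ((xA j u, 0), zA j u)].
Proof.
pose cs := (3 * N + 2) / (3 * N + 3).
have N0 : 0 <= N by rewrite /N ler0n.
have cs0 : 0 < cs by rewrite divr_gt0 //; lra.
have cs1 : cs < 1 by rewrite /cs ltr_pdivrMr //; lra.
have prodc (f g : R -> R) : continuous f -> continuous g -> continuous (fun u => (f u, g u)).
  by move=> cf cg u; rewrite /continuous_at; cts.
have inj2 f g : (forall j j' (u u' : R), a j -> a j' -> u \in `[0, 1] -> u' \in `[0, 1] ->
    f j u = f j' u' -> g j u = g j' u' -> j = j' /\ u = u') ->
  forall j j' (u u' : R), a j -> a j' -> u \in `[0, 1] -> u' \in `[0, 1] ->
    (f j u, g j u) = (f j' u', g j' u') :> R * R -> j = j' /\ u = u'.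
  by move=> h j j' u u' aj aj' u0 u0' [e1 e2]; exact: h.
have [b1 [cb1 b1M b1E]] := extend_from_arcs c_gt0 (fun j => prodc _ _ (@cxB j) (@czB j))
  (@ctB) (inj2 _ _ injB) tBc.
have [b2 [cb2 b2M b2E]] := extend_from_arcs cs0 (fun j => prodc _ _ (@cxB j) (@czB j))
  (@slot_cont) (inj2 _ _ injB) slot_lt1.
have [b3 [cb3 b3M b3E]] := extend_from_arcs cs0 (fun j => prodc _ _ (@cxA j) (@czA j))
  (@slot_cont) (inj2 _ _ injA) slot_lt1.
have lt1 (b : R * R -> R) d : d < 1 -> (forall q, `|b q| <= d) -> forall q, `|b q| < 1.
  by move=> d1 h q; exact: le_lt_trans (h q) d1.
have b1l := lt1 _ _ c_lt1 b1M; have b2l := lt1 _ _ cs1 b2M; have b3l := lt1 _ _ cs1 b3M.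
(* In the slot of an arc all other summands are taken at endpoints, where they vanish; each sum is
   thus the datum of one arc in its slot and 0 outside all slots. *)
pose P th := \sum_(j | a j) xB j (slot_time j th).
pose Q th := \sum_(j | a j) xA j (slot_time j th).
pose W th := \sum_(j | a j) (zA j (slot_time j th) - zB j (slot_time j th)).
have sumc (F : J -> R -> R) : (forall j, continuous (F j)) ->
    continuous (fun th => \sum_(j | a j) F j (slot_time j th)).
  move=> cF th; apply: cvg_sumr => j.
  by apply: (continuous_cvg _ (cF j _)); exact: slot_time_cont.
have cP : continuous P by exact: sumc.
have cQ : continuous Q by exact: sumc.
have cW : continuous W.
  apply: (sumc (fun j u => zA j u - zB j u)) => j u.
  by apply: cvgB; [exact: czA|exact: czB].
have P_ge0 th : 0 <= P th by apply: sumr_ge0 => j aj; apply: xB_ge0 => //; exact: clamp_in.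
have Q_ge0 th : 0 <= Q th by apply: sumr_ge0 => j aj; apply: xA_ge0 => //; exact: clamp_in.
have sum0 (F : J -> R -> R) th : (forall j, a j -> 0 <= F j (slot_time j th)) ->
    \sum_(j | a j) F j (slot_time j th) = 0 -> forall j, a j -> F j (slot_time j th) = 0.
  by move=> F0 /eqP; rewrite psumr_eq0 // => /allP h j aj;
     have /(_ (mem_index_enum j)) := h j; rewrite aj => /eqP.
have P0 th : P th = 0 -> forall j, a j -> slot_time j th = 0 \/ slot_time j th = 1.
  move=> h j aj; apply/(xB_eq0 aj (clamp_in _)); apply: (sum0 xB) => // i ai.
  by apply: xB_ge0 => //; exact: clamp_in.
have Q0 th : Q th = 0 -> forall j, a j -> slot_time j th = 0 \/ slot_time j th = 1.
  move=> h j aj; apply/(xA_eq0 aj (clamp_in _)); apply: (sum0 xA) => // i ai.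
  by apply: xA_ge0 => //; exact: clamp_in.
have PQ0 th : P th = 0 <-> Q th = 0.
  split=> [/P0|/Q0] h; apply: big1 => j aj.
    by apply/(xA_eq0 aj (clamp_in _)); exact: h.
  by apply/(xB_eq0 aj (clamp_in _)); exact: h.
have W0 j th : a j -> slot_time j th = 0 \/ slot_time j th = 1 ->
    zA j (slot_time j th) - zB j (slot_time j th) = 0.
  by move=> aj [] ->; rewrite ?z0E ?z1E // subrr.
have P0W th : P th = 0 -> W th = 0.
  by move=> /P0 h; apply: big1 => j aj; apply: W0 => //; exact: h.
have Pout th : 1 <= `|th| -> P th = 0.
  move=> h; apply: big1 => j aj.
  by apply/(xB_eq0 aj (clamp_in _)); exact: slot_out.
have PE j u : a j -> u \in `[0, 1] -> P (slot j u) = xB j u.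
  move=> aj u01; rewrite /P (bigD1 j) //= slotK // big1 ?addr0 // => i /andP[ai ij].
  by apply/(xB_eq0 ai (clamp_in _)); exact: slot_other.
have QE j u : a j -> u \in `[0, 1] -> Q (slot j u) = xA j u.
  move=> aj u01; rewrite /Q (bigD1 j) //= slotK // big1 ?addr0 // => i /andP[ai ij].
  by apply/(xA_eq0 ai (clamp_in _)); exact: slot_other.
have WE j u : a j -> u \in `[0, 1] -> W (slot j u) = zA j u - zB j u.
  move=> aj u01; rewrite /W (bigD1 j) //= slotK // big1 ?addr0 // => i /andP[ai ij].
  by apply: W0 => //; exact: slot_other.
have zero1 : forall q : R * R, `|(fun=> 0 : R) q| < 1 by move=> q; rewrite normr0.
exists (fibre_shift b3 (fun=> 0) \o slide P Q W \o fibre_shift b1 b2); split.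
- apply: isotopic_to_id_comp; first exact: fibre_shift_isotopic.
  apply: isotopic_to_id_comp; first exact: slide_isotopic.
  by apply: fibre_shift_isotopic => // q; exact: cvg_cst.
- by move=> p h /=; rewrite (fibre_shift_out _ b1l h) slide_out // fibre_shift_out.
- move=> j u aj u01 /=.
  rewrite -(b1E j u aj u01) fibre_shift_val //; last exact: xB_ge0.
  rewrite b2E // -PE // slide_val // QE // WE // addrC subrK.
  rewrite -(b3E j u aj u01) fibre_shift_val //; first by rewrite mul0r.
  exact: xA_ge0.
Qed.

End WedgeIsotopy.

(** * Crossing paths in a half-plane *)

Section Crossing.
Context {R : realType}.

(* Colours of the nonzero vectors (x, z): 0 in the cone z >= |x|; otherwise 1 on
   the left and 2 on the right.  If two paths never met, the colours of their difference
   on a fine grid would contradict Sperner's lemma. *)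
Definition colour (x z : R) : nat := if `|x| <= z then 0 else if x < 0 then 1 else 2.

Definition cedge (c c' : nat) : bool := ((c == 0) && (c' == 2)) || ((c == 2) && (c' == 0)).

(** Without colour 0 or 2 there is no edge of type 0-2 at all; without colour 1 a closed walk
    changes between 0 and 2 an even number of times. *)
Lemma cedge_square (d p q r s : nat) : (d < 3)%N -> (p < 3)%N -> (q < 3)%N ->
  (r < 3)%N -> (s < 3)%N ->
  p != d -> q != d -> r != d -> s != d ->
  cedge p q (+) cedge q r (+) cedge s r (+) cedge p s = false.
Proof. by case: d p q r s => [|[|[|?]]] [|[|[|?]]] [|[|[|?]]] [|[|[|?]]] [|[|[|?]]]. Qed.

Lemma cedge_path (c : nat -> nat) N : (forall i, c i = 0%N \/ c i = 2%N) ->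
  \big[addb/false]_(i < N) cedge (c i) (c i.+1) = (c 0%N == 0%N) (+) (c N == 0%N).
Proof.
move=> c02; elim: N => [|N IH]; first by rewrite big_ord0 addbb.
rewrite big_ord_recr /= IH -addbA; congr addb.
by case: (c02 N) => ->; case: (c02 N.+1) => ->.
Qed.

(** Every square carries the parity of the 0-2 edges from its lower side to its upper side, up to
    its vertical edges; these cancel inside a row and contribute nothing on the two boundary
    columns. *)
Lemma cedge_grid (c : nat -> nat -> nat) N :
  (forall i j, (i < N)%N -> (j < N)%N -> cedge (c i j) (c i.+1 j) (+)
     cedge (c i.+1 j) (c i.+1 j.+1) (+) cedge (c i j.+1) (c i.+1 j.+1) (+)
     cedge (c i j) (c i j.+1) = false) ->
  (forall j, (j < N)%N -> cedge (c 0%N j) (c 0%N j.+1) = false) ->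
  (forall j, (j < N)%N -> cedge (c N j) (c N j.+1) = false) ->
  \big[addb/false]_(i < N) cedge (c i 0%N) (c i.+1 0%N) =
  \big[addb/false]_(i < N) cedge (c i N) (c i.+1 N).
Proof.
move=> sq l0 lN.
have row j : (j < N)%N -> \big[addb/false]_(i < N) cedge (c i j) (c i.+1 j) =
    \big[addb/false]_(i < N) cedge (c i j.+1) (c i.+1 j.+1).
  move=> jN.
  have H n : (n <= N)%N -> \big[addb/false]_(i < n) cedge (c i j) (c i.+1 j) (+)
      \big[addb/false]_(i < n) cedge (c i j.+1) (c i.+1 j.+1) =
      cedge (c 0%N j) (c 0%N j.+1) (+) cedge (c n j) (c n j.+1).
    elim: n => [|n IH] nN; first by rewrite !big_ord0 !addbb.
    rewrite !big_ord_recr /= addbACA IH ?(ltnW nN) //.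
    have := sq n j nN jN.
    move: (cedge (c n j) (c n.+1 j)) (cedge (c n.+1 j) (c n.+1 j.+1))
      (cedge (c n j.+1) (c n.+1 j.+1)) (cedge (c n j) (c n j.+1))
      (cedge (c 0%N j) (c 0%N j.+1)).
    by do 5!case.
  have := H N (leqnn N); rewrite l0 // lN //.
  have addF x y : x (+) y = false -> x = y by case: x; case: y.
  by move/addF.
have H j : (j <= N)%N -> \big[addb/false]_(i < N) cedge (c i 0%N) (c i.+1 0%N) =
    \big[addb/false]_(i < N) cedge (c i j) (c i.+1 j).
  by elim: j => [//|j IH] jN; rewrite IH ?(ltnW jN) // row.
exact: H.
Qed.

(** The colours are those of the difference of the two paths. On the sides t = 0 and t = 1 the
    difference has X >= 0, so only colours 0 and 2 occur, and the order of the endpoints makes the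
    corners 2, 0 at t = 0 but 2, 2 at t = 1. The parities of the 0-2 edges disagree, contrary to
    [cedge_grid]. *)
Lemma crossing_paths (ax az bx bz : R -> R) :
  continuous ax -> continuous az -> continuous bx -> continuous bz ->
  (forall t, t \in `[0, 1] -> 0 <= ax t) -> (forall t, t \in `[0, 1] -> 0 <= bx t) ->
  ax 0 = 0 -> ax 1 = 0 -> bx 0 = 0 -> bx 1 = 0 ->
  az 0 < bz 0 -> bz 0 < az 1 -> az 1 < bz 1 ->
  exists s t : R, [/\ s \in `[0, 1], t \in `[0, 1], ax s = bx t & az s = bz t].
Proof.
move=> cax caz cbx cbz ax0 bx0 ax00 ax10 bx00 bx10 z1 z2 z3.
apply: contrapT => nex.
pose X s t := ax s - bx t; pose Z s t := az s - bz t.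
pose c s t := colour (X s t) (Z s t).
have c3 s t : (c s t < 3)%N by rewrite /c /colour; case: ifP => // _; case: ifP.
(* A good cell misses a colour. The second clause excludes 0-2 edges on the columns where X <= 0:
   there colour 2 forces X = 0 and Z < 0. *)
pose good (h : R) (p : R * R) :=
  (exists2 d, (d < 3)%N & [/\ c p.1 p.2 != d, c (p.1 + h) p.2 != d,
      c p.1 (p.2 + h) != d & c (p.1 + h) (p.2 + h) != d]) /\
  forall s t s' t', (s = p.1 \/ s = p.1 + h) -> (t = p.2 \/ t = p.2 + h) ->
    (s' = p.1 \/ s' = p.1 + h) -> (t' = p.2 \/ t' = p.2 + h) ->
    c s t = 0%N -> X s' t' = 0 -> 0 <= Z s' t'.
have : \forall h \near (0 : R), (`[0, 1] `*` `[0, 1])%classic `<=` good h.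
  have /compact_near_coveringP K := compact_setX (@segment_compact R 0 1) (@segment_compact R 0 1).
  apply: (K R (nbhs (0 : R)) good) => -[s0 t0] [/= s01 t01].
  have cX (f g : R * R * R -> R) : f q @[q --> ((s0, t0), (0 : R))] --> s0 ->
      g q @[q --> ((s0, t0), (0 : R))] --> t0 ->
      X (f q) (g q) @[q --> ((s0, t0), (0 : R))] --> X s0 t0.
    by move=> cf cg; rewrite /X; cts.
  have cZ (f g : R * R * R -> R) : f q @[q --> ((s0, t0), (0 : R))] --> s0 ->
      g q @[q --> ((s0, t0), (0 : R))] --> t0 ->
      Z (f q) (g q) @[q --> ((s0, t0), (0 : R))] --> Z s0 t0.
    by move=> cf cg; rewrite /Z; cts.
  have l1 : q.1.1 @[q --> ((s0, t0), (0 : R))] --> s0 := cvg_fst_of (cvg_fst_of cvg_id).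
  have l2 : q.1.2 @[q --> ((s0, t0), (0 : R))] --> t0 := cvg_snd_of (cvg_fst_of cvg_id).
  have l5 : q.2 @[q --> ((s0, t0), (0 : R))] --> (0 : R) := cvg_snd_of cvg_id.
  have l3 : q.1.1 + q.2 @[q --> ((s0, t0), (0 : R))] --> s0 + 0 by exact: cvgD.
  have l4 : q.1.2 + q.2 @[q --> ((s0, t0), (0 : R))] --> t0 + 0 by exact: cvgD.
  rewrite !addr0 in l3 l4.
  (* [G] is an open condition on the difference vector that avoids one colour. Every nonzero vector
     satisfies one of three: outside the cone of colour 0, above the line bounding colour 1, or in
     the upper left quadrant, free of colour 2. *)
  suff [G [nG GE]] : exists G : R -> R -> Prop,
      (forall f g : R * R * R -> R, f q @[q --> ((s0, t0), (0 : R))] --> X s0 t0 ->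
         g q @[q --> ((s0, t0), (0 : R))] --> Z s0 t0 ->
         \forall q \near ((s0, t0), (0 : R)), G (f q) (g q)) /\
      ((exists2 d, (d < 3)%N & forall x z, G x z -> colour x z != d) /\
       (forall x z x' z', G x z -> G x' z' -> colour x z = 0%N -> x' = 0 -> 0 <= z')).
    have n1 := nG _ _ (cX _ _ l1 l2) (cZ _ _ l1 l2).
    have n2 := nG _ _ (cX _ _ l3 l2) (cZ _ _ l3 l2).
    have n3 := nG _ _ (cX _ _ l1 l4) (cZ _ _ l1 l4).
    have n4 := nG _ _ (cX _ _ l3 l4) (cZ _ _ l3 l4).
    have [[d d3 dG] GG] := GE.
    have nn : \forall q \near ((s0, t0), (0 : R)), G (X q.1.1 q.1.2) (Z q.1.1 q.1.2) /\
        (G (X (q.1.1 + q.2) q.1.2) (Z (q.1.1 + q.2) q.1.2) /\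
        (G (X q.1.1 (q.1.2 + q.2)) (Z q.1.1 (q.1.2 + q.2)) /\
         G (X (q.1.1 + q.2) (q.1.2 + q.2)) (Z (q.1.1 + q.2) (q.1.2 + q.2)))).
      by do 3!apply: filterI => //.
    case: nn => -[A B] /= [nA nB] AB; exists (A, B) => //= -[[s t] h] /AB /=.
    move=> [g1 [g2 [g3 g4]]]; split.
      by exists d => //; split; apply: dG.
    have g s1 t1 : s1 = s \/ s1 = s + h -> t1 = t \/ t1 = t + h -> G (X s1 t1) (Z s1 t1).
      by move=> [] -> [] ->.
    move=> s1 t1 s2 t2 h1 h2 h3 h4; apply: GG; exact: g.
  have [lt|ge] := ltP (Z s0 t0) `|X s0 t0|.
    exists (fun x z => z < `|x|); split.
      move=> f g cf cg; have : `|f q| - g q @[q --> ((s0, t0), (0 : R))] -->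
        `|X s0 t0| - Z s0 t0 by cts.
      by move/cvgr_gt => /(_ 0); rewrite subr_gt0 => /(_ lt); apply: filterS => q;
        rewrite subr_gt0.
    split; first by exists 0%N => // x z; rewrite /colour leNgt => -> /=; case: ifP.
    by move=> x z x' z' h _; rewrite /colour leNgt h /=; case: ifP.
  have Zp : 0 < Z s0 t0.
    rewrite lt_neqAle (le_trans (normr_ge0 _) ge) andbT eq_sym; apply/eqP => Z0.
    apply: nex; exists s0, t0; split=> //; apply/eqP; rewrite -subr_eq0.
      by move: ge; rewrite Z0 normr_le0.
    by move/eqP: Z0.
  have [lt|ge'] := ltP 0 (X s0 t0 + Z s0 t0).
    exists (fun x z => 0 < x + z /\ 0 < z); split.
      move=> f g cf cg; have : f q + g q @[q --> ((s0, t0), (0 : R))] -->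
        X s0 t0 + Z s0 t0 by cts.
      move/cvgr_gt => /(_ 0 lt) n1; apply: filterI => //.
      by move/cvgr_gt: cg => /(_ 0 Zp).
    split; last by move=> x z x' z' _ [_ /ltW].
    exists 1%N => // x z [h _]; rewrite /colour; case: (leP `|x| z) => // zx.
    case: ifP => // x0; move: zx; rewrite ltr0_norm // => zx.
    by move: h; lra.
  have Xn : X s0 t0 < 0 by lra.
  exists (fun x z => x < 0 /\ 0 < z); split.
    move=> f g cf cg; apply: filterI; first by move/cvgr_lt: cf => /(_ 0 Xn).
    by move/cvgr_gt: cg => /(_ 0 Zp).
  split; last by move=> x z x' z' _ [_ /ltW].
  by exists 2%N => // x z [h _]; rewrite /colour h; case: ifP.
move=> /nbhs_ballP[e /= e0 H].
have [N Nbig] : exists N : nat, e^-1 < N.+1%:R.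
  by exists (Num.truncn e^-1); rewrite truncnS_gt // ltW // invr_gt0.
pose h : R := N.+1%:R^-1.
have h0 : 0 < h by rewrite invr_gt0 ltr0n.
have he : h < e by rewrite /h invf_plt ?posrE ?ltr0n.
have hN : N.+1%:R * h = 1 by rewrite divff // pnatr_eq0.
have hgood (i j : nat) : (i <= N.+1)%N -> (j <= N.+1)%N -> good h (i%:R * h, j%:R * h).
  have in01 (k : nat) : (k <= N.+1)%N -> k%:R * h \in `[0, 1].
    move=> kN; rewrite in_itv /=; apply/andP; split; first by rewrite mulr_ge0 ?ler0n // ltW.
    by rewrite /h ler_pdivrMr ?ltr0n // mul1r ler_nat.
  move=> iN jN; apply: (H h); last by split; apply: in01.
  by rewrite /ball /= sub0r normrN gtr0_norm.
pose C (i j : nat) := c (i%:R * h) (j%:R * h).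
have S (k : nat) : k.+1%:R * h = k%:R * h + h by rewrite -natr1 mulrDl mul1r.
have in01 (k : nat) : (k <= N.+1)%N -> k%:R * h \in `[0, 1].
  move=> kN; rewrite in_itv /=; apply/andP; split; first by rewrite mulr_ge0 ?ler0n // ltW.
  by rewrite /h ler_pdivrMr ?ltr0n // mul1r ler_nat.
have side (i j : nat) : (i <= N.+1)%N -> (j < N.+1)%N ->
    (forall k, (k <= N.+1)%N -> X (i%:R * h) (k%:R * h) <= 0) ->
    cedge (C i j) (C i j.+1) = false.
  move=> iN jN Xle.
  have [_ gd] := hgood i j iN (ltnW jN).
  have c2 k : (k <= N.+1)%N -> C i k = 2%N ->
      X (i%:R * h) (k%:R * h) = 0 /\ Z (i%:R * h) (k%:R * h) < 0.
    move=> kN; rewrite /C /c /colour; case: ifP => // /negbT; rewrite -ltNge => xz.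
    case: ifP => // /negbT; rewrite -leNgt => x0 _.
    have X0 : X (i%:R * h) (k%:R * h) = 0 by apply/eqP; rewrite eq_le x0 Xle.
    by split => //; move: xz; rewrite X0 normr0.
  rewrite /cedge; apply/negbTE; rewrite negb_or; apply/andP; split; apply/negP.
    move=> /andP[/eqP e1 /eqP e2]; have [X0 Zn] := c2 _ jN e2.
    have := gd (i%:R * h) (j%:R * h) (i%:R * h) (j.+1%:R * h) (or_introl erefl)
      (or_introl erefl) (or_introl erefl) (or_intror (S j)) e1 X0.
    by rewrite leNgt Zn.
  move=> /andP[/eqP e1 /eqP e2]; have [X0 Zn] := c2 _ (ltnW jN) e1.
  have := gd (i%:R * h) (j.+1%:R * h) (i%:R * h) (j%:R * h) (or_introl erefl)
    (or_intror (S j)) (or_introl erefl) (or_introl erefl) e2 X0.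
  by rewrite leNgt Zn.
have CG := @cedge_grid C N.+1.
have : \big[addb/false]_(i < N.+1) cedge (C i 0%N) (C i.+1 0%N) =
       \big[addb/false]_(i < N.+1) cedge (C i N.+1) (C i.+1 N.+1).
  apply: CG.
  - move=> i j iN jN; have [[d d3 [g1 g2 g3 g4]] _] := hgood i j (ltnW iN) (ltnW jN).
    by apply: (@cedge_square d) => //; rewrite /C ?S.
  - move=> j jN; apply: side => // k kN; rewrite /X mul0r ax00 sub0r oppr_le0.
    by apply: bx0; exact: in01.
  - move=> j jN; apply: side => // k kN; rewrite /X hN ax10 sub0r oppr_le0.
    by apply: bx0; exact: in01.
have c02 (g : nat -> R) (t : R) : (forall i, g i \in `[0, 1]) -> bx t = 0 ->
    forall i, c (g i) t = 0%N \/ c (g i) t = 2%N.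
  move=> g01 bt i; rewrite /c /colour; case: ifP => _; first by left.
  by right; rewrite /X bt subr0 ltNge ax0.
pose mi (i : nat) : R := (minn i N.+1)%:R * h.
have mi01 i : mi i \in `[0, 1] by apply: in01; exact: geq_minr.
have pth t : bx t = 0 ->
    \big[addb/false]_(i < N.+1) cedge (c (i%:R * h) t) (c (i.+1%:R * h) t) =
    (c 0 t == 0%N) (+) (c 1 t == 0%N).
  move=> bt; have := cedge_path N.+1 (c02 mi t mi01 bt).
  rewrite {3 4}/mi min0n mul0r minnn hN => <-.
  apply: eq_bigr => i _; rewrite /mi (minn_idPl (ltnW (ltn_ord i))).
  by rewrite (minn_idPl (ltn_ord i)).
rewrite /C mul0r hN !pth //.
have R0 s t : X s t = 0 -> Z s t < 0 -> c s t = 2%N.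
  by move=> x z; rewrite /c /colour x normr0 leNgt z /= ltxx.
have U0 s t : X s t = 0 -> 0 <= Z s t -> c s t = 0%N.
  by move=> x z; rewrite /c /colour x normr0 z.
rewrite (R0 0 0); last first.
- by rewrite /Z subr_lt0.
- by rewrite /X ax00 bx00 subrr.
rewrite (U0 1 0); last first.
- by rewrite /Z subr_ge0 ltW.
- by rewrite /X ax10 bx00 subrr.
rewrite (R0 0 1); last first.
- by rewrite /Z subr_lt0; lra.
- by rewrite /X ax00 bx10 subrr.
rewrite (R0 1 1) //.
- by rewrite /X ax10 bx10 subrr.
- by rewrite /Z subr_lt0; lra.
Qed.

End Crossing.

(** * Normal position of the pages *)

Ltac split_if :=
  match goal with
  | |- context [if ?a < ?b then _ else _] =>
    lazymatch a with context [if _ then _ else _] => fail | _ =>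
    lazymatch b with context [if _ then _ else _] => fail | _ =>
      case: (ltP a b) => ? end end
  | |- context [if ?a <= ?b then _ else _] =>
    lazymatch a with context [if _ then _ else _] => fail | _ =>
    lazymatch b with context [if _ then _ else _] => fail | _ =>
      case: (leP a b) => ? end end
  end.
Ltac mmlra := rewrite ?/Order.max ?/Order.min; repeat split_if; lra.

Section Glue.
Context {R : realType}.

Lemma glue_cont {X Y : topologicalType} (h : X -> R) (f g : X -> Y) :
  continuous h -> continuous f -> continuous g -> (forall x, h x = 0 -> f x = g x) ->
  continuous (fun x => if 0 <= h x then f x else g x).
Proof.
move=> ch cf cg fg x; rewrite /continuous_at.
have chx : h y @[y --> x] --> h x := ch x.
have [hx|hx|hx] := ltrgtP 0 (h x).
- have fx : f y @[y --> x] --> f x := cf x.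
  apply: cvg_near_eq fx.
  by move/cvgr_gt: chx => /(_ 0 hx); apply: filterS => y /ltW ->.
- have gx : g y @[y --> x] --> g x := cg x.
  apply: cvg_near_eq gx.
  by move/cvgr_lt: chx => /(_ 0 hx); apply: filterS => y; rewrite leNgt => ->.
- move=> V Vx; have E : f x = g x by exact: fg.
  have Vf : nbhs (f x) V by move: Vx; rewrite -?hx ?lexx.
  have Vg : nbhs (g x) V by rewrite -E.
  have fV : \forall y \near x, V (f y) := cf x V Vf.
  have gV : \forall y \near x, V (g y) := cg x V Vg.
  by apply: filterS (filterI fV gV) => y [? ?] /=; case: ifP.
Qed.

End Glue.

Section AngularMove.
Context {R : realType}.
Notation E3 := (space3 R).

(* Homogeneous pseudo-polar coordinates on the plane: [nrm p] is the l^1-norm and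
   [ang p / nrm p], in [-2, 2], is the position of p on the l^1-circle, measured
   clockwise from the positive y-axis and cut along the negative one. *)
Definition nrm (p : R * R) : R := Num.max p.1 (- p.1) + Num.max p.2 (- p.2).
Definition ang (e : R) (p : R * R) : R := p.1 + 2 * e * Num.max (- p.2) 0.
Definition pol (r c : R) : R * R :=
  (Num.max (Num.min c (2 * r - c)) (- 2 * r - c), Num.min (r - c) (r + c)).
Definition side_ang (p : R * R) : R := if 0 <= p.1 then ang 1 p else ang (-1) p.

Lemma nrm_ge0 p : 0 <= nrm p.
Proof. by case: p => x y; rewrite /nrm /=; mmlra. Qed.

Lemma pol_ang p : pol (nrm p) (side_ang p) = p.
Proof.
case: p => x y; rewrite /pol /nrm /side_ang /ang /=.
have mp (z : R) : 0 <= z -> Num.max z (- z) = z /\ Num.max (- z) 0 = 0.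
  by move=> z0; split; [rewrite max_l|rewrite max_r] => //; lra.
have mn (z : R) : z < 0 -> Num.max z (- z) = - z /\ Num.max (- z) 0 = - z.
  by move=> z0; split; [rewrite max_r|rewrite max_l] => //; lra.
have [x0|x0] := leP 0 x.
  have [-> _] := mp x x0; have [y0|y0] := leP 0 y; [have [-> ->] := mp y y0|have [-> ->] := mn y y0];
    by congr pair; mmlra.
have [-> _] := mn x x0; have [y0|y0] := leP 0 y; [have [-> ->] := mp y y0|have [-> ->] := mn y y0];
  by congr pair; mmlra.
Qed.

Lemma side_ang_bound p : `|side_ang p| <= 2 * nrm p.
Proof.
case: p => x y; rewrite /nrm /side_ang /ang ler_norml /=.
by apply/andP; split; mmlra.
Qed.

Lemma nrm_pol r c : `|c| <= 2 * r -> nrm (pol r c) = r.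
Proof. by rewrite ler_norml /nrm /pol /= => /andP[? ?]; mmlra. Qed.

Lemma ang_pol r c : `|c| < 2 * r -> side_ang (pol r c) = c.
Proof.
by rewrite ltr_norml /side_ang /ang /pol /= => /andP[? ?]; mmlra.
Qed.

End AngularMove.

Section TurnMove.
Context {R : realType}.
Notation E3 := (space3 R).

(** Everything is homogeneous in [nrm q], so the origin needs no special case. The sign [e] chooses
    the determination of the angle on the right or on the left of the cut. *)
Definition turn_on (e l r b b' : R) (q : R * R) : R * R :=
  pol (nrm q) (ang e q +
    hat (b - l) (r - b) (ang e q - l * nrm q) (r * nrm q - ang e q) * (b' - b)).

Definition turn (l r b b' : R) (p : E3) : E3 :=
  if 0 <= p.1.1 then (turn_on 1 l r b b' p.1, p.2) else (turn_on (-1) l r b b' p.1, p.2).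

Definition shift_ang (l r b b' rho c : R) : R :=
  c + hat (b - l) (r - b) (c - l * rho) (r * rho - c) * (b' - b).

Lemma turnE l r b b' p :
  turn l r b b' p = (pol (nrm p.1) (shift_ang l r b b' (nrm p.1) (side_ang p.1)), p.2).
Proof. by rewrite /turn /turn_on /shift_ang /side_ang; case: ifP. Qed.

Section Turn.
Variables (l r : R).
Hypotheses (l2 : -2 <= l) (r2 : r <= 2).

Lemma shift_ang_lt b b' rho c : l < b < r -> l < b' < r -> 0 <= rho ->
  `|c| < 2 * rho -> `|shift_ang l r b b' rho c| < 2 * rho.
Proof.
move=> /andP[lb br] /andP[lb' br'] rho0; rewrite !ltr_norml => /andP[c1 c2].
have lr : - 2 * rho <= l * rho by rewrite ler_wpM2r.
have rr : r * rho <= 2 * rho by rewrite ler_wpM2r.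
have al0 : 0 < b - l by lra.
have be0 : 0 < r - b by lra.
rewrite /shift_ang; have [A0|A0] := leP (c - l * rho) 0.
  by rewrite (hat0 al0 be0 (or_introl A0)) mul0r addr0; apply/andP; split; lra.
have [B0|B0] := leP (r * rho - c) 0.
  by rewrite (hat0 al0 be0 (or_intror B0)) mul0r addr0; apply/andP; split; lra.
have [m0 mA mB] := hat_gt0 al0 be0 A0 B0.
move: m0 mA mB; set m := hat _ _ _ _ => m0 mA mB.
have k1 : 0 < m * (b' - l) by apply: mulr_gt0 => //; lra.
have k2 : 0 < m * (r - b') by apply: mulr_gt0 => //; lra.
by apply/andP; split; lra.
Qed.

Lemma shift_angK b b' rho : l < b < r -> l < b' < r ->
  cancel (shift_ang l r b b' rho) (shift_ang l r b' b rho).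
Proof.
move=> /andP[lb br] /andP[lb' br'] c; rewrite /shift_ang.
set m := hat (b - l) _ _ _.
have -> : c + m * (b' - b) - l * rho = (c - l * rho) + m * (b' - b) by ring.
have -> : r * rho - (c + m * (b' - b)) = (r * rho - c) - m * (b' - b) by ring.
have -> : b' - l = b - l + (b' - b) by ring.
have -> : r - b' = r - b - (b' - b) by ring.
by rewrite hat_shift; try lra; rewrite -/m; ring.
Qed.

(* On the cut itself [hat] vanishes, so that the two determinations agree. *)
Lemma shift_ang_cut b b' rho c : l < b < r -> 0 <= rho -> 2 * rho <= `|c| ->
  shift_ang l r b b' rho c = c.
Proof.
move=> /andP[lb br] rho0; rewrite ler_normr => h; rewrite /shift_ang hat0 ?mul0r ?addr0 //.
- by lra.
- by lra.
have lr : - 2 * rho <= l * rho by rewrite ler_wpM2r.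
have rr : r * rho <= 2 * rho by rewrite ler_wpM2r.
by case/orP: h => h; [right|left]; lra.
Qed.

Lemma turnK b b' : l < b < r -> l < b' < r -> cancel (turn l r b b') (turn l r b' b).
Proof.
move=> hb hb' [q z]; rewrite (turnE l r b b') /=.
have := side_ang_bound q; rewrite le_eqVlt => /orP[/eqP E|lt].
  rewrite shift_ang_cut ?E // ?nrm_ge0 // pol_ang turnE /=.
  by rewrite shift_ang_cut ?E ?nrm_ge0 // pol_ang.
have lt' := shift_ang_lt hb hb' (nrm_ge0 q) lt.
by rewrite turnE /= nrm_pol ?(ltW lt') // ang_pol // shift_angK // pol_ang.
Qed.

Lemma turn_cont b (f : R -> R) : l < b < r -> continuous f ->
  continuous (fun p : R * E3 => turn l r b (f p.1) p.2).
Proof.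
move=> hb cf.
have cF e : continuous (fun p : R * E3 => (turn_on e l r b (f p.1) p.2.1, p.2.2) : E3).
  move=> p; rewrite /continuous_at /turn_on /pol /hat /nrm /ang; cts; lra.
apply: (@glue_cont _ _ _ (fun p : R * E3 => p.2.1.1)) => //.
  by move=> p; rewrite /continuous_at; cts.
move=> [t [[x y] z]] /= ->; congr pair.
rewrite -!/(shift_ang l r b (f t) _ _) /turn_on -!/(shift_ang l r b (f t) _ _).
have [y0|y0] := leP 0 y.
  by congr (pol _ (shift_ang _ _ _ _ _ _)); rewrite /ang /=; mmlra.
have n1 : nrm (0, y) = - y by rewrite /nrm /=; mmlra.
have m1 : Num.max (- y) 0 = - y by rewrite max_l // oppr_ge0 ltW.
rewrite !shift_ang_cut ?nrm_ge0 // n1 /ang /= m1.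
- by congr pair; mmlra.
- by rewrite ler_normr; apply/orP; right; mmlra.
- by rewrite ler_normr; apply/orP; left; mmlra.
Qed.

Lemma turn_isotopic b b' : l < b < r -> l < b' < r -> isotopic_to_id (turn l r b b').
Proof.
move=> hb hb'; pose bt (t : R) := b + t * (b' - b).
have -> : turn l r b b' = turn l r b (bt 1).
  by rewrite /bt mul1r addrC subrK.
have hbt t : t \in `[0, 1] -> l < bt t < r.
  rewrite in_itv /= => /andP[t0 t1]; move/andP: hb => [? ?]; move/andP: hb' => [? ?].
  rewrite /bt; have [->|tn0] := eqVneq t 0; first by apply/andP; split; lra.
  have tp : 0 < t by rewrite lt_neqAle eq_sym tn0.
  have k1 : 0 < t * (b' - l) by apply: mulr_gt0 => //; lra.
  have k2 : 0 <= (1 - t) * (b - l) by apply: mulr_ge0; lra.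
  have k3 : 0 < t * (r - b') by apply: mulr_gt0 => //; lra.
  have k4 : 0 <= (1 - t) * (r - b) by apply: mulr_ge0; lra.
  by apply/andP; split; lra.
apply: (@isotopic_to_id_joint _ (fun t => turn l r b (bt t)) (fun t => turn l r (bt t) b)).
- by apply: turn_cont => // t; rewrite /continuous_at /bt; cts.
- move=> t t01; split; try by [apply: turnK => //; exact: hbt].
  move=> p.
  apply: (@continuous_comp _ _ _ (fun p => ((0 : R), p)) (fun p => turn l r (bt t) b p.2)).
    by rewrite /continuous_at; apply: cvg_prod_of => /=; cts.
  by apply: (@turn_cont (bt t) (fun=> b)); [exact: hbt|move=> ?; exact: cvg_cst].
- move=> [q z]; rewrite turnE /shift_ang /bt mul0r addr0 subrr mulr0 addr0 /=.
  by rewrite pol_ang.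
Qed.

Lemma turn_pol b b' rho c z : l < b < r -> 0 <= rho -> `|c| < 2 ->
  turn l r b b' (pol rho (rho * c), z) = (pol rho (rho * shift_ang l r b b' 1 c), z).
Proof.
move=> hb rho0 c2; rewrite turnE /=; congr pair.
have [E|rn0] := eqVneq rho 0.
  rewrite E !mul0r.
  have -> : pol 0 0 = (0, 0) :> R * R by rewrite /pol; apply: (proj2 (pair_equal_spec _ _ _ _)); split; mmlra.
  have n0 : nrm (0, 0) = 0 :> R by rewrite /nrm /= oppr0 maxxx addr0.
  have a0 : side_ang (0, 0) = 0 :> R.
    by rewrite /side_ang /= lexx /ang /= oppr0 maxxx mulr0 addr0.
  rewrite n0 a0 shift_ang_cut // ?mulr0 ?normr0 //.
  by rewrite /pol; apply: (proj2 (pair_equal_spec _ _ _ _)); split; mmlra.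
have rp : 0 < rho by rewrite lt_neqAle eq_sym rn0.
have lt : `|rho * c| < 2 * rho by rewrite normrM gtr0_norm // mulrC ltr_pM2r.
rewrite nrm_pol ?(ltW lt) // ang_pol //; congr pol.
rewrite /shift_ang !mulr1 [RHS]mulrDr [in RHS]mulrA; congr (_ + _ * _).
rewrite /hat.
have -> : (rho * c - l * rho) / (b - l) = rho * ((c - l) / (b - l)) by ring.
have -> : (r * rho - rho * c) / (r - b) = rho * ((r - c) / (r - b)) by ring.
by rewrite maxr_pMr ?(ltW rp) // minr_pMr ?(ltW rp) // mulr0.
Qed.

Lemma turn_cut b b' y z : l < b < r -> y <= 0 -> turn l r b b' ((0, y), z) = ((0, y), z).
Proof.
move=> hb y0; rewrite turnE /=.
have n1 : nrm (0, y) = - y by rewrite /nrm /=; mmlra.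
rewrite shift_ang_cut ?nrm_ge0 // ?pol_ang // n1 /side_ang /ang /= lexx ler_normr.
by apply/orP; left; mmlra.
Qed.

Lemma shift_ang_peak b b' : l < b < r -> shift_ang l r b b' 1 b = b'.
Proof.
move=> /andP[lb br]; rewrite /shift_ang !mulr1 /hat !divff ?minxx ?max_r //; try lra.
all: by rewrite gt_eqF //; lra.
Qed.

Lemma shift_ang_out b b' c : l < b < r -> c <= l \/ r <= c -> shift_ang l r b b' 1 c = c.
Proof.
move=> /andP[lb br] h; rewrite /shift_ang hat0 ?mul0r ?addr0 //; lra.
Qed.

End Turn.

Lemma shift_ang_left (l r b b' c : R) : l < b < r -> l < b' < r -> l < c < b ->
  l < shift_ang l r b b' 1 c < b'.
Proof.
move=> /andP[lb br] /andP[lb' br'] /andP[lc cb].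
have -> : shift_ang l r b b' 1 c = l + (c - l) / (b - l) * (b' - l).
  rewrite /shift_ang !mulr1 /hat min_l ?max_r.
  - by field; rewrite gt_eqF //; lra.
  - by rewrite divr_ge0 //; lra.
  - apply: (@le_trans _ _ 1); first by rewrite ler_pdivrMr; lra.
    by rewrite ler_pdivlMr; lra.
have k0 : 0 < (c - l) / (b - l) by apply: divr_gt0; lra.
have k1 : (c - l) / (b - l) < 1 by rewrite ltr_pdivrMr; lra.
have k2 : 0 < (c - l) / (b - l) * (b' - l) by apply: mulr_gt0 => //; lra.
have k3 : 0 < (1 - (c - l) / (b - l)) * (b' - l) by apply: mulr_gt0; lra.
by apply/andP; split; lra.
Qed.

Lemma shift_ang_right (l r b b' c : R) : l < b < r -> l < b' < r -> b < c < r ->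
  b' < shift_ang l r b b' 1 c < r.
Proof.
move=> /andP[lb br] /andP[lb' br'] /andP[bc cr].
have -> : shift_ang l r b b' 1 c = r - (r - c) / (r - b) * (r - b').
  rewrite /shift_ang !mulr1 /hat min_r ?max_r.
  - by field; rewrite gt_eqF //; lra.
  - by rewrite divr_ge0 //; lra.
  - apply: (@le_trans _ _ 1); first by rewrite ler_pdivrMr; lra.
    by rewrite ler_pdivlMr; lra.
have k0 : 0 < (r - c) / (r - b) by apply: divr_gt0; lra.
have k1 : (r - c) / (r - b) < 1 by rewrite ltr_pdivrMr; lra.
have k2 : 0 < (r - c) / (r - b) * (r - b') by apply: mulr_gt0 => //; lra.
have k3 : 0 < (1 - (r - c) / (r - b)) * (r - b') by apply: mulr_gt0; lra.
by apply/andP; split; lra.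
Qed.

End TurnMove.

Section NormalPages.
Context {R : realType}.
Notation E3 := (space3 R).

Definition dir (i : 'I_4) : R * R :=
  match val i with 0%N => (1, 0) | 1%N => (0, 1) | 2%N => (-1, 0) | _ => (0, -1) end.

(** This is the rotation taking (a, b) to (0, -1). The straight homotopy from the identity runs
    through similarities of determinant [D t], which vanishes only in the case of a half turn, that
    is for b = 1. *)
Lemma rot_isotopic (a b : R) : a ^+ 2 + b ^+ 2 = 1 -> b != 1 ->
  isotopic_to_id (fun p : E3 =>
    ((- b * p.1.1 + a * p.1.2, - a * p.1.1 - b * p.1.2), p.2)).
Proof.
move=> ab b1; pose d (p : E3) : E3 :=
  (((- b - 1) * p.1.1 + a * p.1.2, - a * p.1.1 + (- b - 1) * p.1.2), 0).
have -> : (fun p : E3 => ((- b * p.1.1 + a * p.1.2, - a * p.1.1 - b * p.1.2), p.2)) =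
    (fun p => p + d p).
  apply/funext => -[[x y] z]; rewrite /d /=; congr (_, _, _) => /=; ring.
have cd : continuous d by move=> p; rewrite /continuous_at /d; cts.
pose m t := 1 + t * (- b - 1); pose D t := m t ^+ 2 + (t * a) ^+ 2.
apply: (@isotopic_to_id_straight _ d (fun t p =>
  (((m t * p.1.1 - t * a * p.1.2) / D t, (t * a * p.1.1 + m t * p.1.2) / D t), p.2))) => //.
move=> t; rewrite in_itv /= => /andP[t0 t1].
have D0 : D t != 0.
  rewrite /D paddr_eq0 ?sqr_ge0 // !sqrf_eq0; apply/negP => /andP[/eqP m0].
  rewrite mulf_eq0 => /orP[/eqP te|/eqP ae].
    by move: m0; rewrite /m te mul0r addr0 => /eqP; rewrite oner_eq0.
  have : (b - 1) * (b + 1) = 0 by move: ab; rewrite ae; lra.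
  move/eqP; rewrite mulf_eq0 subr_eq0 (negbTE b1) /= addr_eq0 => /eqP be.
  by move: m0; rewrite /m be; lra.
split.
- by move=> p; rewrite /continuous_at; cts.
- move=> [[x y] z]; rewrite /d /= /GRing.scale /=.
  by congr (_, _, _); rewrite /= /GRing.scale /= ?mulr0 ?addr0 //; rewrite /D /m in D0 *; field.
- move=> [[x y] z]; rewrite /d /= /GRing.scale /=.
  by congr (_, _, _); rewrite /= /GRing.scale /= ?mulr0 ?addr0 //; rewrite /D /m in D0 *; field.
Qed.

Lemma pol_scale (k r c : R) : 0 <= k ->
  pol (k * r) (k * c) = (k * (pol r c).1, k * (pol r c).2).
Proof.
move=> k0; rewrite /pol /=.
rewrite (_ : 2 * (k * r) - k * c = k * (2 * r - c)); last by ring.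
rewrite (_ : -2 * (k * r) - k * c = k * (-2 * r - c)); last by ring.
rewrite (_ : k * r - k * c = k * (r - c)); last by ring.
rewrite (_ : k * r + k * c = k * (r + c)); last by ring.
by rewrite maxr_pMr // !minr_pMr.
Qed.

Lemma polM (rho c : R) : 0 <= rho ->
  pol rho (rho * c) = (rho * (pol 1 c).1, rho * (pol 1 c).2).
Proof. by move=> r0; rewrite -pol_scale // mulr1. Qed.

Lemma page_turn (l r b b' c : R) (p : E3) : -2 <= l -> r <= 2 -> l < b < r -> `|c| < 2 ->
  page (pol 1 c) p -> page (pol 1 (shift_ang l r b b' 1 c)) (turn l r b b' p).
Proof.
case: p => q z l2 r2 hb c2 [rho rho0 /= E]; exists rho => //.
by rewrite E -(polM c rho0) turn_pol //= polM.
Qed.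

Lemma side_ang_lt (v : R * R) : v.1 != 0 \/ 0 < v.2 -> `|side_ang v| < 2 * nrm v.
Proof.
case: v => x y /= h; rewrite /nrm /side_ang /ang /=.
have maxN (z : R) : Num.max z (- z) = `|z|.
  have [z0|z0] := leP 0 z; first by rewrite ger0_norm // max_l //; lra.
  by rewrite ltr0_norm // max_r //; lra.
have [y0|y0] := lerP 0 y; [rewrite [Num.max (- y) 0]max_r|rewrite [Num.max (- y) 0]max_l]; try lra;
  have [x0|x0] := lerP 0 x; rewrite !maxN ?(ger0_norm x0) ?(ltr0_norm x0) ?(ger0_norm y0) ?(ltr0_norm y0) ltr_norml;
  case: h => h; rewrite ?neq_lt in h; try (case/orP: h => h); apply/andP; split; lra.
Qed.

Lemma page_pol (v : R * R) (p : E3) : 0 < nrm v -> page v p -> page (pol 1 (side_ang v / nrm v)) p.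
Proof.
move=> v0 [r r0 E]; exists (r * nrm v); first by rewrite mulr_ge0 // ltW.
rewrite -polM ?mulr_ge0 // ?ltW //.
have -> : r * nrm v * (side_ang v / nrm v) = r * side_ang v by field; rewrite gt_eqF.
by rewrite E pol_scale // pol_ang.
Qed.

Lemma unit_pol_inj (v w : R * R) : v.1 ^+ 2 + v.2 ^+ 2 = 1 -> w.1 ^+ 2 + w.2 ^+ 2 = 1 ->
  0 < nrm v -> 0 < nrm w -> side_ang v / nrm v = side_ang w / nrm w -> v = w.
Proof.
move=> v1 w1 v0 w0 E.
have H (u : R * R) : 0 < nrm u -> u = (nrm u * (pol 1 (side_ang u / nrm u)).1,
    nrm u * (pol 1 (side_ang u / nrm u)).2).
  move=> u0; rewrite -polM ?ltW // mulrC divfK ?gt_eqF //.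
  by rewrite pol_ang.
pose d := pol 1 (side_ang v / nrm v).
have Hv : v = (nrm v * d.1, nrm v * d.2) := H v v0.
have Hw : w = (nrm w * d.1, nrm w * d.2) by rewrite /d E; exact: H.
clearbody d.
suff nvw : nrm v = nrm w by rewrite Hv Hw nvw.
have e1 : nrm v ^+ 2 * (d.1 ^+ 2 + d.2 ^+ 2) = 1.
  by rewrite -v1 [in X in _ = X ^+ 2 + _]Hv [in X in _ = _ + X ^+ 2]Hv /=; ring.
have e2 : nrm w ^+ 2 * (d.1 ^+ 2 + d.2 ^+ 2) = 1.
  by rewrite -w1 [in X in _ = X ^+ 2 + _]Hw [in X in _ = _ + X ^+ 2]Hw /=; ring.
have dn : d.1 ^+ 2 + d.2 ^+ 2 != 0.
  by apply/eqP => h; move: e1; rewrite h mulr0 => /eqP; rewrite eq_sym oner_eq0.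
have : nrm v ^+ 2 = nrm w ^+ 2 by apply: (mulIf dn); rewrite e1 e2.
by move/eqP; rewrite eqrXn2 ?ltW // => /eqP.
Qed.

Lemma isotopic_inj (f : E3 -> E3) : isotopic_to_id f -> injective f.
Proof.
move=> [H [G [[_ h _] <-]]].
have in1 : (1 : R) \in `[0, 1] by rewrite in_itv /= ler01 lexx.
by have [_ _ HK _] := h _ in1; exact: can_inj HK.
Qed.

Lemma pol_axes : [/\ pol 1 0 = (0, 1) :> R * R, pol 1 1 = (1, 0) :> R * R &
  pol 1 (-1) = (-1, 0) :> R * R].
Proof. by rewrite /pol; split; apply: (f_equal2 pair); mmlra. Qed.

(** One page is rotated onto the cut of the angles, which every [turn] fixes. The middle one of the
    remaining three is turned to angle 0; the order is kept, so one page lies on each side and is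
    turned to -1 or 1 within its own half. *)
Lemma normalise_pages (u : 'I_4 -> R * R) : injective u ->
  (forall i, (u i).1 ^+ 2 + (u i).2 ^+ 2 = 1) ->
  exists (f : E3 -> E3) (s : 'I_4 -> 'I_4), [/\ isotopic_to_id f, injective s,
    forall p, axis p -> f p = p &
    forall i p, page (u i) p -> page (dir (s i)) (f p)].
Proof.
move=> uinj u1.
(* At most one page points along (0, 1), the direction from which the straight homotopy would be
   singular. *)
have [i0 i0N] : exists i0, (u i0).2 != 1.
  have [e|h] := eqVneq (u ord0).2 1; last by exists ord0.
  exists (lift ord0 ord0); apply/eqP => e'.
  have z i : (u i).2 = 1 -> (u i).1 = 0.
    by move=> h; apply/eqP; rewrite -sqrf_eq0; have := u1 i; rewrite h; lra.
  have /uinj // : u ord0 = u (lift ord0 ord0).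
  by rewrite [LHS]surjective_pairing [RHS]surjective_pairing e e' !z.
pose a := (u i0).1; pose b := (u i0).2.
pose M (v : R * R) : R * R := (- b * v.1 + a * v.2, - a * v.1 - b * v.2).
pose g (p : E3) : E3 := (M p.1, p.2).
have gi : isotopic_to_id g := rot_isotopic (u1 i0) i0N.
pose v i := M (u i).
have ab : a ^+ 2 + b ^+ 2 = 1 by exact: u1.
have v1 i : (v i).1 ^+ 2 + (v i).2 ^+ 2 = 1.
  rewrite -[RHS](u1 i) /v /M /=.
  have -> : (- b * (u i).1 + a * (u i).2) ^+ 2 + (- a * (u i).1 - b * (u i).2) ^+ 2 =
    (a ^+ 2 + b ^+ 2) * ((u i).1 ^+ 2 + (u i).2 ^+ 2) by ring.
  by rewrite ab mul1r.
have vinj : injective v.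
  move=> i j [e1 e2]; apply: uinj.
  have e (w : R * R) : w = (- b * (M w).1 - a * (M w).2, a * (M w).1 - b * (M w).2).
    have -> : (- b * (M w).1 - a * (M w).2, a * (M w).1 - b * (M w).2) =
       ((a ^+ 2 + b ^+ 2) * w.1, (a ^+ 2 + b ^+ 2) * w.2) by rewrite /M /=; apply: (f_equal2 pair); ring.
    by rewrite ab !mul1r -surjective_pairing.
  by rewrite (e (u i)) (e (u j)) /M /= e1 e2.
have vS : v i0 = (0, -1).
  rewrite /v /M /= -/a -/b; apply: (f_equal2 pair); first by ring.
  by rewrite -ab; ring.
have vn i : i != i0 -> (v i).1 != 0 \/ 0 < (v i).2.
  move=> ii0; have [e|h] := eqVneq (v i).1 0; [right|by left].
  have := v1 i; rewrite e expr0n add0r => /eqP; rewrite sqrf_eq1 => /orP[/eqP ->//|/eqP h].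
  case/eqP: ii0; apply: vinj; rewrite vS [LHS]surjective_pairing e h //.
have nv i : 0 < nrm (v i).
  rewrite lt_neqAle nrm_ge0 andbT eq_sym; apply/eqP => h.
  have := pol_ang (v i); rewrite h => E.
  have := side_ang_bound (v i); rewrite h mulr0 normr_le0 => /eqP E2.
  move: E; rewrite E2 /pol /= mulr0 subr0 mulr0 !addr0 subr0 minxx maxxx => E.
  by have := v1 i; rewrite -E /= !expr0n /= addr0 => /eqP; rewrite eq_sym oner_eq0.
pose c i := side_ang (v i) / nrm (v i).
have c2 i : i != i0 -> `|c i| < 2.
  move=> /vn /side_ang_lt; rewrite /c normrM normfV (gtr0_norm (nv i)).
  by rewrite ltr_pdivrMr.
have cinj i j : c i = c j -> i = j.
  by move=> e; apply: vinj; exact: unit_pol_inj e.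
have [i1 [i2 [i3 [c12 c23 /and3P[n1 n2 n3] cov]]]] : exists i1 i2 i3, [/\ c i1 < c i2, c i2 < c i3,
    [&& i1 != i0, i2 != i0 & i3 != i0] & forall i, i \in [:: i0; i1; i2; i3]].
  pose le i j := c i <= c j.
  pose s := sort le (enum (predC1 i0)).
  have sz : size s = 3%N by rewrite size_sort -cardE cardC1 card_ord.
  have us : uniq s by rewrite sort_uniq enum_uniq.
  have ss : sorted le s by apply: sort_sorted => i j; exact: le_total.
  have ms i : (i \in s) = (i != i0) by rewrite mem_sort mem_enum.
  case: s sz us ss ms => [|i1 [|i2 [|i3 []]]] //= _ /and3P[]; rewrite !inE negb_or.
  move=> /andP[n12 n13] n23 _ /and3P[l12 l23 _] ms.
  exists i1, i2, i3; split.
  - by rewrite lt_neqAle (l12 : c i1 <= c i2) andbT; apply: contra n12 => /eqP/cinj ->.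
  - by rewrite lt_neqAle (l23 : c i2 <= c i3) andbT; apply: contra n23 => /eqP/cinj ->.
  - by rewrite -!ms !inE !eqxx !orbT.
  - move=> i; have := ms i; rewrite !inE => ->.
    by case: (i == i0).
have cb i : i != i0 -> -2 < c i < 2 by move=> /c2; rewrite ltr_norml.
have /andP[d1 d1'] := cb _ n1; have /andP[d2 d2'] := cb _ n2.
have /andP[d3 d3'] := cb _ n3.
pose m1 := turn (-2) 2 (c i2) 0.
have h1 : -2 < c i2 < 2 by rewrite d2.
have h1' : -2 < (0 : R) < 2 by rewrite oppr_lt0 ltr0n.
pose e1 := shift_ang (-2) 2 (c i2) 0 1 (c i1).
pose e3 := shift_ang (-2) 2 (c i2) 0 1 (c i3).
have /andP[e1l e1r] : -2 < e1 < 0 by apply: shift_ang_left => //; rewrite d1.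
have /andP[e3l e3r] : 0 < e3 < 2 by apply: shift_ang_right => //; rewrite c23.
pose m2 := turn (-2) 0 e1 (-1).
have h2 : -2 < e1 < 0 by rewrite e1l.
have h2' : -2 < (-1 : R) < 0 by rewrite ltrN2 ltr1n oppr_lt0 ltr01.
pose m3 := turn 0 2 e3 1.
have h3 : 0 < e3 < 2 by rewrite e3l.
have h3' : 0 < (1 : R) < 2 by rewrite ltr01 ltr1n.
pose f := m3 \o (m2 \o (m1 \o g)).
pose s (i : 'I_4) : 'I_4 := if i == i0 then @Ordinal 4 3 isT else if i == i1 then @Ordinal 4 2 isT
   else if i == i2 then @Ordinal 4 1 isT else @Ordinal 4 0 isT.
have le22 : -2 <= (-2 : R) by []. have le22' : 2 <= (2 : R) by [].
have le02 : (0 : R) <= 2 by []. have le20 : -2 <= (0 : R) by rewrite oppr_le0.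
exists f, s; split.
- apply: isotopic_to_id_comp; last exact: turn_isotopic.
  apply: isotopic_to_id_comp; last exact: turn_isotopic.
  by apply: isotopic_to_id_comp => //; exact: turn_isotopic.
- move=> i j; rewrite /s; have := cov i; have := cov j; rewrite !inE.
  do 4!case: eqP => [->|_] //=; do 4!case: eqP => [->|_] //=.
- move=> [q z]; rewrite /axis /= => ->; rewrite /f /= /g /M /= !mulr0 addr0 subr0.
  by rewrite /m1 /m2 /m3 !turn_cut.
- move=> i p up.
  have gp : page (v i) (g p).
    case: up => r r0 E; exists r => //; rewrite /g /v /= E /M /=.
    by apply: (f_equal2 pair); ring.
  have [pol0 pol1 polN1] := pol_axes.
  rewrite /f /=; move: (cov i); rewrite /s; have [e|ni0] := eqVneq i i0.
    move=> _; move: gp; rewrite e vS; case: (g p) => q z [r r0 /= ->].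
    have rr : r * -1 <= 0 by rewrite mulrN1 oppr_le0.
    rewrite mulr0 /m1 /m2 /m3 !turn_cut //; exists r => //=.
    by rewrite mulr0.
  have gp' := page_pol (nv i) gp; rewrite -/(c i) in gp'.
  have w c' (l r : R) : pol (1 : R) c' = (l, r) -> page (pol 1 c') `<=` page (l, r) by move=> ->.
  rewrite !inE (negbTE ni0) /=.
  have [e _|ni1] := eqVneq i i1.
    have p1 : page (pol 1 e1) (m1 (g p)).
      by apply: page_turn => //; rewrite -?e //; exact: c2.
    have p2 : page (pol 1 (-1)) (m2 (m1 (g p))).
      rewrite -(shift_ang_peak (-1) h2); apply: page_turn => //.
      by rewrite ltr_norml e1l (lt_trans e1r).
    have p3 : page (pol 1 (-1)) (m3 (m2 (m1 (g p)))).
      rewrite -(@shift_ang_out _ 0 2 e3 1 (-1) h3); last by left; rewrite oppr_le0.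
      apply: page_turn => //.
      by rewrite normrN1 ltr1n.
    by move: p3; apply: w.
  rewrite /=; have [e _|ni2] := eqVneq i i2.
    have p1 : page (pol 1 0) (m1 (g p)).
      by rewrite -(shift_ang_peak 0 h1); apply: page_turn; rewrite // -?e //; exact: c2.
    have n0 : `|0 : R| < 2 by rewrite normr0.
    have p2 : page (pol 1 0) (m2 (m1 (g p))).
      rewrite -(@shift_ang_out _ (-2) 0 e1 (-1) 0 h2); last by right.
      exact: page_turn.
    have p3 : page (pol 1 0) (m3 (m2 (m1 (g p)))).
      rewrite -(@shift_ang_out _ 0 2 e3 1 0 h3); last by left.
      exact: page_turn.
    by move: p3; apply: w.
  move=> /= /eqP e.
  have p1 : page (pol 1 e3) (m1 (g p)).
    by apply: page_turn => //; rewrite -?e //; exact: c2.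
  have n3' : `|e3| < 2 by rewrite ltr_norml e3r andbT (lt_trans _ e3l) // oppr_lt0.
  have p2 : page (pol 1 e3) (m2 (m1 (g p))).
    rewrite -(@shift_ang_out _ (-2) 0 e1 (-1) e3 h2); last by right; lra.
    exact: page_turn.
  have p3 : page (pol 1 1) (m3 (m2 (m1 (g p)))).
    by have := @page_turn 0 2 e3 1 e3 _ le20 le22' h3 n3' p2; rewrite shift_ang_peak.
  by move: p3; apply: w.
Qed.

End NormalPages.

Lemma dirP (P : 'I_4 -> Prop) : P (@Ordinal 4 0 isT) -> P (@Ordinal 4 1 isT) ->
  P (@Ordinal 4 2 isT) -> P (@Ordinal 4 3 isT) -> forall p, P p.
Proof.
move=> h0 h1 h2 h3 [[|[|[|[|//]]]] hp].
- by rewrite (_ : Ordinal hp = @Ordinal 4 0 isT) //; exact: val_inj.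
- by rewrite (_ : Ordinal hp = @Ordinal 4 1 isT) //; exact: val_inj.
- by rewrite (_ : Ordinal hp = @Ordinal 4 2 isT) //; exact: val_inj.
- by rewrite (_ : Ordinal hp = @Ordinal 4 3 isT) //; exact: val_inj.
Qed.

(** * Disjoint wedges around the four coordinate pages *)

Section PageWedges.
Context {R : realType}.
Notation E3 := (space3 R).

Definition page_frame (p : 'I_4) (v : R * R) : R * R :=
  (v.1 * (dir p).1 - v.2 * (dir p).2, v.1 * (dir p).2 + v.2 * (dir p).1).

Definition page_coord (p : 'I_4) (v : R * R) : R * R :=
  (v.1 * (dir p).1 + v.2 * (dir p).2, - v.1 * (dir p).2 + v.2 * (dir p).1).

Lemma dir_norm (p : 'I_4) : (dir p).1 ^+ 2 + (dir p).2 ^+ 2 = 1 :> R.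
Proof. by move: p; apply: dirP; rewrite /dir /=; ring. Qed.

Lemma page_frameK p : cancel (page_frame p) (page_coord p).
Proof.
move=> [x y]; rewrite /page_frame /page_coord /=; have := dir_norm p; move: (dir p) => [c d] /= h.
by apply: (f_equal2 pair); rewrite -[RHS]mulr1 -h; ring.
Qed.

Lemma page_coordK p : cancel (page_coord p) (page_frame p).
Proof.
move=> [x y]; rewrite /page_frame /page_coord /=; have := dir_norm p; move: (dir p) => [c d] /= h.
by apply: (f_equal2 pair); rewrite -[RHS]mulr1 -h; ring.
Qed.

(** The wedges |y| <= x of different coordinate pages meet at most along their boundaries, so a move
    supported in one of them fixes the contents of the others. *)
Lemma page_frame_other (p p' : 'I_4) (v : R * R) : p != p' -> `|v.2| <= v.1 ->
  (page_coord p (page_frame p' v)).1 <= `|(page_coord p (page_frame p' v)).2|.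
Proof.
move: v => [x y] /= + h; have := h; have y0 := normr_ge0 y; rewrite ler_norml => /andP[? ?].
have x0 : 0 <= x by apply: le_trans h.
move: p p'; apply: dirP; apply: dirP => // _; rewrite /page_coord /page_frame /dir /=
   ?(mulr0, mul0r, mulr1, mul1r, addr0, add0r, subr0, sub0r, mulrN1, opprK, oppr0);
  rewrite ?normrN ?(ger0_norm x0) //; lra.
Qed.

Variables (J : finType) (pg : J -> 'I_4).
Variables (xB zB tB xA zA : J -> R -> R) (c : R).
Hypotheses (cxB : forall j, continuous (xB j)) (czB : forall j, continuous (zB j)).
Hypotheses (ctB : forall j, continuous (tB j)).
Hypotheses (cxA : forall j, continuous (xA j)) (czA : forall j, continuous (zA j)).
Hypothesis injB : forall j j' (u u' : R), pg j = pg j' -> u \in `[0, 1] -> u' \in `[0, 1] ->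
  xB j u = xB j' u' -> zB j u = zB j' u' -> j = j' /\ u = u'.
Hypothesis injA : forall j j' (u u' : R), pg j = pg j' -> u \in `[0, 1] -> u' \in `[0, 1] ->
  xA j u = xA j' u' -> zA j u = zA j' u' -> j = j' /\ u = u'.
Hypothesis xB_ge0 : forall j (u : R), u \in `[0, 1] -> 0 <= xB j u.
Hypothesis xA_ge0 : forall j (u : R), u \in `[0, 1] -> 0 <= xA j u.
Hypothesis xB_eq0 : forall j (u : R), u \in `[0, 1] -> (xB j u = 0 <-> u = 0 \/ u = 1).
Hypothesis xA_eq0 : forall j (u : R), u \in `[0, 1] -> (xA j u = 0 <-> u = 0 \/ u = 1).
Hypotheses (z0E : forall j, zB j 0 = zA j 0) (z1E : forall j, zB j 1 = zA j 1).
Hypotheses (c_gt0 : 0 < c) (c_lt1 : c < 1).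
Hypothesis tBc : forall j (u : R), u \in `[0, 1] -> `|tB j u| <= c.

Let pB j u : E3 := (page_frame (pg j) (xB j u, tB j u * xB j u), zB j u).
Let pA j u : E3 := (page_frame (pg j) (xA j u, 0), zA j u).

Let page_wedge p : exists f : E3 -> E3, isotopic_to_id f /\
  forall j (u : R), u \in `[0, 1] ->
    [/\ pg j = p -> f (pB j u) = pA j u, pg j != p -> f (pB j u) = pB j u &
        pg j != p -> f (pA j u) = pA j u].
Proof.
have act j j' : pg j == p -> pg j' == p -> pg j = pg j' by move=> /eqP-> /eqP.
have [f [f1 f2 f3]] := @wedge_isotopy R J [pred j | pg j == p] xB zB tB xA zA c cxB czB ctB cxA czA
  (fun j j' u u' a a' => @injB j j' u u' (act j j' a a'))
  (fun j j' u u' a a' => @injA j j' u u' (act j j' a a'))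
  (fun j u _ => @xB_ge0 j u) (fun j u _ => @xA_ge0 j u)
  (fun j u _ => @xB_eq0 j u) (fun j u _ => @xA_eq0 j u) (fun j _ => z0E j) (fun j _ => z1E j)
  c_gt0 c_lt1 tBc.
pose r (v : E3) : E3 := (page_frame p v.1, v.2); pose r' (v : E3) : E3 := (page_coord p v.1, v.2).
have rK : cancel r r' by move=> [v z]; rewrite /r /r' /= page_frameK.
have r'K : cancel r' r by move=> [v z]; rewrite /r /r' /= page_coordK.
have cr : continuous r by move=> v; rewrite /continuous_at /r /page_frame; cts.
have cr' : continuous r' by move=> v; rewrite /continuous_at /r' /page_coord; cts.
exists (r \o f \o r'); split; first exact: isotopic_to_id_conj.
have fixes j (x y z : R) : pg j != p -> `|y| <= x -> (r \o f \o r') (page_frame (pg j) (x, y), z) = (page_frame (pg j) (x, y), z).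
  move=> jp xy; rewrite /= f2; first exact: r'K.
  by apply: (@page_frame_other p (pg j) (x, y)) => //; rewrite eq_sym.
move=> j u u01; split=> [jp|jp|jp].
- have -> : pB j u = r ((xB j u, tB j u * xB j u), zB j u) by rewrite /pB /r jp.
  by rewrite /= rK f3 //= ?jp // /pA jp.
- apply: fixes => //; rewrite normrM (ger0_norm (xB_ge0 _ u01)) -[leRHS]mul1r ler_wpM2r ?xB_ge0 //.
  exact: le_trans (tBc _ u01) (ltW c_lt1).
- by apply: fixes => //; rewrite normr0 xA_ge0.
Qed.

Lemma wedges_isotopy : exists f : E3 -> E3, isotopic_to_id f /\
  forall j (u : R), u \in `[0, 1] ->
    f (page_frame (pg j) (xB j u, tB j u * xB j u), zB j u) = (page_frame (pg j) (xA j u, 0), zA j u).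
Proof.
(* The induction treats one page after the other: arcs of treated pages are already in final
   position, and the later moves must leave them there. *)
suff [f [fi fE]] : exists f : E3 -> E3, isotopic_to_id f /\
    forall j (u : R), u \in `[0, 1] -> f (pB j u) = if pg j \in enum 'I_4 then pA j u else pB j u.
  by exists f; split=> // j u u01; rewrite -/(pB j u) fE // mem_enum.
elim: (enum 'I_4) (enum_uniq 'I_4) => [_|p ps IH /= /andP[pps /IH[f [fi fE]]]].
  by exists id; split=> //; exact: isotopic_to_id_id.
have [g [gi gE]] := page_wedge p; exists (g \o f); split; first exact: isotopic_to_id_comp.
move=> j u u01 /=; rewrite fE // inE; have [g1 g2 g3] := gE j u u01.
have [jp|jp] := eqVneq (pg j) p; last by case: ifP => _; [exact: g3|exact: g2].
by rewrite jp (negbTE pps) g1.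
Qed.

End PageWedges.

(** * Local structure of polygonal links *)

Section PiecewiseLinear.
Context {R : realType}.

(** Written as a sum of clamped increments, the interpolation of the vertices is continuous on the
    whole line without any gluing. *)
Definition plin {V : lmodType R} (v : nat -> V) (N : nat) (t : R) : V :=
  v 0%N + \sum_(k < N) clamp (t - k%:R) *: (v k.+1 - v k).

Lemma plin_seg {V : lmodType R} (v : nat -> V) N j (u : R) : (j < N)%N -> u \in `[0, 1] ->
  plin v N (j%:R + u) = (1 - u) *: v j + u *: v j.+1.
Proof.
move=> jN u01; have := u01; rewrite in_itv /= => /andP[u0 u1].
have H n : (n <= N)%N -> v 0%N + \sum_(k < n) clamp (j%:R + u - k%:R) *: (v k.+1 - v k) =
    if (n <= j)%N then v n else (1 - u) *: v j + u *: v j.+1.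
  elim: n => [|n IH] nN; first by rewrite big_ord0 addr0 leq0n.
  rewrite big_ord_recr /= addrA IH ?(ltnW nN) //.
  have [nj|jn|->] := ltngtP n j.
  - rewrite clamp_ge1; first by rewrite scale1r addrC subrK.
    have : n%:R + 1 <= j%:R :> R by rewrite natr1 ler_nat.
    by lra.
  - rewrite clamp_le0 ?scale0r ?addr0 //.
    have : j%:R + 1 <= n%:R :> R by rewrite natr1 ler_nat.
    by lra.
  - rewrite addrAC subrr add0r clamp_id // scalerBr scalerBl scale1r.
    by rewrite addrA addrAC.
by rewrite /plin H // leqNgt jN.
Qed.

Lemma plin_cont {V : normedModType R} (v : nat -> V) N : continuous (plin v N).
Proof.
move=> t; rewrite /continuous_at /plin; apply: cvgD; first exact: cvg_cst.
apply: cvg_sumr => k; apply: cvgZr_tmp.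
by apply: (continuous_cvg _ (@clamp_cont _ _)); cts.
Qed.

End PiecewiseLinear.

Section LocalLines.
Context {R : realType}.
Notation E3 := (space3 R).

(** The complement of the closed set [D] plays the role of the neighbourhood of [y] in which all of
    [S] lies on the arc [g]. *)
Definition line_chart (S : set E3) (y : E3) (g : R -> E3) : Prop :=
  [/\ continuous g, g 0 = y,
      forall v w : R, v \in `[-1, 1] -> w \in `[-1, 1] -> g v = g w -> v = w,
      forall v : R, v \in `[-1, 1] -> S (g v)
    & exists2 D : set E3, closed D /\ ~ D y &
        forall x, S x -> ~ D x -> exists2 v : R, v \in `[-1, 1] & g v = x].

(** This is what remains of polygonality after an arbitrary ambient isotopy, and it suffices to
    count the arcs at a point of the axis. *)
Definition locally_line (S : set E3) : Prop :=
  forall y, S y -> exists g, line_chart S y g.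

Lemma locally_line_image (f f' : E3 -> E3) (S : set E3) : continuous f -> continuous f' ->
  cancel f f' -> cancel f' f -> locally_line S -> locally_line (f @` S).
Proof.
move=> cf cf' fK f'K lS _ [y Sy <-]; have [g [cg g0 ginj gS [D [clD Dy] gD]]] := lS y Sy.
exists (f \o g); split.
- by move=> v; apply: continuous_comp; [exact: cg|exact: cf].
- by rewrite /= g0.
- by move=> v w v1 w1 /(can_inj fK); exact: ginj.
- by move=> v v1; exists (g v) => //; exact: gS.
- exists (f' @^-1` D).
    by split; [apply: closed_comp => // x _; exact: cf'|rewrite /preimage /= fK].
  move=> _ [x Sx <-]; rewrite /preimage /= fK => /(gD x Sx)[v v1 <-].
  by exists v.
Qed.

Lemma locally_line_isotopic (K L : set E3) :
  ambient_isotopic K L -> locally_line K -> locally_line L.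
Proof.
move=> [H [G [_ h _ <-]]] lK.
have in1 : (1 : R) \in `[0, 1] by rewrite in_itv /= ler01 lexx.
have [c1 c2 k1 k2] := h 1 in1.
exact: (locally_line_image c1 c2 k1 k2).
Qed.

Lemma closed_image_itv (f : R -> E3) (a b : R) : continuous f -> closed (f @` `[a, b]).
Proof.
move=> cf; apply: compact_closed; first exact: norm_hausdorff.
apply: continuous_compact; last exact: segment_compact.
exact: continuous_subspaceT.
Qed.

(* A neighbourhood of the point of parameter t0 on a circle [0, 1] / (0 = 1), together
   with two closed intervals covering the complement. *)
Lemma circle_chart {T : topologicalType} (f : R -> T) (t0 : R) : continuous f -> f 1 = f 0 ->
  t0 \in `[0, 1[ -> exists (g : R -> R) (I1 I2 : R * R),
  [/\ continuous (f \o g) /\ g 0 = t0,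
    (forall v, v \in `[-1, 1] -> g v \in `[0, 1[) /\ {in `[-1, 1] &, injective g},
    (forall t, t \in `[0, 1[ -> [\/ t \in `[I1.1, I1.2], t \in `[I2.1, I2.2] |
       exists2 v, v \in `[-1, 1] & g v = t]),
    (forall t, t \in `[I1.1, I1.2] -> t \in `[0, 1] /\ t - 1 != t0 /\ t != t0) &
    (forall t, t \in `[I2.1, I2.2] -> t \in `[0, 1] /\ t - 1 != t0 /\ t != t0)].
Proof.
move=> cf f1; rewrite in_itv /= => /andP[t00 t01].
have [tz|tn] := eqVneq t0 0.
  exists (fun v => if 0 <= v then v / 4 else 1 + v / 4), (1/4, 3/4), (1/4, 3/4).
  split; [split|split| | |].
  - have -> : f \o (fun v => if 0 <= v then v / 4 else 1 + v / 4) =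
      (fun v : R => if 0 <= v then f (v / 4) else f (1 + v / 4)).
      by apply/funext => v /=; case: ifP.
    apply: (@glue_cont _ _ _ id).
    + by move=> v; exact: cvg_id.
    + by move=> v; apply: (continuous_cvg _ (@cf (v / 4))); cts.
    + by move=> v; apply: (continuous_cvg _ (@cf (1 + v / 4))); cts.
    + by move=> v ->; rewrite mul0r addr0 f1.
  - by rewrite lexx mul0r tz.
  - by move=> v; rewrite !in_itv /= => /andP[? ?]; case: (leP 0 v) => ?; apply/andP; split; lra.
  - move=> v w; rewrite !in_itv /= => /andP[? ?] /andP[? ?].
    by case: (leP 0 v) => ?; case: (leP 0 w) => ?; lra.
  - move=> t; rewrite in_itv /= => /andP[h0 h1].
    have [h2|h2] := leP t (1/4).
      apply: Or33; exists (4 * t); first by rewrite in_itv /=; apply/andP; split; lra.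
      by case: leP => ?; lra.
    have [h3|h3] := leP t (3/4).
      by apply: Or31; rewrite in_itv /=; apply/andP; split; lra.
    apply: Or33; exists (4 * t - 4); first by rewrite in_itv /=; apply/andP; split; lra.
    by case: leP => ?; lra.
  - move=> t; rewrite !in_itv /= => /andP[? ?]; split; first by apply/andP; split; lra.
    by split; apply/eqP; lra.
  - move=> t; rewrite !in_itv /= => /andP[? ?]; split; first by apply/andP; split; lra.
    by split; apply/eqP; lra.
have tp : 0 < t0 by rewrite lt_neqAle eq_sym tn.
pose r := Num.min t0 (1 - t0) / 2.
have r1 : r < t0 by rewrite /r; case: (leP t0 (1 - t0)) => ?; lra.
have r2 : r < 1 - t0 by rewrite /r; case: (leP t0 (1 - t0)) => ?; lra.
have r0 : 0 < r by rewrite /r; case: (leP t0 (1 - t0)) => ?; lra.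
exists (fun v => t0 + r * v), (0, t0 - r), (t0 + r, 1); split; [split|split| | |].
- by move=> v; apply: (continuous_cvg _ (@cf (t0 + r * v))); cts.
- by rewrite mulr0 addr0.
- move=> v; rewrite !in_itv /= => /andP[? ?]; apply/andP; split; nra.
- move=> v w _ _ /addrI; apply: mulfI; by rewrite gt_eqF.
- move=> t; rewrite in_itv /= => /andP[h0 h1].
  have [h2|h2] := leP t (t0 - r); first by apply: Or31; rewrite in_itv /= h0.
  have [h3|h3] := leP (t0 + r) t; first by apply: Or32; rewrite in_itv /= h3 ltW.
  apply: Or33; exists ((t - t0) / r); last by field; rewrite gt_eqF.
  by rewrite in_itv /= ler_pdivlMr // ler_pdivrMr //; apply/andP; split; lra.
- move=> t; rewrite !in_itv /= => /andP[? ?]; split; first by apply/andP; split; lra.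
  by split; apply/eqP; lra.
- move=> t; rewrite !in_itv /= => /andP[? ?]; split; first by apply/andP; split; lra.
  by split; apply/eqP; lra.
Qed.

Lemma locally_line_polygonal (P : set E3) : polygonal_link P -> locally_line P.
Proof.
move=> [k [N [c [[k0 N0] cl lin inj ->]]]].
have Nr : 0 < N%:R :> R by rewrite ltr0n.
(* The map [c i] is prescribed only on [0, 1]; [e i] is a continuous function on the whole line that
   agrees with it there. *)
pose e i (t : R) := plin (fun j => c i (j%:R / N%:R)) N (N%:R * t).
have ce i : continuous (e i).
  move=> t; apply: (continuous_cvg _ (@plin_cont _ _ _ _ (N%:R * t))); cts.
have eE i (t : R) : t \in `[0, 1] -> e i t = c i t.
  rewrite in_itv /= => /andP[t0 t1].
  have [j [jN u01 tE]] : exists j, [/\ (j < N)%N, N%:R * t - j%:R \in `[0, 1] &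
      t = (j%:R + (N%:R * t - j%:R)) / N%:R].
    have tE j : t = (j%:R + (N%:R * t - j%:R)) / N%:R by field; rewrite gt_eqF.
    have [te|tn] := eqVneq t 1.
      exists N.-1; split=> //; first by rewrite prednK.
      rewrite te mulr1 in_itv /= -{1 3}(prednK N0) -natr1.
      by apply/andP; split; lra.
    have Nt0 : 0 <= N%:R * t by rewrite mulr_ge0 // ltW.
    exists (Num.truncn (N%:R * t)); split=> //.
      rewrite truncn_lt_nat // -[X in _ < X]mulr1 ltr_pM2l //.
      by rewrite lt_neqAle tn.
    have /andP[h1 h2] := truncn_itv Nt0.
    rewrite in_itv /=; apply/andP; split; first by lra.
    by move: h2; rewrite -natr1; lra.
  have := plin_seg (fun j => c i (j%:R / N%:R)) jN u01.
  rewrite addrC subrK -/(e i t) => ->.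
  by have /= <- := lin i (Ordinal jN) _ u01; rewrite -tE.
have e1 i : e i 1 = e i 0 by rewrite !eE ?in_itv /= ?lexx ?ler01 ?cl.
have einj i j (s t : R) : s \in `[0, 1[ -> t \in `[0, 1[ -> e i s = e j t -> i = j /\ s = t.
  have w (r : R) : r \in `[0, 1[ -> r \in `[0, 1].
    by rewrite !in_itv /= => /andP[-> /ltW ->].
  by move=> s1 t1; rewrite !eE ?w //; exact: inj.
have PE x : (\bigcup_i (c i @` `[0, 1[)) x <-> exists i, exists2 t : R, t \in `[0, 1[ & e i t = x.
  have w (r : R) : r \in `[0, 1[ -> r \in `[0, 1].
    by rewrite !in_itv /= => /andP[-> /ltW ->].
  split=> [[i _ [t /= t1 <-]]|[i [t t1 <-]]].
    by exists i, t => //; rewrite eE // w.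
  by exists i => //; exists t => //; rewrite eE // w.
move=> y /PE[i [t0 t01 yE]].
pose Do := \bigcup_(j in [set j | j != i]) (e j @` `[0, 1]).
have clDo : closed Do.
  by apply: closed_bigcup; [exact: finite_finset|move=> j _; exact: closed_image_itv].
have Doy : ~ Do y.
  move=> [j /= ji [t /= + E]]; rewrite in_itv /= => /andP[t0' t1'].
  have [te|tn] := eqVneq t 1.
    have z0 : (0 : R) \in `[0, 1[ by rewrite in_itv /= lexx ltr01.
    have [ij _] := einj _ _ _ _ z0 t01 (etrans (esym (e1 j)) (etrans (congr1 (e j) (esym te)) (etrans E (esym yE)))).
    by rewrite ij eqxx in ji.
  have tt : t \in `[0, 1[ by rewrite in_itv /= t0' lt_neqAle tn.
  have [ij _] := einj _ _ _ _ tt t01 (etrans E (esym yE)).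
  by rewrite ij eqxx in ji.
have [g [I1 [I2 [[cg g0] [g01 ginj] cov hI1 hI2]]]] := circle_chart (@ce i) (e1 i) t01.
have nI (I : R * R) : (forall t, t \in `[I.1, I.2] -> t \in `[0, 1] /\ t - 1 != t0 /\ t != t0) ->
    ~ (e i @` `[I.1, I.2]) y.
  move=> hI [t /= tI E]; have [] := hI t tI.
  rewrite in_itv /= => /andP[a0 a1] [nt nt'].
  have [te|tn] := eqVneq t 1.
    have z0 : (0 : R) \in `[0, 1[ by rewrite in_itv /= lexx ltr01.
    have E' : e i 0 = e i t0 by rewrite -e1 -te E yE.
    have [_ tt0] := einj _ _ _ _ z0 t01 E'.
    by rewrite te subrr tt0 eqxx in nt.
  have tt : t \in `[0, 1[ by rewrite in_itv /= a0 lt_neqAle tn.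
  have [_ h] := einj _ _ _ _ tt t01 (etrans E (esym yE)).
  by rewrite h eqxx in nt'.
exists (e i \o g); split; first exact: cg.
- by rewrite /= g0.
- by move=> v w v1 w1 /= E; apply: ginj => //;
    have [] := einj _ _ _ _ (g01 v v1) (g01 w w1) E.
- by move=> v v1; apply/PE; exists i, (g v) => //; exact: g01.
- exists (Do `|` (e i @` `[I1.1, I1.2] `|` e i @` `[I2.1, I2.2])).
    have cl1 := closed_image_itv (a := I1.1) (b := I1.2) (ce i).
    have cl2 := closed_image_itv (a := I2.1) (b := I2.2) (ce i).
    split; first exact: closedU clDo (closedU cl1 cl2).
    by move=> [//|[]]; exact: nI.
  move=> x /PE[j [t t1 <-]] nD.
  have ji : j = i.
    apply/eqP; apply/negPn/negP => ji; apply: nD; left; exists j => //; exists t => //.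
    by move: t1; rewrite /= !in_itv /= => /andP[-> /ltW ->].
  rewrite ji in nD *; case: (cov t t1) => [h|h|[v v1 <-]].
  - by case: nD; right; left; exists t.
  - by case: nD; right; right; exists t.
  - by exists v.
Qed.

End LocalLines.

(** * Pairing and orienting the arcs *)

Lemma sgr_pos_inj {R : realType} (s s' : bool) (x y : R) : 0 < x -> 0 < y ->
  (-1) ^+ s * x = (-1) ^+ s' * y -> s = s'.
Proof.
by move=> x0 y0; case: s s' => [] []; rewrite ?expr1 ?expr0 ?mul1r ?mulN1r // => ?;
   exfalso; lra.
Qed.

Section EndPairs.
Context {R : realType} {J : finType}.
Notation E3 := (space3 R).

Variables (L : set E3) (a : J -> R -> E3).
Hypothesis ca : forall j, continuous (a j).
Hypothesis ainj : forall j (t t' : R), t \in `[0, 1] -> t' \in `[0, 1] -> a j t = a j t' -> t = t'.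
Hypothesis LE : forall x, L x <-> exists j, exists2 t : R, t \in `[0, 1] & a j t = x.
Hypothesis aint : forall j j' (t t' : R), t \in `]0, 1[ -> t' \in `[0, 1] -> a j t = a j' t' ->
  j = j' /\ t = t'.
Hypothesis lineL : locally_line L.

Definition from_end (e : J * bool) (t : R) : E3 := a e.1 (if e.2 then 1 - t else t).

Let in01 (b : bool) (t : R) : t \in `[0, 1] -> (if b then 1 - t else t) \in `[0, 1].
Proof. by case: b => //; rewrite !in_itv /= => /andP[? ?]; apply/andP; split; lra. Qed.

Let in01o (b : bool) (t : R) : t \in `]0, 1[ -> (if b then 1 - t else t) \in `]0, 1[.
Proof. by case: b => //; rewrite !in_itv /= => /andP[? ?]; apply/andP; split; lra. Qed.

Lemma from_end_cont e : continuous (from_end e).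
Proof.
case: e => j [] t; apply: (continuous_cvg _ (@ca j _)); cts.
Qed.

Lemma from_end_inj e (t t' : R) : t \in `[0, 1] -> t' \in `[0, 1] ->
  from_end e t = from_end e t' -> t = t'.
Proof.
move=> t1 t1' /(ainj (in01 _ t1) (in01 _ t1')); case: (e.2) => // /(congr1 (fun x => 1 - x)).
by rewrite !subKr.
Qed.

Let zero01 : (0 : R) \in `[0, 1]. Proof. by rewrite in_itv /= lexx ler01. Qed.

(* Read in a line chart, the arc leaving an end runs along one of the two sides. *)
Lemma germ_side e g : line_chart L (from_end e 0) g ->
  exists (s : bool) (tau d : R), [/\ 0 < tau < 1, 0 < d < 1,
    forall v : R, 0 < v -> v <= d -> exists2 t : R, 0 < t <= tau &
      from_end e t = g ((-1) ^+ s * v) &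
    forall t : R, 0 < t <= tau -> exists2 v : R, 0 < v <= 1 & from_end e t = g ((-1) ^+ s * v)].
Proof.
move=> [cg g0 ginj gL [D [clD nD] gD]].
have [tau /andP[tau0 tau1] tauD] : exists2 tau : R, 0 < tau < 1 &
    forall t : R, 0 <= t <= tau -> ~ D (from_end e t).
  have : nbhs (from_end e 0) (~` D) by apply: open_nbhs_nbhs; split => //; exact: closed_openC.
  move=> /(@from_end_cont e 0)/nbhs_ballP[r /= r0 rD].
  exists (Num.min r 1 / 2); first by case: (leP r 1) => ?; apply/andP; split; lra.
  move=> t /andP[t0 tr]; apply: (rD t); rewrite /ball /= sub0r normrN ger0_norm //.
  by move: tr; case: (leP r 1) => ? ?; lra.
have tin t : 0 <= t <= tau -> t \in `[0, 1].
  by move=> /andP[? ?]; rewrite in_itv /=; apply/andP; split; lra.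
have ex t : {v | 0 <= t <= tau -> v \in `[-1, 1] /\ g v = from_end e t}.
  apply: cid; have [h|h] := boolP (0 <= t <= tau); last by exists 0.
  have Lx : L (from_end e t) by apply/LE; exists e.1, (if e.2 then 1 - t else t) => //; exact/in01/tin.
  by have [v v1 vE] := gD _ Lx (tauD t h); exists v.
pose psi t := projT1 (ex t).
have psi1 t : 0 <= t <= tau -> psi t \in `[-1, 1] by move=> h; have [] := projT2 (ex t) h.
have psiE t : 0 <= t <= tau -> g (psi t) = from_end e t.
  by move=> h; have [] := projT2 (ex t) h.
(* Closed sets of chart parameters have compact images, because [-1, 1] is compact, and [g] is
   injective there; this makes preimages under [psi] closed. *)
have cpsi : {within `[0, tau], continuous psi}.
  apply/continuous_closedP => C cC; apply/closed_subspaceP.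
  exists (from_end e @^-1` (g @` (`[-1, 1] `&` C))).
    apply: closed_comp => [x _|]; first exact: from_end_cont.
    apply: compact_closed; first exact: norm_hausdorff.
    apply: continuous_compact; first exact: continuous_subspaceT.
    by apply: compact_closedI => //; exact: segment_compact.
  apply/seteqP; split => t [] /=; last first.
    move=> Ct t01; split => //; exists (psi t); last by rewrite psiE.
    by split => //; exact: psi1.
  move=> [v [v1 Cv] E] t01; split => //.
  change (C (psi t)); suff -> : psi t = v by [].
  by apply: ginj => //; [exact: psi1|rewrite psiE].
have psi_n0 t : 0 < t <= tau -> psi t != 0.
  move=> /andP[t0 tt]; apply/eqP => h.
  have tt' : 0 <= t <= tau by rewrite (ltW t0).
  have := psiE t tt'; rewrite h g0 => /(from_end_inj zero01 (tin _ tt')) E.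
  by rewrite E ltxx in t0.
have psi_0 : psi 0 = 0.
  have h0 : 0 <= (0 : R) <= tau by rewrite lexx ltW.
  apply: ginj; [exact: psi1|by rewrite in_itv /=; apply/andP; split; lra|].
  by rewrite psiE.
pose s := psi tau < 0.
have htau : 0 < tau <= tau by rewrite tau0 lexx.
(* [psi] vanishes only at 0, so by the intermediate value theorem it keeps on the whole germ the
   sign that it has at [tau]. *)
have sgn (t : R) : 0 < t <= tau -> 0 < (-1) ^+ s * psi t.
  move=> /andP[t0 tt]; rewrite ltNge; apply/negP => h.
  have [] := @IVT R psi t tau 0 tt.
  - apply: continuous_subspaceW cpsi => x /=; rewrite !in_itv /= => /andP[h1 ->].
    by rewrite (le_trans (ltW t0)).
  - have := psi_n0 _ htau; rewrite /s in h; move: h.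
    rewrite minC maxC; have [ps|ps] := ltP (psi tau) 0.
      rewrite expr1 mulN1r oppr_le0 => h _.
      by rewrite ge_min le_max h (ltW ps) orbT.
    rewrite expr0 mul1r => h _.
    by rewrite ge_min le_max h ps orbT.
  - move=> c; rewrite in_itv /= => /andP[c1 c2].
    by apply/eqP/psi_n0; rewrite c2 (lt_le_trans t0).
have sK (x : R) : (-1) ^+ s * ((-1) ^+ s * x) = x by rewrite mulrA -expr2 sqrr_sign mul1r.
exists s, tau, (Num.min ((-1) ^+ s * psi tau) 1 / 2); split.
- by rewrite tau0.
- have := sgn _ htau; case: (leP ((-1) ^+ s * psi tau) 1) => ? ?; apply/andP; split; lra.
- move=> v v0 vd.
  have vp : v <= (-1) ^+ s * psi tau.
    by move: vd; have := sgn _ htau; case: (leP ((-1) ^+ s * psi tau) 1) => ? ? ?; lra.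
  have [|c cI cE] := @IVT R psi 0 tau ((-1) ^+ s * v) (ltW tau0) cpsi.
    rewrite psi_0; move: vp; rewrite /s; case: ltP => ps.
      by rewrite expr1 !mulN1r => vp; apply/andP; split; lra.
    by rewrite expr0 !mul1r => vp; apply/andP; split; lra.
  move: cI; rewrite in_itv /= => /andP[c0 ct].
  exists c; last by rewrite -cE psiE // c0.
  rewrite ct andbT lt_neqAle c0 andbT eq_sym; apply/eqP => cz.
  move: cE; rewrite cz psi_0 => /esym/eqP; rewrite mulf_eq0 signr_eq0 /= => /eqP vz.
  by rewrite vz ltxx in v0.
- move=> t tt; exists ((-1) ^+ s * psi t); last first.
    by rewrite sK psiE //; case/andP: tt => /ltW -> ->.
  rewrite sgn //=; have : psi t \in `[-1, 1] by apply: psi1; case/andP: tt => /ltW -> ->.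
  rewrite in_itv /= => /andP[? ?].
  by case: (s); rewrite ?expr1 ?expr0 ?mul1r ?mulN1r; lra.
Qed.

(** Two ends on the same side of a line chart would share interior points of arcs, so each side
    carries at most one end. The side opposite to [e] is not empty either: its points near the
    centre belong to the link and can only lie on the germ of another end. *)
Lemma end_pairs e : exists e', [/\ e' <> e, from_end e' 0 = from_end e 0 &
  forall e'', from_end e'' 0 = from_end e 0 -> e'' = e \/ e'' = e'].
Proof.
have Le : L (from_end e 0) by apply/LE; exists e.1, (if e.2 then 1 - 0 else 0) => //; exact: in01.
have [g cg] := lineL Le; have [cgg g0 ginj gL _] := cg.
pose At e' := from_end e' 0 = from_end e 0.
have germ e' : At e' -> exists (s : bool) (tau d : R), [/\ 0 < tau < 1, 0 < d < 1,
    forall v : R, 0 < v -> v <= d -> exists2 t : R, 0 < t <= tau &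
      from_end e' t = g ((-1) ^+ s * v) &
    forall t : R, 0 < t <= tau -> exists2 v : R, 0 < v <= 1 & from_end e' t = g ((-1) ^+ s * v)].
  by move=> h; apply: germ_side; rewrite h.
have endat j (t : R) : t \in `[0, 1] -> a j t = from_end e 0 -> exists2 b, At (j, b) & t = if b then 1 else 0.
  move=> t1 E; have [tt|] := boolP (t \in `]0, 1[).
    have [_ h] := aint tt (in01 e.2 zero01) E.
    by move: tt; rewrite h in_itv /=; case: (e.2) => /andP[]; rewrite ?subr0 ltxx.
  move: t1; rewrite !in_itv /= => /andP[t0 t1]; rewrite negb_and -!leNgt => /orP[h|h].
    have tz : t = 0 by apply/eqP; rewrite eq_le h t0.
    by exists false => //; rewrite /At -E tz.
  have tz : t = 1 by apply/eqP; rewrite eq_le h t1.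
  by exists true => //; rewrite /At -E tz /from_end /= subr0.
have side_inj e1 e2 s : At e1 -> At e2 ->
    (exists (tau d : R), [/\ 0 < tau < 1, 0 < d < 1 & forall v : R, 0 < v -> v <= d -> exists2 t : R, 0 < t <= tau &
      from_end e1 t = g ((-1) ^+ s * v)]) ->
    (exists (tau d : R), [/\ 0 < tau < 1, 0 < d < 1 & forall v : R, 0 < v -> v <= d -> exists2 t : R, 0 < t <= tau &
      from_end e2 t = g ((-1) ^+ s * v)]) -> e1 = e2.
  move=> A1 A2 [tau1 [d1 [/andP[_ tl1] /andP[d10 _] h1]]] [tau2 [d2 [/andP[_ tl2] /andP[d20 _] h2]]].
  have m0 : 0 < Num.min d1 d2 by rewrite lt_min d10.
  have min1l : Num.min d1 d2 <= d1 by rewrite ge_min lexx.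
  have min1r : Num.min d1 d2 <= d2 by rewrite ge_min lexx orbT.
  have [t1 /andP[t10 t11] E1] := h1 _ m0 min1l.
  have [t2 /andP[t20 t21] E2] := h2 _ m0 min1r.
  have to1 : t1 \in `]0, 1[ by rewrite in_itv /= t10 (le_lt_trans t11).
  have to2 : t2 \in `[0, 1] by rewrite in_itv /= (ltW t20) (le_trans t21) // ltW.
  have [ej _] := aint (in01o e1.2 to1) (in01 e2.2 to2) (etrans E1 (esym E2)).
  case: e1 e2 A1 A2 ej {h1 h2 E1 E2} => [j b] [j' b'] A1 A2 /= ej; subst j'.
  congr pair; apply/eqP; apply/negPn/negP => bb.
  have := etrans A1 (esym A2); rewrite /from_end /= => /(ainj (in01 _ zero01) (in01 _ zero01)).
  by move: bb; clear; case: b b' => [] [] //= _; rewrite subr0 => /eqP; rewrite ?oner_eq0 // eq_sym oner_eq0.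
have [s [tau [d [tau01 d01 h1 h2]]]] := germ e erefl.
have [e' [Ae' nee']] : exists e', At e' /\ e' <> e.
  pose F (x : {e' | At e'}) := germ _ (projT2 x).
  (* The length of a germ is set to 0 for ends that lie elsewhere. Once these germs are removed, the
     rest of the arcs is a closed set that misses the point. *)
  have cut e' : exists tau' : R, [/\ 0 <= tau' < 1, At e' -> 0 < tau', (~ At e' -> tau' = 0) &
     At e' -> exists s' : bool, forall t : R, 0 < t <= tau' -> exists2 v : R, 0 < v <= 1 &
        from_end e' t = g ((-1) ^+ s' * v)].
    have [A|nA] := pselect (At e').
      have [s' [tau' [d' [/andP[t0 t1] _ _ h]]]] := germ _ A.
      by exists tau'; split => //; [rewrite (ltW t0)|exists s'].
    by exists 0; split => //; rewrite lexx ltr01.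
  have [T TP] := choice cut.
  pose D := \bigcup_(j in [set: J]) (a j @` `[T (j, false), 1 - T (j, true)]).
  have clD : closed D.
    by apply: closed_bigcup; [exact: finite_finset|move=> j _; exact: closed_image_itv].
  have nD : ~ D (from_end e 0).
    move=> [j _ [t /= + E]]; rewrite in_itv /= => /andP[t0 t1].
    have [/andP[a0 a1] p0 _ _] := TP (j, false); have [/andP[b0 b1] p1 _ _] := TP (j, true).
    have t01 : t \in `[0, 1] by rewrite in_itv /=; apply/andP; split; lra.
    have [[] A tE] := endat j t t01 E.
      by have := p1 A; lra.
    by have := p0 A; lra.
  have : nbhs (g 0) (~` D).
    by rewrite g0; apply: open_nbhs_nbhs; split => //; exact: closed_openC.
  move=> /(cgg 0)/nbhs_ballP[r /= r0 rD].
  pose v := Num.min r 1 / 2.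
  have v0 : 0 < v by rewrite /v; case: (leP r 1) => ?; lra.
  have vr : v < r by rewrite /v; case: (leP r 1) => ?; lra.
  have v1 : v < 1 by rewrite /v; case: (leP r 1) => ?; lra.
  (* A link point on the side opposite to [e] and off [D] lies on the germ of some end; comparing
     sides in the chart shows that this end is not [e]. *)
  have nDv : ~ D (g ((-1) ^+ (~~ s) * v)).
    apply: (rD ((-1) ^+ (~~ s) * v)).
    by rewrite /ball /= sub0r normrN normrM normr_sign mul1r gtr0_norm.
  have sin (b : bool) (w : R) : 0 < w <= 1 -> (-1) ^+ b * w \in (`[-1, 1] : interval R).
    move=> /andP[? ?]; rewrite in_itv /=.
    by case: b; rewrite ?expr1 ?expr0 ?mul1r ?mulN1r; apply/andP; split; lra.
  have vv : 0 < v <= 1 by rewrite v0 ltW.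
  have /LE[j [t t01 E]] : L (g ((-1) ^+ (~~ s) * v)) by apply: gL; exact: sin.
  have tI : ~ (t \in `[T (j, false), 1 - T (j, true)]) by move=> h; apply: nDv; exists j => //; exists t.
  have fin b : At (j, b) -> 0 < (if b then 1 - t else t) <= T (j, b) -> exists e', At e' /\ e' <> e.
    move=> A tt; exists (j, b); split => // ee.
    have [_ _ _ /(_ A)[s' hs']] := TP (j, b).
    have [w w01 Ew] := hs' _ tt.
    have tau't : 0 < T (j, b) by case/andP: tt => ? ?; lra.
    have ss' : s' = s.
      have /andP[tb1 tb2] := tau01.
      pose m := Num.min tau (T (j, b)).
      have m0 : 0 < m by rewrite lt_min tb1.
      have m1 : 0 < m <= tau by rewrite m0 ge_min lexx.
      have m2 : 0 < m <= T (j, b) by rewrite m0 ge_min lexx orbT.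
      have [w1 w11 Ew1] := h2 m m1; have [w2 w21 Ew2] := hs' m m2.
      rewrite ee Ew1 in Ew2; have := ginj _ _ (sin _ _ w11) (sin _ _ w21) Ew2.
      by case/andP: w11 => p1 _; case/andP: w21 => p2 _ /(sgr_pos_inj p1 p2).
    have E' : from_end (j, b) (if b then 1 - t else t) = a j t.
      by rewrite /from_end /=; case: (b); rewrite ?subKr.
    rewrite E' E ss' in Ew; have := ginj _ _ (sin _ _ vv) (sin _ _ w01) Ew.
    by case/andP: w01 => p1 _ /(sgr_pos_inj v0 p1); case: (s).
  move: t01; rewrite in_itv /= => /andP[t0 t1].
  have [/andP[a0 a1] _ n0 _] := TP (j, false); have [/andP[b0 b1] _ n1 _] := TP (j, true).
  have tn0 b : t = (if b then 1 else 0) -> ~ At (j, b).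
    move=> te A; have Ea : g ((-1) ^+ (~~ s) * v) = g 0.
      by rewrite -E g0 -A /from_end /= te; case: (b); rewrite ?subr0.
    have z1 : (0 : R) \in `[-1, 1] by rewrite in_itv /= oppr_le0 ler01.
    have /eqP := ginj _ _ (sin _ _ vv) z1 Ea; rewrite mulf_eq0 signr_eq0 /=.
    by rewrite gt_eqF.
  have [lt|ge] := ltP t (T (j, false)).
    have A : At (j, false) by apply: contrapT => /n0 h; move: lt; rewrite h ltNge t0.
    apply: (fin false A) => /=; rewrite (ltW lt) andbT lt_neqAle t0 andbT eq_sym.
    by apply/eqP => te; exact: (tn0 false).
  have lt : 1 - T (j, true) < t.
    by rewrite ltNge; apply/negP => h; apply: tI; rewrite in_itv /= ge.
  have A : At (j, true) by apply: contrapT => /n1 h; move: lt; rewrite h subr0 ltNge t1.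
  apply: (fin true A) => /=; apply/andP; split; last by rewrite lerBlDr addrC -lerBlDr ltW.
  by rewrite subr_gt0 lt_neqAle t1 andbT; apply/eqP => te; exact: (tn0 true).
exists e'; split => // e'' Ae''.
have [s' [tau' [d' [tau'01 d'01 h1' _]]]] := germ e' Ae'.
have [s'' [tau'' [d'' [tau''01 d''01 h1'' _]]]] := germ e'' Ae''.
have [ss|ss] := eqVneq s'' s.
  left; apply: (@side_inj _ _ s) => //; first by exists tau'', d''; rewrite -ss.
  by exists tau, d.
right; apply: (@side_inj _ _ s'') => //; first by exists tau'', d''.
exists tau', d'; split => // ; suff <- : s' = s'' by [].
have : s' != s.
  apply/eqP => h; apply: nee'; apply: (@side_inj _ _ s) => //; last by exists tau, d.
  by exists tau', d'; rewrite -h.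
by case: (s') (s) (s'') ss => [] [] [].
Qed.

End EndPairs.

Section Orientation.
Variables (J : finType) (V : Type) (lev : J * bool -> V).
Hypothesis lev_ends : forall j, lev (j, false) <> lev (j, true).
Hypothesis lev_pair : forall e, exists e', [/\ e' <> e, lev e' = lev e &
  forall e'', lev e'' = lev e -> e'' = e \/ e'' = e'].

(** [rev] crosses an arc and [oth] passes to the other arc at the same point, so the orbits of
    [next] are the oriented components. Reversal permutes these orbits without fixing any, and an
    orientation picks one orbit from each opposite pair. *)
Lemma orient_arcs : exists (b0 : J -> bool) (nx : J -> J), [/\ injective nx,
  forall j, lev (nx j, b0 (nx j)) = lev (j, ~~ b0 j) &
  forall j j', lev (j, b0 j) = lev (j', b0 j') -> j = j'].
Proof.
have [oth othP] := choice lev_pair.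
have oth_n e : oth e <> e by have [] := othP e.
have oth_l e : lev (oth e) = lev e by have [] := othP e.
have othE e e' : lev e' = lev e -> e' <> e -> e' = oth e.
  by move=> h n; have [_ _ /(_ _ h)[]] := othP e.
have othK : involutive oth.
  by move=> e; apply/esym; apply: othE; [rewrite oth_l|move=> h; apply: (oth_n e)].
pose rev (e : J * bool) := (e.1, ~~ e.2).
have revK : involutive rev by move=> [j b]; rewrite /rev /= negbK.
have rev_l e : lev (rev e) <> lev e.
  by case: e => j [] h; apply: (lev_ends (j := j)); rewrite -?h //; exact/esym.
pose next e := oth (rev e).
have next_inj : injective next by move=> e e' /(inv_inj othK)/(inv_inj revK).
have rn e : next (rev (next e)) = rev e by rewrite /next revK othK.
(* If an orbit contained its reverse, shortening the path at both ends would lead to a fixed point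
   of [rev] or of [oth]. *)
have nrev n : forall e, rev e <> iter n next e.
  elim/ltn_ind: n => -[|[|n]] IH e; first by case: e => j [].
    by move=> /= /esym; exact: oth_n.
  move=> h; apply: (IH n _ (next e)) => //; apply: next_inj.
  by rewrite rn h -iterSr.
have nconn e : froot next e != froot next (rev e).
  apply/eqP => /eqP; rewrite root_connect; last exact: fconnect_sym.
  by move/iter_findex => /esym; exact: nrev.
have root_next e : froot next (next e) = froot next e.
  apply/esym/eqP; rewrite root_connect; last exact: fconnect_sym.
  exact: fconnect1.
have root_rev e : froot next (rev (next e)) = froot next (rev e) by rewrite -(rn e) root_next.
(* Of two opposite orbits, the one whose root comes first in the enumeration gives the
   orientation. *)
pose O e := (enum_rank (froot next e) < enum_rank (froot next (rev e)))%N.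
have ON e : O (rev e) = ~~ O e.
  have ne : (enum_rank (froot next e) : nat) != enum_rank (froot next (rev e)).
    by apply: contra (nconn e) => /eqP h; apply/eqP/enum_rank_inj/ord_inj.
  by move: ne; rewrite /O revK -leqNgt; case: ltngtP.
have Onext e : O (next e) = O e by rewrite /O root_next root_rev.
pose b0 j := O (j, true).
have Ob0 j : O (j, b0 j).
  rewrite /b0; case h : (O (j, true)) => //.
  by have := ON (j, true); rewrite /rev /= h.
have b0E j b : O (j, b) -> b = b0 j.
  rewrite /b0; case: b => h; first by rewrite h.
  by have := ON (j, false); rewrite /rev /= h => ->.
have nextE j : next (j, b0 j) = ((next (j, b0 j)).1, b0 (next (j, b0 j)).1).
  rewrite {1}[next _]surjective_pairing; congr pair; apply: b0E.
  by rewrite -surjective_pairing Onext.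
exists b0, (fun j => (next (j, b0 j)).1); split.
- move=> j j' h; suff /next_inj[] : next (j, b0 j) = next (j', b0 j') by [].
  by rewrite nextE (nextE j') h.
- by move=> j; rewrite -nextE /next oth_l.
- move=> j j' h; apply: contrapT => jj'.
  have E : (j', b0 j') = oth (j, b0 j) by apply: othE => // -[]/esym.
  have := Ob0 j'; rewrite E -[oth _]/(oth (j, b0 j)) -[(j, b0 j)]revK -/(next _) Onext ON.
  by rewrite Ob0.
Qed.

End Orientation.

(** * Strips folded from a periodic sequence of panels *)

Section IntSequences.
Context {R : realType}.

Lemma int_homo_le (f : int -> R) : (forall i, f i < f (i + 1)) ->
  forall i j, i <= j -> f i <= f j.
Proof.
move=> fS i j ij; have -> : j = i + `|j - i|%N.
  by rewrite gez0_abs ?subr_ge0 //; ring.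
elim: `|j - i|%N => [|n IH]; first by rewrite addr0.
by rewrite -addn1 PoszD addrA (le_trans IH) // ltW.
Qed.

Lemma int_quasi_periodic {V : zmodType} (f : int -> V) (m : nat) (l : V) :
  (forall i, f (i + m%:Z) = f i + l) -> forall k i, f (i + k * m%:Z) = f i + l *~ k.
Proof.
move=> fm.
have H (k : nat) i : f (i + k%:Z * m%:Z) = f i + l *~ k.
  elim: k i => [|k IH] i; first by rewrite mul0r addr0 mulr0z addr0.
  by rewrite -addn1 PoszD mulrDl mul1r addrA fm IH mulrzDr mulr1z addrA.
case=> k i; first exact: H.
rewrite NegzE; apply/eqP; rewrite mulrNz eq_sym subr_eq -H -addrA -mulrDl addNr.
by rewrite mul0r addr0.
Qed.

Lemma int_bracket (f : int -> R) (m : nat) (l : R) : (0 < m)%N -> 0 < l ->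
  (forall i, f i < f (i + 1)) -> (forall i, f (i + m%:Z) = f i + l) ->
  forall t, exists i, f i <= t < f (i + 1).
Proof.
move=> m0 l0 fS fm t.
pose K := Num.floor ((t - f 0) / l).
have fK (k : int) : f (k * m%:Z) = f 0 + l * k%:~R.
  by rewrite -[k * _]add0r (int_quasi_periodic fm) -mulrzr.
have /andP[K1 K2] := floor_itv ((t - f 0) / l).
have e1 : f (K * m%:Z) <= t.
  by rewrite fK -lerBrDl mulrC -ler_pdivlMr.
have e2 : t < f (K * m%:Z + m%:Z).
  rewrite -[X in _ + X]mul1r -mulrDl fK -ltrBlDl mulrC -ltr_pdivrMr //.
have ex : exists k : nat, t < f (K * m%:Z + k%:Z + 1).
  by exists m.-1; rewrite -addrA -PoszD addn1 prednK.
exists (K * m%:Z + (ex_minn ex)%:Z); case: ex_minnP => k kt kmin; rewrite kt andbT.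
case: k kt kmin => [|k] kt kmin; first by rewrite addr0.
rewrite leNgt; apply/negP => h; have := kmin k.
by rewrite -addrA -PoszD addn1 h ltnn => /(_ isT).
Qed.

Lemma int_bracket_uniq (f : int -> R) t i j : (forall i, f i < f (i + 1)) ->
  f i <= t < f (i + 1) -> f j <= t < f (j + 1) -> i = j.
Proof.
move=> fS /andP[i1 i2] /andP[j1 j2].
have H a b : f a <= t -> t < f (b + 1) -> a <= b.
  move=> h1 h2; rewrite leNgt; apply/negP; rewrite -lezD1 => /(int_homo_le fS) h.
  by have := lt_le_trans h2 (le_trans h h1); rewrite ltxx.
by apply/eqP; rewrite eq_le !H.
Qed.

End IntSequences.

Section Strips.
Context {R : realType}.

Variables (w l : R) (tw : bool) (m : nat).
Variables (pos slope : int -> R) (V d n : int -> R * R) (h : int -> R).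
Let tau : R := (-1) ^+ tw.
Let cr (i : int) (s : R) : R := pos i + slope i * s.
Hypotheses (m_gt0 : (0 < m)%N) (l_gt0 : 0 < l) (w_gt0 : 0 < w).
Hypothesis posM : forall i, pos (i + m%:Z) = pos i + l.
Hypothesis slopeM : forall i, slope (i + m%:Z) = tau * slope i.
Hypothesis VM : forall i, V (i + m%:Z) = V i.
Hypothesis dM : forall i, d (i + m%:Z) = d i.
Hypothesis nM : forall i, n (i + m%:Z) = (tau * (n i).1, tau * (n i).2).
Hypothesis hM : forall i, h (i + m%:Z) = h i.
Hypothesis cr_lt : forall i s, `|s| <= w / 2 -> cr i s < cr (i + 1) s.
Hypothesis VS : forall i,
  V (i + 1) = ((V i).1 + (pos (i + 1) - pos i) * (d i).1, (V i).2 + (pos (i + 1) - pos i) * (d i).2).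
Hypothesis crS : forall i,
  slope (i + 1) * (d i).1 + (n i).1 = slope (i + 1) * (d (i + 1)).1 + (n (i + 1)).1 /\
  slope (i + 1) * (d i).2 + (n i).2 = slope (i + 1) * (d (i + 1)).2 + (n (i + 1)).2.
Hypothesis frame : forall i, [/\ (d i).1 ^+ 2 + (d i).2 ^+ 2 = 1,
  (n i).1 ^+ 2 + (n i).2 ^+ 2 = 1 & (d i).1 * (n i).1 + (d i).2 * (n i).2 = 0].

Let tau2 : tau * tau = 1. Proof. by rewrite -expr2 sqrr_sign. Qed.

Let tau_norm s : `|tau * s| = `|s|. Proof. by rewrite normrM normr_sign mul1r. Qed.

(** [V i] is the image of the core point of crease [i], and [d i], [n i] are the images of the
    directions along and across the strip. By [crS] the isometries on the two sides of a crease
    agree on its direction (slope, 1), hence along the crease. *)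
Definition panel_fold i (p : R * R) : R * R :=
  ((V i).1 + (p.1 - pos i) * (d i).1 + p.2 * (n i).1,
   (V i).2 + (p.1 - pos i) * (d i).2 + p.2 * (n i).2).

Definition panel_time i (p : R * R) : R := (p.1 - cr i p.2) / (cr (i + 1) p.2 - cr i p.2).

(** The height is constant on every crease and linear in between along the strip, so the panels fit
    together continuously whatever values [h] has. *)
Definition panel_height i (p : R * R) : R := h i + panel_time i p * (h (i + 1) - h i).

Let half_panel i (p : R * R) := band w p /\ cr i p.2 <= p.1 < cr (i + 1) p.2.

Lemma half_panel_ex p : band w p -> exists i, half_panel i p.
Proof.
(* Two periods are used because one period of a twisted strip reverses [s]. *)
move=> bp; have [] := @int_bracket R (cr^~ p.2) (m + m) (l + l) _ _ _ _ p.1.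
- by rewrite addn_gt0 m_gt0.
- by rewrite addr_gt0.
- by move=> i; exact: cr_lt.
- move=> i; rewrite /cr PoszD addrA !posM !slopeM mulrA tau2 mul1r; ring.
- by move=> i hi; exists i.
Qed.

Let idx p := xget (0 : int) [set i | half_panel i p].

Let idxE i p : half_panel i p -> idx p = i.
Proof.
move=> [bp hp]; rewrite /idx; case: xgetP => [j _ /= [_ hj]|/(_ i)]; last by case; split.
exact: (int_bracket_uniq (fun k => cr_lt k bp) hj hp).
Qed.

Definition strip : folded_strip R := FoldedStrip l tw m pos slope
  (fun p => panel_fold (idx p) p) (fun p => panel_height (idx p) p).

Let edge_fold i p : p.1 = cr (i + 1) p.2 -> panel_fold i p = panel_fold (i + 1) p.
Proof.
move=> E; rewrite /panel_fold VS E /cr; have [e1 e2] := crS i.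
apply: (f_equal2 pair) => /=.
  have -> : (V i).1 + (pos (i + 1) + slope (i + 1) * p.2 - pos i) * (d i).1 + p.2 * (n i).1 =
    (V i).1 + (pos (i + 1) - pos i) * (d i).1 + p.2 * (slope (i + 1) * (d i).1 + (n i).1) by ring.
  by rewrite e1; ring.
have -> : (V i).2 + (pos (i + 1) + slope (i + 1) * p.2 - pos i) * (d i).2 + p.2 * (n i).2 =
  (V i).2 + (pos (i + 1) - pos i) * (d i).2 + p.2 * (slope (i + 1) * (d i).2 + (n i).2) by ring.
by rewrite e2; ring.
Qed.

Let edge_height i p : band w p -> p.1 = cr (i + 1) p.2 -> panel_height i p = panel_height (i + 1) p.
Proof.
move=> bp E; rewrite /panel_height /panel_time E.
have := cr_lt i bp => c; have -> : cr (i + 1) p.2 - cr (i + 1) p.2 = 0 by ring.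
by rewrite divff ?subr_eq0 ?gt_eqF // mul1r mul0r mul0r addr0 addrC subrK.
Qed.

Lemma strip_panel i p : panel w strip i p ->
  fold strip p = panel_fold i p /\ height strip p = panel_height i p.
Proof.
move=> [bp /= /andP[h1]]; rewrite le_eqVlt => /orP[/eqP h2|h2]; last first.
  have -> // : idx p = i by apply: idxE; split => //; rewrite h1.
have -> : idx p = i + 1.
  apply: idxE; split => //; rewrite -[crease _ _ _]/(cr (i + 1) p.2) in h2.
  by rewrite h2 lexx cr_lt.
by split; apply/esym; [exact: edge_fold|exact: edge_height].
Qed.

Lemma strip_half_panel p : band w p ->
  exists i, cr i p.2 <= p.1 < cr (i + 1) p.2 /\ panel w strip i p.
Proof.
move=> bp; have [i [_ hi]] := half_panel_ex bp; exists i; split => //; split => //=.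
by case/andP: hi => h1 /ltW h2; apply/andP.
Qed.

Let panel_per i p : panel w strip i p -> panel w strip (i + m%:Z) (p.1 + l, tau * p.2).
Proof.
move=> [bp /= /andP[h1 h2]]; split; first by rewrite /band /= tau_norm.
have E j : crease strip (j + m%:Z) (tau * p.2) = crease strip j p.2 + l.
  by rewrite /crease /= posM slopeM mulrACA tau2 mul1r addrAC.
rewrite /= (_ : i + m%:Z + 1 = (i + 1) + m%:Z); last by ring.
suff : crease strip (i + m%:Z) (tau * p.2) <= p.1 + l <= crease strip (i + 1 + m%:Z) (tau * p.2) by [].
by rewrite !E !lerD2r; apply/andP.
Qed.

Lemma strip_periodic p : band w p ->
  fold strip (p.1 + l, tau * p.2) = fold strip p /\ height strip (p.1 + l, tau * p.2) = height strip p.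
Proof.
move=> /strip_half_panel[i [_ pi]].
have [-> ->] := strip_panel pi; have [-> ->] := strip_panel (panel_per pi).
have crM k : cr (k + m%:Z) (tau * p.2) = cr k p.2 + l.
  by rewrite /cr posM slopeM mulrACA tau2 mul1r addrAC.
have iE : i + m%:Z + 1 = (i + 1) + m%:Z by ring.
have tauE (x : R) : tau * p.2 * (tau * x) = p.2 * x by rewrite mulrACA tau2 mul1r.
have dE (x : R) : p.1 + l - (x + l) = p.1 - x by ring.
split; first by rewrite /panel_fold /= posM VM dM nM /= !tauE dE.
rewrite /panel_height /panel_time /= iE !hM !crM dE.
by have -> : cr (i + 1) p.2 + l - (cr i p.2 + l) = cr (i + 1) p.2 - cr i p.2 by ring.
Qed.

Lemma strip_flat : flat_folded w strip.
Proof.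
split.
- by split.
- move=> i s; rewrite /crease /flip /= posM slopeM -/tau mulrACA tau2 mul1r; ring.
- by move=> i s; exact: cr_lt.
- move=> i p q pp pq; have [-> _] := strip_panel pp; have [-> _] := strip_panel pq.
  have [d1 n1 dn] := frame i; rewrite /sqdist /panel_fold /=.
  pose X := p.1 - q.1; pose Y := p.2 - q.2.
  have -> : (V i).1 + (p.1 - pos i) * (d i).1 + p.2 * (n i).1 -
    ((V i).1 + (q.1 - pos i) * (d i).1 + q.2 * (n i).1) = X * (d i).1 + Y * (n i).1.
    by rewrite /X /Y; ring.
  have -> : (V i).2 + (p.1 - pos i) * (d i).2 + p.2 * (n i).2 -
    ((V i).2 + (q.1 - pos i) * (d i).2 + q.2 * (n i).2) = X * (d i).2 + Y * (n i).2.
    by rewrite /X /Y; ring.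
  rewrite -/X -/Y.
  have -> : (X * (d i).1 + Y * (n i).1) ^+ 2 + (X * (d i).2 + Y * (n i).2) ^+ 2 =
    X ^+ 2 * ((d i).1 ^+ 2 + (d i).2 ^+ 2) + Y ^+ 2 * ((n i).1 ^+ 2 + (n i).2 ^+ 2) +
    2 * X * Y * ((d i).1 * (n i).1 + (d i).2 * (n i).2) by ring.
  by rewrite d1 n1 dn; ring.
- by move=> p bp; have [] := strip_periodic bp.
Qed.

Lemma strip_height_cont : {within band w, continuous (height strip)}.
Proof.
apply/subspace_continuousP => p bp.
have [i [/andP[h1 h2] pi]] := strip_half_panel bp.
pose j := i - 1; have ij : i = j + 1 by rewrite /j subrK.
(* Near [p] only the panels [j] and [i] occur; with clamped times one formula covers both sides of
   the crease between them. *)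
pose F q := h j + clamp (panel_time j q) * (h i - h j) + clamp (panel_time i q) * (h (i + 1) - h i).
have cc k : cr k q.2 @[q --> p] --> cr k p.2 by rewrite /cr; cts.
have n1 : \forall q \near p, cr j q.2 < q.1.
  have : q.1 - cr j q.2 @[q --> p] --> p.1 - cr j p.2 by apply: cvgB; [cts|exact: cc].
  move/cvgr_gt => /(_ 0); rewrite subr_gt0 => H.
  have /H : cr j p.2 < p.1 by apply: lt_le_trans h1; rewrite [in X in _ < X]ij; exact: cr_lt.
  by apply: filterS => q; rewrite subr_gt0.
have n2 : \forall q \near p, q.1 < cr (i + 1) q.2.
  have : cr (i + 1) q.2 - q.1 @[q --> p] --> cr (i + 1) p.2 - p.1 by apply: cvgB; [exact: cc|cts].
  move/cvgr_gt => /(_ 0); rewrite subr_gt0 => /(_ h2).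
  by apply: filterS => q; rewrite subr_gt0.
have FE q : band w q -> cr j q.2 < q.1 -> q.1 < cr (i + 1) q.2 -> height strip q = F q.
  move=> bq q1 q2; rewrite /F.
  have ci := cr_lt i bq; have cj := cr_lt j bq; rewrite -ij in cj.
  have [le|ge] := leP (cr i q.2) q.1.
    have /strip_panel[_ ->] : panel w strip i q by split => //=; apply/andP; split => //; exact: ltW.
    rewrite /panel_height clamp_ge1; last first.
      by rewrite /panel_time -ij ler_pdivlMr ?subr_gt0 // mul1r; rewrite lerD2r.
    rewrite clamp_id; first by rewrite mul1r; ring.
    rewrite in_itv /= /panel_time divr_ge0 ?subr_ge0 ?(ltW ci) //=.
    by rewrite ler_pdivrMr ?subr_gt0 // mul1r lerD2r ltW.
  have /strip_panel[_ ->] : panel w strip j q.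
    by split => //=; rewrite -/(cr _ _) -ij; apply/andP; split; exact: ltW.
  rewrite /panel_height [X in _ + X * (h (i + 1) - h i)]clamp_le0; last first.
    by rewrite /panel_time mulr_le0_ge0 // ?invr_ge0 ?subr_ge0 ?subr_le0 // ltW.
  rewrite clamp_id; first by rewrite -ij; ring.
  rewrite in_itv /= /panel_time -ij divr_ge0 ?subr_ge0 ?(ltW cj) ?(ltW q1) //=.
  by rewrite ler_pdivrMr ?subr_gt0 // mul1r lerD2r ltW.
have cF : F q @[q --> p] --> F p.
  have cT k : panel_time k q @[q --> p] --> panel_time k p.
    rewrite /panel_time; apply: cvgM.
      by apply: cvgB; [cts|exact: cc].
    by apply: cvgV; [rewrite subr_eq0 gt_eqF // cr_lt|apply: cvgB; exact: cc].
  have cC k : clamp (panel_time k q) @[q --> p] --> clamp (panel_time k p).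
    by apply: (continuous_cvg _ (@clamp_cont _ _)); exact: cT.
  rewrite /F; apply: cvgD; last by apply: cvgM; [exact: cC|exact: cvg_cst].
  by apply: cvgD; [exact: cvg_cst|apply: cvgM; [exact: cC|exact: cvg_cst]].
have hp : height strip p = F p.
  by apply: FE => //; apply: lt_le_trans h1; rewrite [in X in _ < X]ij; exact: cr_lt.
have cFw : F q @[q --> within (band w) (nbhs p)] --> F p by exact: cvg_within_filter.
rewrite -hp in cFw.
apply: (@cvg_near_eq _ _ _ _ (height strip) F _ _ cFw).
rewrite near_withinE; apply: filterS (filterI n1 n2) => q [q1 q2] bq.
exact: FE.
Qed.

End Strips.

(** * Convex combinations and monotone polygonal paths *)

Section Convex.
Context {R : realType}.
Implicit Types (a b c l : R).

Definition mid l a b : R := (1 - l) * a + l * b.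

Lemma mid_le l a b c : 0 <= l <= 1 -> a <= c -> b <= c -> mid l a b <= c.
Proof. by move=> /andP[? ?] ? ?; rewrite /mid; nra. Qed.

Lemma mid_ge l a b c : 0 <= l <= 1 -> c <= a -> c <= b -> c <= mid l a b.
Proof. by move=> /andP[? ?] ? ?; rewrite /mid; nra. Qed.

Lemma mid_gt l a b c : 0 <= l <= 1 -> c < a -> c < b -> c < mid l a b.
Proof.
move=> l01 ca cb; apply: (@lt_le_trans _ _ (Num.min a b)); first by rewrite lt_min ca.
by apply: mid_ge => //; rewrite ge_min lexx ?orbT.
Qed.

Lemma mid_lt l a b c : 0 <= l <= 1 -> a < c -> b < c -> mid l a b < c.
Proof.
move=> l01 ca cb; apply: (@le_lt_trans _ _ (Num.max a b)); last by rewrite gt_max ca.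
by apply: mid_le => //; rewrite le_max lexx ?orbT.
Qed.

Lemma mid_norm l a b c : 0 <= l <= 1 -> `|a| <= c -> `|b| <= c -> `|mid l a b| <= c.
Proof.
move=> l01; rewrite !ler_norml => /andP[? ?] /andP[? ?].
by apply/andP; split; [exact: mid_ge|exact: mid_le].
Qed.

Lemma mid_eq_left l a b : 0 <= l -> a < b -> mid l a b <= a -> l = 0.
Proof.
rewrite /mid le_eqVlt => /orP[/eqP //|l0] ab h; exfalso.
have : 0 < l * (b - a) by rewrite mulr_gt0 // subr_gt0.
by lra.
Qed.

Lemma mid_eq_right l a b : l <= 1 -> a < b -> b <= mid l a b -> l = 1.
Proof.
rewrite /mid le_eqVlt => /orP[/eqP //|l0] ab h; exfalso.
have : 0 < (1 - l) * (b - a) by rewrite mulr_gt0 // subr_gt0.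
by lra.
Qed.

(** The conclusion concerns [r + l] because the end of one segment is also the start of the next. *)
Lemma mid_nodes_inj (v : nat -> R) k0 k1 r r' l l' :
  (forall k, (k0 <= k < k1)%N -> v k < v k.+1) ->
  (k0 <= r < k1)%N -> (k0 <= r' < k1)%N -> 0 <= l <= 1 -> 0 <= l' <= 1 ->
  mid l (v r) (v r.+1) = mid l' (v r') (v r'.+1) -> r%:R + l = r'%:R + l'.
Proof.
move=> vS.
have mono (a b : nat) : (k0 <= a)%N -> (a <= b)%N -> (b <= k1)%N -> v a <= v b.
  move=> ka; elim: b => [|b IH]; first by rewrite leqn0 => /eqP ->.
  rewrite leq_eqVlt => /orP[/eqP -> //|]; rewrite ltnS => ab bk.
  by apply: le_trans (IH ab (ltnW bk)) (ltW (vS _ _)); rewrite (leq_trans ka ab).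
have H (a b : nat) la lb : (k0 <= a < k1)%N -> (k0 <= b < k1)%N -> 0 <= la <= 1 -> 0 <= lb <= 1 ->
    (a < b)%N -> mid la (v a) (v a.+1) = mid lb (v b) (v b.+1) -> a%:R + la = b%:R + lb.
  move=> ha hb la01 lb01 ab E.
  have vab : v a.+1 <= v b by apply: mono; case/andP: ha => ? ?; case/andP: hb => ? ?; lia.
  have e1 : mid lb (v b) (v b.+1) <= v b.
    by rewrite -E; apply: le_trans vab; apply: mid_le => //; apply/ltW/vS.
  have e2 : v a.+1 <= mid la (v a) (v a.+1).
    by rewrite E; apply: le_trans vab _; apply: mid_ge => //; apply/ltW/vS.
  have lbz : lb = 0 by apply: mid_eq_left e1; [case/andP: lb01|exact: vS].
  have laz : la = 1 by apply: mid_eq_right e2; [case/andP: la01|exact: vS].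
  have [ba|ba] := eqVneq b a.+1; first by rewrite lbz laz ba addr0 natr1.
  have vE : v a.+1 = v b by move: E; rewrite laz lbz /mid; lra.
  have : v a.+1 < v b.
    apply: lt_le_trans (vS a.+1 _) (mono _ _ _ _ _); case/andP: ha => ? ?; case/andP: hb => ? ?; lia.
  by rewrite vE ltxx.
move=> hr hr' l01 l01' E; have [rr|rr|rr] := ltngtP r r'.
- exact: H.
- by apply/esym; apply: H.
- rewrite rr in E *; congr (_ + _).
  have /eqP : (l - l') * (v r'.+1 - v r') = 0 by move: E; rewrite /mid; lra.
  by rewrite mulf_eq0 !subr_eq0 (gt_eqF (vS _ hr')) orbF => /eqP.
Qed.

End Convex.

(** * Assembling panels into strips *)

Section IntIteration.

Lemma int_rec2 (P : int -> Prop) : P 0 -> (forall z, P z <-> P (z + 1)) -> forall z, P z.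
Proof.
move=> P0 PS; case=> n.
  elim: n => [//|n IH]; rewrite -addn1 PoszD; exact: (PS n).1.
elim: n => [|n IH]; apply/PS; first by rewrite NegzE addNr.
by rewrite NegzE -addn1 PoszD opprD addrNK -NegzE.
Qed.

Variables (B : finType) (f : B -> B) (f_inj : injective f).

Definition zit (x : B) (z : int) : B :=
  match z with Posz n => iter n f x | Negz n => iter n.+1 (finv f) x end.

Lemma zitS x z : zit x (z + 1) = f (zit x z).
Proof.
case: z => [n|[|n]]; first by rewrite -PoszD addn1.
  by rewrite NegzE addNr /= f_finv.
have -> : Negz n.+1 + 1 = Negz n by rewrite !NegzE -(addn1 n.+1) PoszD opprD addrNK.
by rewrite /= f_finv.
Qed.

Lemma zit_period x z : zit x (z + (order f x)%:Z) = zit x z.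
Proof.
elim/int_rec2: z => [|z]; first by rewrite add0r /= iter_order.
by rewrite addrAC !zitS; split=> [->|/f_inj].
Qed.

Lemma zit_modz x z : zit x z = iter `|(z %% (order f x))%Z|%N f x.
Proof.
have per (k : int) y : zit x (y + k * (order f x)%:Z) = zit x y.
  elim/int_rec2: k => [|k]; first by rewrite mul0r addr0.
  by rewrite mulrDl mul1r addrA zit_period.
rewrite {1}(divz_eq z (order f x)%:Z) addrC per.
have m0 : (order f x)%:Z != 0 by rewrite -lt0n order_gt0.
by rewrite -[in LHS](gez0_abs (modz_ge0 z m0)).
Qed.

Lemma zit_eq x z z' : zit x z = zit x z' -> exists k : int, z' = z + k * (order f x)%:Z.
Proof.
have m0 : (order f x)%:Z != 0 by rewrite -lt0n order_gt0.
have mlt y : (`|(y %% (order f x))%Z| < order f x)%N.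
  have : (y %% (order f x)%:Z)%Z < order f x by rewrite ltz_pmod // lt_neqAle eq_sym m0.
  by rewrite -{1}(gez0_abs (modz_ge0 y m0)) ltz_nat.
rewrite !zit_modz => /(congr1 (findex f x)); rewrite !findex_iter // => E.
have {}E : (z %% (order f x)%:Z)%Z = (z' %% (order f x)%:Z)%Z.
  by rewrite -(gez0_abs (modz_ge0 z m0)) E gez0_abs // modz_ge0.
exists ((z' %/ (order f x)%:Z)%Z - (z %/ (order f x)%:Z)%Z).
have e1 := divz_eq z (order f x)%:Z; have e2 := divz_eq z' (order f x)%:Z.
rewrite mulrBl; lia.
Qed.

Lemma zit_root x z : froot f (zit x z) = froot f x.
Proof.
rewrite zit_modz; apply/esym/eqP; rewrite root_connect; last exact: fconnect_sym.
exact: fconnect_iter.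
Qed.

Definition zsum {V : zmodType} (F : int -> V) (z : int) : V :=
  match z with Posz n => \sum_(k < n) F k%:Z | Negz n => - \sum_(k < n.+1) F (Negz k) end.

Lemma zsumS {V : zmodType} (F : int -> V) z : zsum F (z + 1) = zsum F z + F z.
Proof.
case: z => [n|[|n]]; first by rewrite -PoszD addn1 /= big_ord_recr.
  by rewrite NegzE addNr /= big_ord0 big_ord1 NegzE addNr.
have -> : Negz n.+1 + 1 = Negz n by rewrite !NegzE -(addn1 n.+1) PoszD opprD addrNK.
by rewrite /= [in RHS]big_ord_recr /= opprD addrNK.
Qed.

Lemma zsum_period {V : zmodType} (F : int -> V) (m : nat) z :
  (forall z, F (z + m%:Z) = F z) -> zsum F (z + m%:Z) = zsum F z + zsum F m%:Z.
Proof.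
move=> Fm; elim/int_rec2: z => [|z]; first by rewrite add0r /= big_ord0 add0r.
by rewrite addrAC !zsumS Fm addrAC; split=> [->|/addIr].
Qed.

(** The running product of the signs (-1) ^ e, written as the parity of a sum so that it makes sense
    at negative indices and yields the boolean [twisted] after one period. *)
Definition zsgn {R : pzRingType} (e : int -> bool) (z : int) : R :=
  (-1) ^+ odd `|zsum (fun k => (e k : nat)%:Z) z|%N.

Lemma zsgnS {R : pzRingType} (e : int -> bool) z : zsgn e (z + 1) = zsgn e z * (-1) ^+ e z :> R.
Proof.
rewrite /zsgn zsumS -signr_addb; congr (_ ^+ _); case: (e z) => /=.
  move: (zsum _ z) => [n|[|n]]; first by rewrite -PoszD addn1 /= addbT.
    by [].
  have -> : Negz n.+1 + 1 = Negz n by rewrite !NegzE -(addn1 n.+1) PoszD opprD addrNK.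
  by rewrite /= !negbK addbT.
by rewrite addr0 addbF.
Qed.

Lemma zsgn_period {R : pzRingType} (e : int -> bool) (m : nat) z :
  (forall z, e (z + m%:Z) = e z) -> zsgn e (z + m%:Z) = zsgn e z * zsgn e m%:Z :> R.
Proof.
move=> em; elim/int_rec2: z => [|z].
  by rewrite add0r {2}/zsgn /= big_ord0 expr0 mul1r.
rewrite addrAC !zsgnS em -!mulrA [(-1) ^+ e z * _]commr_sign !mulrA; split=> [->//|E].
by have := congr1 (fun x => x * (-1) ^+ e z) E; rewrite -!mulrA -!expr2 !sqrr_sign !mulr1.
Qed.

Lemma sum_orbits {V : nmodType} (F : B -> V) :
  \sum_(r | froots f r) \sum_(k < order f r) F (iter k f r) = \sum_b F b.
Proof.
rewrite [RHS](partition_big (froot f) (froots f)) /=; last first.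
  by move=> b _; exact/roots_root/fconnect_sym.
apply: eq_bigr => r /eqP fr.
transitivity (\sum_(b <- orbit f r) F b).
  rewrite /orbit (big_nth r) size_traject big_mkord; apply: eq_bigr => k _.
  by rewrite nth_traject.
rewrite big_uniq ?orbit_uniq //=; apply: eq_bigl => b.
rewrite -fconnect_orbit -(root_connect (fconnect_sym f_inj)) eq_sym fr.
by [].
Qed.

End IntIteration.

Section Assembly.
Context {R : realType}.
Variables (w : R) (B : finType) (nxt : B -> B).
Variables (V D N : B -> R * R) (len sl H : B -> R) (e : B -> bool).
Let eps b : R := (-1) ^+ e b.

(** Length of the panel at the distance [a] from the core. Consecutive panels may use opposite
    transverse coordinates, which [eps b] records; hence the sign in front of the next slope. *)
Definition panel_gap b a := len b + (eps b * sl (nxt b) - sl b) * a.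

Definition panel_point b (l a : R) : R * R :=
  ((V b).1 + (sl b * a + l * panel_gap b a) * (D b).1 + a * (N b).1,
   (V b).2 + (sl b * a + l * panel_gap b a) * (D b).2 + a * (N b).2).

Hypotheses (w_gt0 : 0 < w) (nxt_inj : injective nxt).
Hypothesis V_nxt : forall b,
  V (nxt b) = ((V b).1 + len b * (D b).1, (V b).2 + len b * (D b).2).
Hypothesis corner : forall b,
  eps b * sl (nxt b) * (D b).1 + (N b).1 =
  eps b * (sl (nxt b) * (D (nxt b)).1 + (N (nxt b)).1) /\
  eps b * sl (nxt b) * (D b).2 + (N b).2 =
  eps b * (sl (nxt b) * (D (nxt b)).2 + (N (nxt b)).2).
Hypothesis frame : forall b, [/\ (D b).1 ^+ 2 + (D b).2 ^+ 2 = 1,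
  (N b).1 ^+ 2 + (N b).2 ^+ 2 = 1 & (D b).1 * (N b).1 + (D b).2 * (N b).2 = 0].
Hypothesis gap_gt0 : forall b a, `|a| <= w / 2 -> 0 < panel_gap b a.
Hypothesis point_inj : forall b b' l l' a a', 0 <= l < 1 -> 0 <= l' < 1 ->
  `|a| <= w / 2 -> `|a'| <= w / 2 -> panel_point b l a = panel_point b' l' a' ->
  mid l (H b) (H (nxt b)) = mid l' (H b') (H (nxt b')) -> [/\ b = b', l = l' & a = a'].
Variable par : B -> bool.
Hypothesis core_meet : forall b b' l l', 0 <= l < 1 -> 0 <= l' < 1 ->
  panel_point b l 0 = panel_point b' l' 0 ->
  b = b' /\ l = l' \/ [/\ par b <> par b', 0 < l & 0 < l'].
Hypothesis core_uniq : forall b b' l l' u u', 0 <= l < 1 -> 0 <= l' < 1 ->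
  0 <= u < 1 -> 0 <= u' < 1 -> par b <> par b' ->
  panel_point b l 0 = panel_point b' l' 0 -> panel_point b u 0 = panel_point b' u' 0 ->
  l = u /\ l' = u'.

Let len_gt0 b : 0 < len b.
Proof.
have := @gap_gt0 b 0; rewrite /panel_gap mulr0 addr0; apply.
by rewrite normr0 divr_ge0 // ltW.
Qed.

Section Component.
Variable r : B.
Let m := order nxt r.
Let b := zit nxt r.
Let pos := zsum (fun z => len (b z)).
Let sg (z : int) : R := zsgn (fun k => e (b k)) z.
Let L := pos m%:Z.

Let bM z : b (z + m%:Z) = b z. Proof. exact: zit_period. Qed.
Let bS z : b (z + 1) = nxt (b z). Proof. exact: zitS. Qed.
Let posS z : pos (z + 1) = pos z + len (b z). Proof. exact: zsumS. Qed.
Let posM z : pos (z + m%:Z) = pos z + L.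
Proof. by apply: zsum_period => k; rewrite bM. Qed.
Let sgS z : sg (z + 1) = sg z * eps (b z). Proof. exact: zsgnS. Qed.
Let sgM z : sg (z + m%:Z) = sg z * sg m%:Z.
Proof. by apply: zsgn_period => k; rewrite bM. Qed.
Let sg2 z : sg z * sg z = 1. Proof. by rewrite -expr2 sqrr_sign. Qed.
Let sg_norm z s : `|sg z * s| = `|s|. Proof. by rewrite normrM normr_sign mul1r. Qed.
Let pos_lt z : pos z < pos (z + 1). Proof. by rewrite posS ltrDl. Qed.
Let m_gt0 : (0 < m)%N. Proof. exact: order_gt0. Qed.
Let pos0 : pos 0 = 0. Proof. by rewrite /pos /= big_ord0. Qed.
Let L_gt0 : 0 < L.
Proof.
rewrite -pos0; apply: lt_le_trans (pos_lt 0) _; rewrite add0r.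
by apply: (int_homo_le pos_lt); rewrite lez_nat.
Qed.

(** [sg z] compares the transverse coordinate of the whole strip with that of its panel number [z].
    The strip is twisted when this sign is negative after one period. *)
Definition component_strip : folded_strip R :=
  strip w L (odd `|zsum (fun k => (e (b k) : nat)%:Z) m%:Z|%N) m
    pos (fun z => sg z * sl (b z)) (fun z => V (b z)) (fun z => D (b z))
    (fun z => (sg z * (N (b z)).1, sg z * (N (b z)).2)) (fun z => H (b z)).

Let slopeM z : sg (z + m%:Z) * sl (b (z + m%:Z)) = sg m%:Z * (sg z * sl (b z)).
Proof. by rewrite bM sgM; ring. Qed.

Let crE z s : pos (z + 1) + sg (z + 1) * sl (b (z + 1)) * s - (pos z + sg z * sl (b z) * s) =
  panel_gap (b z) (sg z * s).
Proof. by rewrite posS sgS bS /panel_gap; ring. Qed.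

Let cr_lt z s : `|s| <= w / 2 ->
  pos z + sg z * sl (b z) * s < pos (z + 1) + sg (z + 1) * sl (b (z + 1)) * s.
Proof. by move=> sw; rewrite -subr_gt0 crE gap_gt0 // sg_norm. Qed.

Let VS z : V (b (z + 1)) = ((V (b z)).1 + (pos (z + 1) - pos z) * (D (b z)).1,
  (V (b z)).2 + (pos (z + 1) - pos z) * (D (b z)).2).
Proof. by rewrite bS V_nxt posS addrAC subrr add0r. Qed.

Let crS z : sg (z + 1) * sl (b (z + 1)) * (D (b z)).1 + sg z * (N (b z)).1 =
    sg (z + 1) * sl (b (z + 1)) * (D (b (z + 1))).1 + sg (z + 1) * (N (b (z + 1))).1 /\
  sg (z + 1) * sl (b (z + 1)) * (D (b z)).2 + sg z * (N (b z)).2 =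
    sg (z + 1) * sl (b (z + 1)) * (D (b (z + 1))).2 + sg (z + 1) * (N (b (z + 1))).2.
Proof.
rewrite bS sgS; have [c1 c2] := corner (b z).
by split; rewrite -!mulrA -!mulrDr [eps _ * (_ * _)]mulrA; rewrite ?c1 ?c2.
Qed.

Let frameM z : [/\ (D (b z)).1 ^+ 2 + (D (b z)).2 ^+ 2 = 1,
  (sg z * (N (b z)).1) ^+ 2 + (sg z * (N (b z)).2) ^+ 2 = 1 &
  (D (b z)).1 * (sg z * (N (b z)).1) + (D (b z)).2 * (sg z * (N (b z)).2) = 0].
Proof.
have [d1 n1 dn] := frame (b z); split=> //.
  by rewrite !exprMn -mulrDr n1 mulr1 expr2 sg2.
by rewrite !(mulrCA _ (sg z)) -mulrDr dn mulr0.
Qed.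

Let DM z : D (b (z + m%:Z)) = D (b z). Proof. by rewrite bM. Qed.
Let VM z : V (b (z + m%:Z)) = V (b z). Proof. by rewrite bM. Qed.
Let HM z : H (b (z + m%:Z)) = H (b z). Proof. by rewrite bM. Qed.
Let n z := (sg z * (N (b z)).1, sg z * (N (b z)).2).
Let NM z : n (z + m%:Z) = (sg m%:Z * (n z).1, sg m%:Z * (n z).2).
Proof. by rewrite /n bM sgM /= !mulrA ![sg m%:Z * _]mulrC. Qed.

Lemma component_flat : flat_folded w component_strip.
Proof. exact: (@strip_flat _ _ _ _ _ _ _ (fun z => V (b z)) (fun z => D (b z)) n (fun z => H (b z))
  m_gt0 L_gt0 posM slopeM VM DM NM HM cr_lt VS crS frameM). Qed.

Lemma component_cont : {within band w, continuous (height component_strip)}.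
Proof. exact: (@strip_height_cont _ _ _ _ _ _ _ (fun z => V (b z)) (fun z => D (b z)) n
  (fun z => H (b z)) m_gt0 L_gt0 posM slopeM cr_lt VS crS). Qed.

Lemma component_height_per p : band w p ->
  height component_strip (p.1 + L, flip component_strip p.2) = height component_strip p.
Proof.
move=> bp.
by have [] := @strip_periodic _ _ _ _ _ _ _ (fun z => V (b z)) (fun z => D (b z)) n
  (fun z => H (b z)) m_gt0 L_gt0 posM slopeM VM DM NM HM cr_lt VS crS _ bp.
Qed.

Lemma component_at z p l : band w p -> 0 <= l <= 1 ->
  p.1 = pos z + (sl (b z) * (sg z * p.2) + l * panel_gap (b z) (sg z * p.2)) ->
  fold component_strip p = panel_point (b z) l (sg z * p.2) /\
  height component_strip p = mid l (H (b z)) (H (b (z + 1))).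
Proof.
move=> bp /andP[l0 l1] pE.
have g0 : 0 < panel_gap (b z) (sg z * p.2) by rewrite gap_gt0 // sg_norm.
have pz : panel w component_strip z p.
  split=> //=; rewrite /crease /= pE; apply/andP; split.
    by rewrite -subr_ge0 [X in 0 <= X](_ : _ = l * panel_gap (b z) (sg z * p.2)); [rewrite mulr_ge0 // ltW|ring].
  rewrite -subr_ge0 [X in 0 <= X](_ : _ = pos (z + 1) + sg (z + 1) * sl (b (z + 1)) * p.2 -
    (pos z + sg z * sl (b z) * p.2) - l * panel_gap (b z) (sg z * p.2)); last by ring.
  rewrite crE -[X in X - _]mul1r -mulrBl mulr_ge0 ?subr_ge0 //; exact: ltW.
have [-> ->] := @strip_panel _ _ _ _ _ _ _ (fun z => V (b z)) (fun z => D (b z)) n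
  (fun z => H (b z)) cr_lt VS crS _ _ pz.
split; first by rewrite /panel_fold /panel_point pE; apply: (f_equal2 pair) => /=; ring.
rewrite /panel_height /panel_time crE.
have -> : p.1 - (pos z + sg z * sl (b z) * p.2) = l * panel_gap (b z) (sg z * p.2).
  by rewrite pE; ring.
by rewrite mulfK ?gt_eqF // /mid; ring.
Qed.

Lemma component_ex p : band w p -> exists z l, 0 <= l < 1 /\
  p.1 = pos z + (sl (b z) * (sg z * p.2) + l * panel_gap (b z) (sg z * p.2)).
Proof.
move=> bp; have [z [/andP[h1 h2] _]] := @strip_half_panel _ _ _ _ _ _ _ (fun z => V (b z)) (fun z => D (b z)) n
  (fun z => H (b z)) m_gt0 L_gt0 posM slopeM cr_lt _ bp.
have g0 : 0 < panel_gap (b z) (sg z * p.2) by rewrite gap_gt0 // sg_norm.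
exists z, ((p.1 - (pos z + sg z * sl (b z) * p.2)) / panel_gap (b z) (sg z * p.2)); split.
  rewrite divr_ge0 ?subr_ge0 //= ?(ltW g0) // ltr_pdivrMr // mul1r -crE ltrD2r //.
by rewrite mulfVK ?gt_eqF //; ring.
Qed.

End Component.

Let cpos r z := zsum (fun z => len (zit nxt r z)) z.
Let csg r z : R := zsgn (fun z => e (zit nxt r z)) z.
Let root (i : 'I_#|froots nxt|) : B := enum_val i.

Definition component_strips (i : 'I_#|froots nxt|) := component_strip (root i).
Let S := component_strips.

Let root_fix i : froot nxt (root i) = root i.
Proof. by apply/eqP; have := enum_valP i. Qed.

Let cpos_lt r z : cpos r z < cpos r (z + 1).
Proof. by rewrite /cpos zsumS ltrDl. Qed.

Let cpos0 r : cpos r 0 = 0. Proof. by rewrite /cpos /= big_ord0. Qed.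

(** The same place in the same panel determines the position along the strip up to a multiple of its
    length, and a half-open fundamental domain leaves only the multiple 0. *)
Let key_uniq i j z z' x t t' : zit nxt (root i) z = zit nxt (root j) z' ->
  t = cpos (root i) z + x -> t' = cpos (root j) z' + x ->
  t \in `[0, strip_length (S i)[ -> t' \in `[0, strip_length (S j)[ ->
  [/\ i = j, z = z' & t = t'].
Proof.
move=> zz; have ij : i = j.
  by apply: enum_val_inj; have := congr1 (froot nxt) zz; rewrite !zit_root // !root_fix.
rewrite -{}ij in zz * => tE tE'; have [k kE] := zit_eq nxt_inj zz.
have per y : cpos (root i) (y + (order nxt (root i))%:Z) = cpos (root i) y + strip_length (S i).
  by apply: zsum_period => y'; rewrite zit_period.
have t't : t' = t + strip_length (S i) *~ k.
  by rewrite tE tE' kE (int_quasi_periodic per); ring.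
rewrite !in_itv /= => /andP[t0 tL] /andP[t'0 t'L].
have L0 : 0 < strip_length (S i) by apply: le_lt_trans tL.
have k0 : k = 0.
  rewrite -mulrzr in t't.
  have h1 : k%:~R < 1 :> R.
    by rewrite -(ltr_pM2l L0) mulr1; apply: le_lt_trans t'L; rewrite t't lerDr.
  have h2 : -1 < k%:~R :> R.
    rewrite -(ltr_pM2l L0) mulrN1 ltrNl -subr_gt0.
    by apply: le_lt_trans t'0 _; rewrite t't opprK ltrD2r.
  have {}h1 : k < 1 by rewrite -(ltr_int R).
  have {}h2 : -1 < k by rewrite -(ltr_int R).
  by lia.
by rewrite t't kE k0 mulr0z mul0r !addr0.
Qed.

Let key_ex i p : band w p -> exists z l, [/\ 0 <= l < 1,
  p.1 = cpos (root i) z + (sl (zit nxt (root i) z) * (csg (root i) z * p.2) +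
    l * panel_gap (zit nxt (root i) z) (csg (root i) z * p.2)),
  fold (S i) p = panel_point (zit nxt (root i) z) l (csg (root i) z * p.2) &
  height (S i) p = mid l (H (zit nxt (root i) z)) (H (nxt (zit nxt (root i) z)))].
Proof.
move=> bp; have [z [l [l01 pE]]] := component_ex (root i) bp.
exists z, l; have /andP[l0 l1] := l01.
have l01' : 0 <= l <= 1 by rewrite l0 ltW.
have [fE hE] := @component_at (root i) z p l bp l01' pE.
by split=> //; rewrite hE zitS.
Qed.

Let band0 t : band w (t, 0).
Proof. by rewrite /band /= normr0 divr_ge0 // ltW. Qed.

Let core_ex i t : exists z l, [/\ 0 <= l < 1,
  t = cpos (root i) z + l * len (zit nxt (root i) z),
  fold (S i) (t, 0) = panel_point (zit nxt (root i) z) l 0 &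
  height (S i) (t, 0) = mid l (H (zit nxt (root i) z)) (H (nxt (zit nxt (root i) z)))].
Proof.
have [z [l /= [l01 tE fE hE]]] := key_ex i (band0 t); exists z, l.
by rewrite fE hE mulr0; split=> //; rewrite tE /panel_gap !mulr0 addr0 add0r.
Qed.

Let key (x : 'I_#|froots nxt| * R) b l := [/\ 0 <= l < 1, core_proj S x = panel_point b l 0 &
  exists2 z, b = zit nxt (root x.1) z & x.2 = cpos (root x.1) z + l * len b].

Let key_of x : exists b l, key x b l.
Proof.
case: x => i t; have [z [l [l01 tE fE _]]] := core_ex i t.
by exists (zit nxt (root i) z), l; split=> //; exists z.
Qed.

Let key_inj x y b l : core_domain S x -> core_domain S y -> key x b l -> key y b l -> x = y.
Proof.
case: x y => [i t] [j t'] /= ti tj [_ _ /= [z bE tE]] [_ _ /= [z' bE' tE']].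
by have [-> _ ->] := key_uniq (etrans (esym bE) bE') tE tE' ti tj.
Qed.

Let key_meet x y b b' l l' : core_domain S x -> core_domain S y -> key x b l -> key y b' l' ->
  x <> y -> core_proj S x = core_proj S y -> [/\ par b <> par b', 0 < l & 0 < l'].
Proof.
move=> xd yd kx ky ne; have [l01 -> _] := kx; have [l01' -> _] := ky => E.
have [[bb ll]|//] := core_meet l01 l01' E.
by case: ne; rewrite -bb -ll in ky; exact: key_inj kx ky.
Qed.

(** Crossings join panels of opposite [par], so a triple point would need three pairwise different
    booleans. By [core_uniq] each pair of panels contributes at most one crossing, hence there are
    finitely many; none sits on a crease, since the fractions are positive. *)
Lemma component_regular : regular_core S.
Proof.
split.
- pose T (bb : B * B) := [set xy : ('I_#|froots nxt| * R) * ('I_#|froots nxt| * R) |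
    core_domain S xy.1 /\ core_domain S xy.2 /\ exists l l', [/\ par bb.1 <> par bb.2,
    key xy.1 bb.1 l, key xy.2 bb.2 l' & panel_point bb.1 l 0 = panel_point bb.2 l' 0]].
  apply: (@sub_finite_set _ _ (\bigcup_bb T bb)).
    move=> [x y] /= [xd yd xy E].
    have [b [l kx]] := key_of x; have [b' [l' ky]] := key_of y.
    have [pb _ _] := key_meet xd yd kx ky xy E.
    exists (b, b') => //=; split=> //; split=> //; exists l, l'; split=> //.
    by have [_ <- _] := kx; have [_ <- _] := ky.
  apply: bigcup_finite => [|[b b'] _]; first exact: finite_finset.
  have [->|/set0P[xy0 T0]] := eqVneq (T (b, b')) set0; first exact: finite_set0.
  apply: (@sub_finite_set _ _ [set xy0]); last exact: finite_set1.
  move=> xy [xd [yd [l [l' [/= pb kx ky E]]]]].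
  have [x0d [y0d [l0 [l0' [/= _ kx0 ky0 E0]]]]] := T0.
  have [l01 _ _] := kx; have [l01' _ _] := ky; have [u01 _ _] := kx0; have [u01' _ _] := ky0.
  have [lu lu'] := core_uniq l01 l01' u01 u01' pb E E0.
  rewrite -lu in kx0; rewrite -lu' in ky0 => /=.
  by rewrite (surjective_pairing xy) (surjective_pairing xy0) (key_inj xd x0d kx kx0)
    (key_inj yd y0d ky ky0).
- move=> x y z xd yd zd xy yz.
  have [xy'|nxy] := pselect (x = y); first by constructor 1.
  have [yz'|nyz] := pselect (y = z); first by constructor 2.
  have [xz'|nxz] := pselect (x = z); first by constructor 3.
  have [b [l kx]] := key_of x; have [b' [l' ky]] := key_of y; have [b'' [l'' kz]] := key_of z.
  have [p1 _ _] := key_meet xd yd kx ky nxy xy.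
  have [p2 _ _] := key_meet yd zd ky kz nyz yz.
  have [p3 _ _] := key_meet xd zd kx kz nxz (etrans xy yz).
  by case: (par b) p1 p3; case: (par b') p2; case: (par b'').
- move=> x y i xd yd ne E.
  have [b [l kx]] := key_of x; have [b' [l' ky]] := key_of y.
  have [_ l0 _] := key_meet xd yd kx ky ne E.
  have [/andP[_ l1] _ [z bE xE]] := kx.
  rewrite xE => zi.
  have H1 : cpos (root x.1) z <= cpos (root x.1) i < cpos (root x.1) (z + 1).
    rewrite -[cpos (root x.1) i]zi lerDl mulr_ge0 ?(ltW l0) ?(ltW (len_gt0 _)) //=.
    by rewrite /cpos zsumS ltrD2l -bE gtr_pMl.
  have H2 : cpos (root x.1) i <= cpos (root x.1) i < cpos (root x.1) (i + 1) by rewrite lexx cpos_lt.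
  have zE := int_bracket_uniq (cpos_lt _) H1 H2.
  have : l * len b = 0 by apply: (addrI (cpos (root x.1) z)); rewrite zi zE addr0.
  by apply/eqP; rewrite mulf_neq0 ?gt_eqF.
Qed.

Lemma component_layered : layered w S.
Proof.
split; [by move=> i; exact: component_cont|by move=> i p; exact: component_height_per|].
move=> i j [t s] [t' s'] bp bq pd qd fE hE.
have [z [l [l01 /= tE fp hp]]] := key_ex i bp.
have [z' [l' [l01' /= tE' fq hq]]] := key_ex j bq.
have sgN k r x : `|csg r k * x| = `|x| by rewrite normrM normr_sign mul1r.
have [] := point_inj l01 l01' _ _ (etrans (esym fp) (etrans fE fq)) (etrans (esym hp) (etrans hE hq)).
- by rewrite sgN.
- by rewrite sgN.
move=> bb ll aa; rewrite -bb -ll -aa in tE'.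
have [ij zz tt] := key_uniq bb tE tE' pd qd.
split=> //; rewrite tt; congr pair; move: aa; rewrite ij zz.
by apply: mulfI; rewrite signr_eq0.
Qed.

Lemma component_core_link : core_link S =
  [set p | exists b l, 0 <= l < 1 /\ p = (panel_point b l 0, mid l (H b) (H (nxt b)))].
Proof.
apply/seteqP; split=> [p [[i t] /= _ <-]|p [b [l [l01 ->]]]].
  have [z [l [l01 _ fE hE]]] := core_ex i t; exists (zit nxt (root i) z), l; split=> //.
  by rewrite /core_proj /= -fE -hE.
have fr : froots nxt (froot nxt b) by exact/roots_root/fconnect_sym.
pose i := enum_rank_in fr (froot nxt b).
have iE : root i = froot nxt b by exact: enum_rankK_in.
have cb : fconnect nxt (root i) b by rewrite iE fconnect_sym // connect_root.
have kb := findex_max cb; have bE := iter_findex cb; set k := findex _ _ _ in kb bE.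
have cS : {homo cpos (root i) : x y / x <= y} := int_homo_le (cpos_lt (root i)).
exists (i, cpos (root i) k%:Z + l * len b); rewrite /core_domain /= ?in_itv /=.
  move: l01 => /andP[l0 l1]; apply/andP; split.
    rewrite addr_ge0 ?mulr_ge0 ?(ltW (len_gt0 _)) //.
    by have := cS 0 k%:Z isT; rewrite cpos0.
  apply: (@lt_le_trans _ _ (cpos (root i) (k%:Z + 1))); last first.
      by have := cS (k%:Z + 1) (order nxt (root i))%:Z; rewrite -PoszD addn1 lez_nat; exact.
  by rewrite /cpos zsumS ltrD2l /= bE gtr_pMl.
have [||fE hE] := @component_at (root i) k%:Z (cpos (root i) k%:Z + l * len b, 0) l (band0 _).
- by move: l01 => /andP[-> /ltW].
- by rewrite /= /panel_gap !mulr0 addr0 add0r /= bE.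
have bz : zit nxt (root i) k%:Z = b := bE.
rewrite (_ : core_proj S _ = panel_point b l 0); last by apply: etrans fE _; rewrite bz mulr0.
by apply: (f_equal2 pair) => //; apply: etrans hE _; rewrite zitS // bz.
Qed.

Lemma component_length : ribbon_length S = \sum_b len b.
Proof.
rewrite /ribbon_length -(sum_orbits nxt_inj len).
by rewrite (big_enum_val (fun r => \sum_(k < order nxt r) len (iter k nxt r))).
Qed.

End Assembly.

(** * The ribbon of a family of arcs *)

Section Patches.
Context {R : realType}.
Variables (J : finType) (pg : J -> 'I_4) (s t : J -> R) (nx : J -> J).
Hypothesis nx_inj : injective nx.
Hypothesis tE : forall j, t j = s (nx j).
Hypothesis s_inj : injective s.
Hypothesis pg_nx : forall j, pg (nx j) != pg j.

Definition lo j := Num.min (s j) (t j).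
Definition hi j := Num.max (s j) (t j).

Hypothesis nested : forall i j, i != j -> pg i = pg j ->
  [\/ hi i < lo j, hi j < lo i, lo i < lo j /\ hi j < hi i | lo j < lo i /\ hi i < hi j].

Variables (g M w eta T q : R) (X : J -> R).
Hypotheses (g_gt0 : 0 < g) (w_gt0 : 0 < w) (eta_gt0 : 0 < eta) (T_gt0 : 0 < T) (T_lt1 : T < 1).
Hypothesis gap : forall i j, i != j -> g <= `|s i - s j|.
Hypothesis s_bound : forall j, `|s j| <= M.

(** [T] is the tangent of half the angle between a tip panel and the arm. A tip panel of core length
    [tilt_len] has the legs [setback] along the arm and [rise] across it, half of the total offset.
    [kap] is the inverse of the cosine of the angle: the offset [a] is stretched by it along the
    middle crease. *)
Definition kap : R := (1 + T ^+ 2) / (1 - T ^+ 2).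
Definition rise j : R := eta * `|t j - s j| / 2.
Definition setback j : R := rise j * (1 - T ^+ 2) / (2 * T).
Definition tilt_len j : R := rise j * (1 + T ^+ 2) / (2 * T).

Hypothesis q_big : eta * M + kap * (w / 2) < q.
Hypothesis X_big : forall j, q + T * (w / 2) < X j /\ q < X j - setback j.
Hypothesis X_nested : forall i j, pg i = pg j -> lo i < lo j -> hi j < hi i ->
  X j + T * (w / 2) < X i - setback i /\ X j + T * (w / 2) < X i - T * (w / 2).

(* In every page the core passes the axis level z at the point (eta z, eta z), whose
   coordinates in the frame of the page p are eta z (su p, sv p). *)
Definition su (p : 'I_4) : R := (dir p).1 + (dir p).2.
Definition sv (p : 'I_4) : R := (dir p).1 - (dir p).2.
Definition det (p p' : 'I_4) : R := (dir p).1 * (dir p').2 - (dir p).2 * (dir p').1.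
Definition updn j : R := if s j < t j then 1 else -1.
Definition tilt j : R := sv (pg j) * updn j * T.
Definition c0 j : R := det (pg (invF nx_inj j)) (pg j).
Definition c6 j : R := det (pg j) (pg (nx j)).
Definition xs j := eta * su (pg j) * s j.
Definition ys j := eta * sv (pg j) * s j.
Definition xt j := eta * su (pg j) * t j.
Definition yt j := eta * sv (pg j) * t j.

(* In the frame of its page, the crease lines of the strip along the arc j: at the
   axis point s j, at the end of the square part, at the three folds of the tip,
   and symmetrically; a is the distance from the core.  The slopes c0 and c6 are 0 or 1 or
   -1, for a strip passing straight to the opposite page or folded along a diagonal.
   The point at the fraction l of the panel r has page coordinates (px, py), plane
   coordinates pt and height ph. *)
Definition NX j a r := nth 0 [:: xs j + c0 j * a; q; X j + tilt j * a; X j - setback j;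
  X j - tilt j * a; q; xt j - c6 j * a] r.
Definition NY j a r := nth 0 [:: ys j + a; ys j + a; ys j + a; (ys j + yt j) / 2 + kap * a;
  yt j + a; yt j + a; yt j + a] r.
Definition NH j r := nth 0 [:: s j; s j + g / 4; s j + updn j * (g / 3); (s j + t j) / 2;
  t j - updn j * (g / 3); t j - g / 4; t j] r.

Definition px j r l a := mid l (NX j a r) (NX j a r.+1).
Definition py j r l a := mid l (NY j a r) (NY j a r.+1).
Definition ph j r l := mid l (NH j r) (NH j r.+1).
Definition pt j r l a : R * R :=
  (px j r l a * (dir (pg j)).1 - py j r l a * (dir (pg j)).2,
   px j r l a * (dir (pg j)).2 + py j r l a * (dir (pg j)).1).

(** * Position of the strips in the plane *)

Lemma pt_loc j r l a : px j r l a = (pt j r l a).1 * (dir (pg j)).1 + (pt j r l a).2 * (dir (pg j)).2 /\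
  py j r l a = - (pt j r l a).1 * (dir (pg j)).2 + (pt j r l a).2 * (dir (pg j)).1.
Proof. by rewrite /pt; move: (pg j); apply: dirP; rewrite /dir /=; split; ring. Qed.

Lemma suv_norm p : `|su p| = 1 /\ `|sv p| = 1.
Proof.
move: p; apply: dirP; rewrite /su /sv /dir /= ?subr0 ?addr0 ?add0r ?sub0r ?opprK ?normrN normr1 //.
Qed.

Lemma det_bound p p' : `|det p p'| <= 1.
Proof.
move: p; apply: dirP; move: p'; apply: dirP; rewrite /det /dir /= ler_norml; apply/andP; split; lra.
Qed.

Lemma kap_ge1 : 1 <= kap.
Proof.
have T2 : T ^+ 2 < 1 by rewrite expr_lt1 // ltW.
by rewrite /kap ler_pdivlMr ?subr_gt0 //; have := sqr_ge0 T; lra.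
Qed.

Lemma t_bound j : `|t j| <= M. Proof. by rewrite tE. Qed.

Lemma level_norm (c z : R) : `|c| = 1 -> `|z| <= M -> `|eta * c * z| <= eta * M.
Proof. by move=> c1 zM; rewrite !normrM c1 mulr1 gtr0_norm // ler_pM2l. Qed.

Lemma nodes_bound j : [/\ `|xs j| <= eta * M, `|ys j| <= eta * M, `|xt j| <= eta * M & `|yt j| <= eta * M].
Proof.
by have [h1 h2] := suv_norm (pg j); split; apply: level_norm; rewrite ?s_bound ?t_bound.
Qed.

Lemma slope_bound (c a : R) : `|c| <= 1 -> `|a| <= w / 2 -> `|c * a| <= w / 2.
Proof. by move=> c1 aw; rewrite normrM -[leRHS]mul1r; apply: ler_pM. Qed.

Lemma tilt_norm j : `|tilt j| = T.
Proof.
rewrite /tilt !normrM (suv_norm (pg j)).2 mul1r (gtr0_norm T_gt0) /updn.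
by case: ifP => _; rewrite ?normrN normr1 mul1r.
Qed.

Lemma tilt_bound j a : `|a| <= w / 2 -> `|tilt j * a| <= T * (w / 2).
Proof. by move=> aw; rewrite normrM tilt_norm ler_pM2l. Qed.

Lemma half_w_lt_q : eta * M + w / 2 < q.
Proof. by apply: le_lt_trans q_big; rewrite lerD2l ler_peMl ?kap_ge1 // ltW // divr_gt0. Qed.

Lemma setback_gt0 j : 0 <= setback j.
Proof.
have T2 : T ^+ 2 < 1 by rewrite expr_lt1 // ltW.
rewrite /setback /rise !mulr_ge0 ?invr_ge0 ?ler0n ?subr_ge0 ?normr_ge0 ?(ltW eta_gt0) ?(ltW T2) //.
by rewrite mulr_ge0 ?ler0n // ltW.
Qed.

Lemma py_bound j r l a : (r < 6)%N -> 0 <= l <= 1 -> `|a| <= w / 2 -> `|py j r l a| < q.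
Proof.
move=> r6 l01 aw; apply: le_lt_trans q_big.
have k1 := kap_ge1; have [_ y0 _ y1] := nodes_bound j.
have hw : w / 2 <= kap * (w / 2) by rewrite ler_peMl // ltW // divr_gt0.
have n0 : `|ys j + a| <= eta * M + kap * (w / 2).
  by apply: (le_trans (ler_normD _ _)); apply: lerD => //; exact: le_trans aw hw.
have n1 : `|yt j + a| <= eta * M + kap * (w / 2).
  by apply: (le_trans (ler_normD _ _)); apply: lerD => //; exact: le_trans aw hw.
have nm : `|(ys j + yt j) / 2 + kap * a| <= eta * M + kap * (w / 2).
  apply: (le_trans (ler_normD _ _)); apply: lerD.
    by move: y0 y1; rewrite !ler_norml => /andP[? ?] /andP[? ?]; apply/andP; split; lra.
  by rewrite normrM ger0_norm ?(le_trans ler01) // ler_pM2l // (lt_le_trans ltr01).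
by apply: mid_norm => //; case: r r6 => [|[|[|[|[|[|//]]]]]] _.
Qed.

Lemma px_center j r l a : r = 0%N \/ r = 5%N -> 0 <= l <= 1 -> `|a| <= w / 2 ->
  px j r l a <= q /\ (px j r l a = q -> if r == 0%N then l = 1 else l = 0).
Proof.
move=> hr l01 aw; have [x0 _ x1 _] := nodes_bound j; have hq := half_w_lt_q.
have b0 : xs j + c0 j * a < q.
  have := slope_bound (det_bound _ _) aw : `|c0 j * a| <= _.
  by move: x0; rewrite !ler_norml => /andP[? ?] /andP[? ?]; lra.
have b6 : xt j - c6 j * a < q.
  have := slope_bound (det_bound _ _) aw : `|c6 j * a| <= _.
  by move: x1; rewrite !ler_norml => /andP[? ?] /andP[? ?]; lra.
case/andP: (l01) => l0 l1; case: hr => ->; rewrite /px /NX /=; split.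
- by apply: mid_le => //; exact: ltW.
- by move=> E; apply: mid_eq_right b0 _ => //; rewrite E.
- by apply: mid_le => //; exact: ltW.
- move=> E; have : 1 - l = 1; last by lra.
  apply: (@mid_eq_right _ _ (xt j - c6 j * a) q); [lra|by []|].
  by rewrite /mid; move: E; rewrite /mid; lra.
Qed.

Lemma px_tip j r l a : (1 <= r <= 4)%N -> 0 <= l <= 1 -> `|a| <= w / 2 ->
  q <= px j r l a /\ (px j r l a = q -> (r = 1%N /\ l = 0) \/ (r = 4%N /\ l = 1)).
Proof.
move=> hr l01 aw; have [b1 b2] := X_big j.
have /andP[b3 b4] : - (T * (w / 2)) <= tilt j * a <= T * (w / 2).
  by rewrite -ler_norml tilt_bound.
have n2 : q < X j + tilt j * a by lra.
have n4 : q < X j - tilt j * a by lra.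
case/andP: (l01) => l0 l1.
case: r hr => [//|[|[|[|[|//]]]]] _; rewrite /px /NX /=.
- split; first by apply: mid_ge => //; exact: ltW.
  by move=> E; left; split => //; apply: mid_eq_left n2 _ => //; rewrite E.
- have h := mid_gt l01 n2 b2; split; first exact: ltW.
  by move=> E; rewrite E ltxx in h.
- have h := mid_gt l01 b2 n4; split; first exact: ltW.
  by move=> E; rewrite E ltxx in h.
- split; first by apply: mid_ge => //; exact: ltW.
  move=> E; right; split => //.
  have : 1 - l = 0; last by lra.
  apply: (@mid_eq_left _ _ q (X j - tilt j * a)); [lra|by []|].
  by rewrite /mid; move: E; rewrite /mid; lra.
Qed.

Lemma px_lower j r l a : (r < 6)%N -> 0 <= l <= 1 -> `|a| <= w / 2 -> - q < px j r l a.
Proof.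
move=> r6 l01 aw; have [x0 _ x1 _] := nodes_bound j; have hq := half_w_lt_q.
have q0 : 0 < q.
  apply: le_lt_trans hq; apply: addr_ge0; last by rewrite ltW // divr_gt0.
  by apply: le_trans x0.
have [/andP[r1 r4]|hr] := boolP (1 <= r <= 4)%N.
  have [h _] := @px_tip j r l a (introT andP (conj r1 r4)) l01 aw.
  by apply: lt_le_trans h; lra.
have b0 : - q < xs j + c0 j * a.
  have := slope_bound (det_bound _ _) aw : `|c0 j * a| <= _.
  by move: x0; rewrite !ler_norml => /andP[? ?] /andP[? ?]; lra.
have b6 : - q < xt j - c6 j * a.
  have := slope_bound (det_bound _ _) aw : `|c6 j * a| <= _.
  by move: x1; rewrite !ler_norml => /andP[? ?] /andP[? ?]; lra.
have qq : - q < q by lra.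
by case: r r6 hr => [|[|[|[|[|[|//]]]]]] // _ _; apply: mid_gt.
Qed.

Lemma px_upper j r l a : (r < 6)%N -> 0 <= l <= 1 -> `|a| <= w / 2 -> px j r l a <= X j + T * (w / 2).
Proof.
move=> r6 l01 aw; have [b1 b2] := X_big j.
have Tw : 0 < T * (w / 2) by rewrite mulr_gt0 // divr_gt0.
have /andP[b3 b4] : - (T * (w / 2)) <= tilt j * a <= T * (w / 2).
  by rewrite -ler_norml tilt_bound.
have sb := setback_gt0 j.
have [hr|hr] := boolP ((r == 0%N) || (r == 5%N)).
  have hr' : r = 0%N \/ r = 5%N by case/orP: hr => /eqP ->; [left|right].
  have [h _] := px_center j hr' l01 aw.
  by lra.
by case: r r6 hr => [|[|[|[|[|[|//]]]]]] // _ _; apply: mid_le => //; rewrite /NX /=; lra.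
Qed.

Lemma px_fold j r l a b : r = 2%N \/ r = 3%N -> 0 <= l <= 1 -> `|a| <= w / 2 ->
  b < X j - setback j -> b < X j - T * (w / 2) -> b < px j r l a.
Proof.
move=> hr l01 aw b1 b2.
have /andP[b3 b4] : - (T * (w / 2)) <= tilt j * a <= T * (w / 2).
  by rewrite -ler_norml tilt_bound.
by case: hr => ->; apply: mid_gt => //; rewrite /NX /=; lra.
Qed.

(** * Heights and layering of the strips *)

Lemma nx_neq j : nx j != j.
Proof. by apply/eqP => h; have := pg_nx j; rewrite h eqxx. Qed.

Lemma s_neq_t j : s j != t j.
Proof. by rewrite tE (inj_eq s_inj) eq_sym nx_neq. Qed.

Lemma level_gap i j : s i <> s j -> g <= `|s i - s j|.
Proof. by move=> h; apply: gap; apply/eqP => e; apply: h; rewrite e. Qed.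

Lemma updn_sub j : t j - s j = updn j * `|t j - s j|.
Proof.
rewrite /updn; case: ltP => h; first by rewrite mul1r ger0_norm // subr_ge0 ltW.
by rewrite mulN1r ler0_norm ?opprK // subr_le0.
Qed.

Lemma arc_gap j : if s j < t j then s j + g <= t j else t j + g <= s j.
Proof.
have := level_gap (i := nx j) (j := j); rewrite -tE => /(_ _) h.
have {h} : g <= `|t j - s j| by apply: h => e; have := s_neq_t j; rewrite e eqxx.
case: ltP => h.
  have h1 : 0 <= t j - s j by lra.
  by rewrite (ger0_norm h1); lra.
have h1 : t j - s j <= 0 by lra.
by rewrite (ler0_norm h1); lra.
Qed.

Lemma same_page_levels i j z z' : i != j -> pg i = pg j -> z = s i \/ z = t i ->
  z' = s j \/ z' = t j -> g <= `|z - z'|.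
Proof.
move=> ij pij hz hz'.
have tt k k' : pg k = pg k' -> s k <> t k'.
  by move=> pk; rewrite tE => /s_inj h; have := pg_nx k'; rewrite -h pk eqxx.
case: hz => ->; case: hz' => ->.
- exact: gap.
- by rewrite tE; apply: level_gap; rewrite -tE; apply: tt.
- by rewrite tE; apply: level_gap; rewrite -tE => /esym; apply: tt.
- by rewrite !tE; apply: gap; rewrite (inj_eq nx_inj).
Qed.

Lemma ph_start j l : ph j 0 l = s j + l * (g / 4).
Proof. by rewrite /ph /mid /NH /=; ring. Qed.

Lemma ph_end j l : ph j 5 l = t j - (1 - l) * (g / 4).
Proof. by rewrite /ph /mid /NH /=; ring. Qed.

Lemma ph_center j r l : r = 0%N \/ r = 5%N -> 0 <= l <= 1 ->
  exists2 z, z = s j \/ z = t j & `|ph j r l - z| <= g / 4.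
Proof.
have g0 := g_gt0.
move=> hr /andP[l0 l1].
have p1 : 0 <= l * (g / 4) by rewrite mulr_ge0 // divr_ge0 // ltW.
have p2 : 0 <= (1 - l) * (g / 4) by rewrite mulr_ge0 ?subr_ge0 // divr_ge0 // ltW.
case: hr => ->.
  exists (s j); first by left.
  by rewrite ph_start addrC addKr ger0_norm //; lra.
exists (t j); first by right.
by rewrite ph_end addrC addKr normrN ger0_norm //; lra.
Qed.

Lemma ph_q j r l : (1 <= r <= 4)%N -> (r = 1%N /\ l = 0) \/ (r = 4%N /\ l = 1) ->
  exists2 z, z = s j \/ z = t j & `|ph j r l - z| <= g / 4.
Proof.
have g0 := g_gt0.
move=> _ [[-> ->]|[-> ->]].
  exists (s j); first by left.
  have -> : ph j 1 0 - s j = g / 4 by rewrite /ph /mid /NH /=; ring.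
  by rewrite ger0_norm //; lra.
exists (t j); first by right.
have -> : ph j 4 1 - t j = - (g / 4) by rewrite /ph /mid /NH /=; ring.
by rewrite normrN ger0_norm //; lra.
Qed.

Lemma ph_range j r l : (r < 6)%N -> 0 <= l <= 1 -> lo j - g / 4 <= ph j r l <= hi j + g / 4.
Proof.
have g0 := g_gt0.
move=> r6 l01; have := arc_gap j; rewrite /ph /lo /hi /NH /updn; case: ltP => h G.
  apply/andP; split.
    by case: r r6 => [|[|[|[|[|[|//]]]]]] _ /=; apply: mid_ge => //; lra.
  by case: r r6 => [|[|[|[|[|[|//]]]]]] _ /=; apply: mid_le => //; lra.
apply/andP; split.
  by case: r r6 => [|[|[|[|[|[|//]]]]]] _ /=; apply: mid_ge => //; lra.
by case: r r6 => [|[|[|[|[|[|//]]]]]] _ /=; apply: mid_le => //; lra.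
Qed.

(** On its long arms a strip is within g / 3 of its extreme levels. Arcs nested inside have levels
    at least g further in and exceed them by at most g / 4, so the arms never reach their
    heights. *)
Lemma ph_long j r l : r = 1%N \/ r = 4%N -> 0 <= l <= 1 ->
  ph j r l <= lo j + g / 3 \/ hi j - g / 3 <= ph j r l.
Proof.
have g0 := g_gt0.
move=> hr l01; have := arc_gap j; rewrite /ph /lo /hi /NH /updn.
case: ltP => h G; case: hr => -> /=.
- by left; apply: mid_le => //; lra.
- by right; apply: mid_ge => //; lra.
- by right; apply: mid_ge => //; lra.
- by left; apply: mid_le => //; lra.
Qed.

Lemma ph_tip_inj j r r' l l' : (1 <= r < 5)%N -> (1 <= r' < 5)%N -> 0 <= l <= 1 -> 0 <= l' <= 1 ->
  ph j r l = ph j r' l' -> r%:R + l = r'%:R + l'.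
Proof.
have g0 := g_gt0.
move=> hr hr' l01 l01' E.
have inc k : (1 <= k < 5)%N -> updn j * NH j k < updn j * NH j k.+1.
  have := arc_gap j; rewrite /NH /updn; case: ltP => h G.
    by case: k => [|[|[|[|[|//]]]]] //= _; rewrite ?mul1r; lra.
  by case: k => [|[|[|[|[|//]]]]] //= _; rewrite ?mulN1r; lra.
apply: (mid_nodes_inj inc) => //.
have mE k (x : R) : mid x (updn j * NH j k) (updn j * NH j k.+1) = updn j * ph j k x.
  by rewrite /ph /mid; ring.
by rewrite !mE E.
Qed.

(** Neither [a] nor the sideways coordinate enters. Near the axis the heights lie within g / 4 of
    levels that are g apart. Further out, arcs with disjoint level intervals differ in height, and
    for nested arcs either the outer one is on a long arm, at another height, or its tip lies beyond
    the whole inner strip. *)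
Lemma same_page_inj j j' r r' l l' a a' : pg j = pg j' -> (r < 6)%N -> (r' < 6)%N ->
  0 <= l <= 1 -> 0 <= l' <= 1 -> `|a| <= w / 2 -> `|a'| <= w / 2 ->
  px j r l a = px j' r' l' a' -> ph j r l = ph j' r' l' ->
  j = j' /\ r%:R + l = r'%:R + l'.
Proof.
have g0 := g_gt0.
move=> pjj r6 r6' l01 l01' aw aw' Ex Eh.
have cases k : (k < 6)%N -> (k = 0%N \/ k = 5%N) \/ (1 <= k <= 4)%N.
  by case: k => [|[|[|[|[|[|//]]]]]] _; [left; left|right|right|right|right|left; right].
have far i i' k k' m m' : i != i' -> pg i = pg i' ->
    (exists2 z, z = s i \/ z = t i & `|ph i k m - z| <= g / 4) ->
    (exists2 z, z = s i' \/ z = t i' & `|ph i' k' m' - z| <= g / 4) -> ph i k m = ph i' k' m' -> False.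
  move=> ii pii [z hz zE] [z' hz' zE'] E.
  have := same_page_levels ii pii hz hz'.
  have : `|z - z'| <= `|ph i k m - z| + `|ph i' k' m' - z'|.
    rewrite distrC (_ : z' - z = (ph i k m - z) - (ph i' k' m' - z')); last by rewrite E; ring.
    exact: ler_normB.
  by lra.
have ctip i i' k k' m m' b b' : pg i = pg i' -> k = 0%N \/ k = 5%N -> (1 <= k' <= 4)%N ->
    0 <= m <= 1 -> 0 <= m' <= 1 -> `|b| <= w / 2 -> `|b'| <= w / 2 ->
    px i k m b = px i' k' m' b' -> ph i k m = ph i' k' m' ->
    i = i' /\ k%:R + m = k'%:R + m'.
  move=> pii hk hk' m01 m01' bw bw' ex eh.
  have [c1 c2] := px_center i hk m01 bw; have [d1 d2] := px_tip i' hk' m01' bw'.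
  have eq : px i k m b = q by apply/eqP; rewrite eq_le c1 ex d1.
  have hk'2 := d2 (etrans (esym ex) eq).
  have [ii|ii] := eqVneq i i'; last first.
    by case: (far i i' k k' m m' ii pii) => //; [exact: ph_center|exact: ph_q].
  split => //; have m1 := c2 eq; move: eh; rewrite -ii /ph.
  have := arc_gap i; case: hk m1 {c1 c2 ex eq} => -> /= ->; case: hk'2 => [[-> ->]|[-> ->]];
    rewrite /mid /NH /=; case: ltP => ? ? ?; try lra; exfalso; lra.
have [hr|hr] := cases r r6; have [hr'|hr'] := cases r' r6'.
- have [jj|jj] := eqVneq j j'; last first.
    by case: (far j j' r r' l l' jj pjj) => //; exact: ph_center.
  split=> //; move: Eh; rewrite -jj; case/andP: l01 => ? ?; case/andP: l01' => ? ?.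
  have G := arc_gap j; have g4 : 0 < g / 4 by lra.
  case: hr => ->; case: hr' => ->; rewrite ?ph_start ?ph_end.
  + by move=> /addrI/(mulIf (lt0r_neq0 g4)) ->.
  + by move=> E; exfalso; move: G; case: ltP => ? ?; nra.
  + by move=> E; exfalso; move: G; case: ltP => ? ?; nra.
  + by move=> /addrI/oppr_inj/(mulIf (lt0r_neq0 g4)) E; congr (_ + _); lra.
- exact: ctip Ex Eh.
- by have [-> ->] := ctip _ _ _ _ _ _ _ _ (esym pjj) hr' hr l01' l01 aw' aw (esym Ex) (esym Eh).
- have [jj|jj] := eqVneq j j'.
    split=> //; rewrite -jj in Eh; apply: (ph_tip_inj (j := j)) => //.
  exfalso; have H i i' k k' m m' b b' : pg i = pg i' -> (1 <= k <= 4)%N -> (k' < 6)%N ->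
      0 <= m <= 1 -> 0 <= m' <= 1 -> `|b| <= w / 2 -> `|b'| <= w / 2 -> i != i' ->
      px i k m b = px i' k' m' b' -> ph i k m = ph i' k' m' ->
      lo i < lo i' -> hi i' < hi i -> False.
    move=> pii hk hk' m01 m01' bw bw' ii ex eh l1 l2.
    have [n1 n2] := X_nested pii l1 l2.
    have /andP[p1 p2] := ph_range i' hk' m01'.
    have lohi v : exists2 z, z = s v \/ z = t v & z = lo v.
      by rewrite /lo; case: leP => _; [exists (s v)|exists (t v)] => //; [left|right].
    have hihi v : exists2 z, z = s v \/ z = t v & z = hi v.
      by rewrite /hi; case: leP => _; [exists (t v)|exists (s v)] => //; [right|left].
    have [z1 hz1 e1] := lohi i; have [z2 hz2 e2] := lohi i'.
    have := same_page_levels ii pii hz1 hz2; rewrite e1 e2 ltr0_norm ?subr_lt0 // => g1.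
    have [z3 hz3 e3] := hihi i; have [z4 hz4 e4] := hihi i'.
    have := same_page_levels ii pii hz3 hz4; rewrite e3 e4 gtr0_norm ?subr_gt0 // => g2.
    have [hk2|hk2] : (k = 1%N \/ k = 4%N) \/ (k = 2%N \/ k = 3%N).
      by case: k hk {ex eh} => [|[|[|[|[|//]]]]] // _; [left; left|right; left|right; right|left; right].
      by have [|] := ph_long i hk2 m01; lra.
    have := @px_fold i k m b (X i' + T * (w / 2)) hk2 m01 bw n1 n2.
    by rewrite ex ltNge px_upper.
  have s5 k : (1 <= k <= 4)%N -> (k < 6)%N by move=> /andP[_ k4]; exact: leq_ltn_trans k4 _.
  have /andP[p1 p2] := ph_range j (s5 _ hr) l01; have /andP[p3 p4] := ph_range j' (s5 _ hr') l01'.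
  have lohi v : exists2 z, z = s v \/ z = t v & z = lo v.
    by rewrite /lo; case: leP => _; [exists (s v)|exists (t v)] => //; [left|right].
  have hihi v : exists2 z, z = s v \/ z = t v & z = hi v.
    by rewrite /hi; case: leP => _; [exists (t v)|exists (s v)] => //; [right|left].
  have [z1 hz1 e1] := lohi j; have [z2 hz2 e2] := lohi j'.
  have [z3 hz3 e3] := hihi j; have [z4 hz4 e4] := hihi j'.
  have [h|h|[h1 h2]|[h1 h2]] := nested jj pjj.
  + by have := same_page_levels jj pjj hz3 hz2; rewrite e2 e3 ltr0_norm ?subr_lt0 //; lra.
  + by have := same_page_levels jj pjj hz1 hz4; rewrite e1 e4 gtr0_norm ?subr_gt0 //; lra.
  + exact: (H j j' r r' l l' a a').
  + by apply: (H j' j r' r l' l a' a) => //; rewrite eq_sym.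
Qed.

Lemma frame_diff (p p' : 'I_4) (x y x' y' : R) : p != p' ->
  x * (dir p).1 - y * (dir p).2 = x' * (dir p').1 - y' * (dir p').2 ->
  x * (dir p).2 + y * (dir p).1 = x' * (dir p').2 + y' * (dir p').1 ->
  [/\ odd p = odd p', x = - x', y = - y', su p' = - su p & sv p' = - sv p] \/
  [/\ odd p != odd p', `|det p p'| = 1, y' = - det p p' * x & y = det p p' * x'].
Proof.
move: p; apply: dirP; move: p'; apply: dirP; rewrite /det /dir /su /sv /= => // _ e1 e2;
  try (by left; split => //; lra); right; split => //; rewrite ?normrN1 /=; try lra.
all: by rewrite ?mulr0 ?mul0r ?mulr1 ?mul1r ?subr0 ?sub0r ?addr0 ?add0r ?mulrN1 ?mulN1r ?opprK
  ?normrN normr1.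
Qed.

Lemma frame_center (p p' : 'I_4) (z x' y' : R) :
  eta * su p * z * (dir p).1 - eta * sv p * z * (dir p).2 = x' * (dir p').1 - y' * (dir p').2 ->
  eta * su p * z * (dir p).2 + eta * sv p * z * (dir p).1 = x' * (dir p').2 + y' * (dir p').1 ->
  x' = eta * su p' * z /\ y' = eta * sv p' * z.
Proof.
by move: p; apply: dirP; move: p'; apply: dirP; rewrite /dir /su /sv /= => e1 e2; split; lra.
Qed.

Lemma pt_eqP j j' r r' l l' a a' : pt j r l a = pt j' r' l' a' ->
  px j r l a * (dir (pg j)).1 - py j r l a * (dir (pg j)).2 =
    px j' r' l' a' * (dir (pg j')).1 - py j' r' l' a' * (dir (pg j')).2 /\
  px j r l a * (dir (pg j)).2 + py j r l a * (dir (pg j)).1 =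
    px j' r' l' a' * (dir (pg j')).2 + py j' r' l' a' * (dir (pg j')).1.
Proof. by rewrite /pt => -[]. Qed.

Lemma pt_same_page j j' r r' l l' a a' : pg j = pg j' -> pt j r l a = pt j' r' l' a' ->
  px j r l a = px j' r' l' a' /\ py j r l a = py j' r' l' a'.
Proof.
move=> pjj E; have [-> ->] := pt_loc j r l a; have [-> ->] := pt_loc j' r' l' a'.
by rewrite E pjj.
Qed.

Lemma panel_cases k : (k < 6)%N -> (k = 0%N \/ k = 5%N) \/ (1 <= k <= 4)%N.
Proof. by case: k => [|[|[|[|[|[|//]]]]]] _; [left; left|right|right|right|right|left; right]. Qed.

(** Outside the centre x >= q in the frame of the page. For the opposite page this contradicts
    [px_lower], and for a perpendicular one it contradicts [py_bound], as the sideways coordinate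
    there is x up to sign. *)
Lemma diff_page_center j j' r r' l l' a a' : pg j != pg j' -> (r < 6)%N -> (r' < 6)%N ->
  0 <= l <= 1 -> 0 <= l' <= 1 -> `|a| <= w / 2 -> `|a'| <= w / 2 ->
  pt j r l a = pt j' r' l' a' -> r = 0%N \/ r = 5%N.
Proof.
move=> pjj r6 r6' l01 l01' aw aw' /pt_eqP[e1 e2].
have [//|hr] := panel_cases r6; exfalso.
have [q1 _] := px_tip j hr l01 aw.
have := py_bound j' r6' l01' aw'; have := px_lower j' r6' l01' aw'.
rewrite ltr_norml => h1 /andP[h2 h3].
have [[_ x1 _ _ _]|[_ d1 y1 _]] := frame_diff pjj e1 e2; first by lra.
have : `|py j' r' l' a'| = `|px j r l a| by rewrite y1 normrM normrN d1 mul1r.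
move=> E; have : `|py j' r' l' a'| < q by rewrite ltr_norml h2.
by rewrite E; have := ler_norm (px j r l a); lra.
Qed.

Lemma center_level_eq i j (x : R) : `|s i - s j| <= x -> x < g -> i = j.
Proof.
move=> h1 h2; apply: contrapT => /eqP ij; have := gap ij.
by move=> /(fun h => le_trans h h1); rewrite leNgt h2.
Qed.

(** In the centre equal heights force levels less than g apart, hence equal levels. The arcs are
    then consecutive, and their heights agree only at the end of the first one. *)
Lemma diff_page_inj j j' r r' l l' a a' : pg j != pg j' -> (r < 6)%N -> (r' < 6)%N ->
  0 <= l <= 1 -> 0 <= l' <= 1 -> `|a| <= w / 2 -> `|a'| <= w / 2 ->
  pt j r l a = pt j' r' l' a' -> ph j r l = ph j' r' l' -> l = 1 \/ l' = 1.
Proof.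
have g0 := g_gt0.
move=> pjj r6 r6' l01 l01' aw aw' Ep Eh.
have hr := diff_page_center pjj r6 r6' l01 l01' aw aw' Ep.
have hr' : r' = 0%N \/ r' = 5%N.
  by apply: diff_page_center r6' r6 l01' l01 aw' aw (esym Ep); rewrite eq_sym.
have bnd m : 0 <= m <= 1 -> 0 <= m * (g / 4) <= g / 4.
  move=> /andP[m0 m1]; have g4 : 0 <= g / 4 by lra.
  by apply/andP; split; [exact: mulr_ge0|rewrite ler_piMl].
have bnd' m : 0 <= m <= 1 -> 0 <= (1 - m) * (g / 4) <= g / 4.
  by move=> /andP[m0 m1]; apply: bnd; apply/andP; split; lra.
have := bnd _ l01; have := bnd _ l01'; have := bnd' _ l01; have := bnd' _ l01'.
move: Eh; case: hr => ->; case: hr' => ->; rewrite ?ph_start ?ph_end ?tE.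
- move=> E /andP[? ?] /andP[? ?] /andP[? ?] /andP[? ?]; exfalso.
  have : j = j' by apply: (@center_level_eq _ _ (g / 2)); [rewrite ler_norml; apply/andP; split|]; lra.
  by move=> e; rewrite e eqxx in pjj.
- move=> E /andP[? ?] /andP[? ?] /andP[? ?] /andP[? ?]; right.
  have e : j = nx j' by apply: (@center_level_eq _ _ (g / 2)); [rewrite ler_norml; apply/andP; split|]; lra.
  have : (1 - l') * (g / 4) = 0 by rewrite e in E; lra.
  by move/eqP; rewrite mulf_eq0 subr_eq0 [g / 4 == 0]gt_eqF ?divr_gt0 // orbF => /eqP.
- move=> E /andP[? ?] /andP[? ?] /andP[? ?] /andP[? ?]; left.
  have e : nx j = j' by apply: (@center_level_eq _ _ (g / 2)); [rewrite ler_norml; apply/andP; split|]; lra.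
  have : (1 - l) * (g / 4) = 0 by rewrite e in E; lra.
  by move/eqP; rewrite mulf_eq0 subr_eq0 [g / 4 == 0]gt_eqF ?divr_gt0 // orbF => /eqP.
- move=> E /andP[? ?] /andP[? ?] /andP[? ?] /andP[? ?]; exfalso.
  have : nx j = nx j' by apply: (@center_level_eq _ _ (g / 2)); [rewrite ler_norml; apply/andP; split|]; lra.
  by move=> /nx_inj e; rewrite e eqxx in pjj.
Qed.

Lemma nat_frac_inj (r r' : nat) (l l' : R) : 0 <= l < 1 -> 0 <= l' < 1 ->
  r%:R + l = r'%:R + l' -> r = r' /\ l = l'.
Proof.
move=> /andP[l0 l1] /andP[l0' l1'] E.
have [h|h|h] := ltngtP r r'.
- have : r%:R + 1 <= r'%:R :> R by rewrite natr1 ler_nat.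
  by lra.
- have : r'%:R + 1 <= r%:R :> R by rewrite natr1 ler_nat.
  by lra.
- by split => //; move: E; rewrite h => /addrI.
Qed.

(** Between pages a contact needs the fraction 1, which is excluded. Within a page x and the height
    fix the place along the strip, and there the sideways coordinate is strictly increasing in
    [a]. *)
Lemma patch_inj j j' r r' l l' a a' : (r < 6)%N -> (r' < 6)%N ->
  0 <= l < 1 -> 0 <= l' < 1 -> `|a| <= w / 2 -> `|a'| <= w / 2 ->
  pt j r l a = pt j' r' l' a' -> ph j r l = ph j' r' l' ->
  [/\ j = j', r = r', l = l' & a = a'].
Proof.
move=> r6 r6' l01 l01' aw aw' Ep Eh.
have l01c : 0 <= l <= 1 by case/andP: l01 => -> /ltW ->.
have l01c' : 0 <= l' <= 1 by case/andP: l01' => -> /ltW ->.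
have [pjj|pjj] := eqVneq (pg j) (pg j'); last first.
  case/andP: l01 => _ l1; case/andP: l01' => _ l1'.
  by case: (diff_page_inj pjj r6 r6' l01c l01c' aw aw' Ep Eh) => e;
    [rewrite e ltxx in l1|rewrite e ltxx in l1'].
have [Ex Ey] := pt_same_page pjj Ep.
have [jj rl] := same_page_inj pjj r6 r6' l01c l01c' aw aw' Ex Eh.
have [rr ll] := nat_frac_inj l01 l01' rl; split => //.
rewrite -jj -rr -ll in Ey; have kp := lt_le_trans ltr01 kap_ge1.
case/andP: l01 => l0 l1.
move: Ey; rewrite /py /mid /NY; case: (r) r6 => [|[|[|[|[|[|//]]]]]] _ /=; try lra.
- move=> E; have : ((1 - l) + l * kap) * (a - a') = 0 by lra.
  move/eqP; rewrite mulf_eq0 subr_eq0 => /orP[|/eqP //]; rewrite gt_eqF //.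
  by rewrite ltr_pwDl ?subr_gt0 // mulr_ge0 // ltW.
- move=> E; have : ((1 - l) * kap + l) * (a - a') = 0 by lra.
  move/eqP; rewrite mulf_eq0 subr_eq0 => /orP[|/eqP //]; rewrite gt_eqF //.
  by rewrite ltr_pwDl // mulr_gt0 // subr_gt0.
Qed.

(** * Crossings of the core *)

Definition NZ j r := nth 0 [:: s j; s j; s j; (s j + t j) / 2; t j; t j; t j] r.
Definition pz j r l := mid l (NZ j r) (NZ j r.+1).

(** Sideways, the core shows the level in the scale [eta]: within one page its projection is a
    flattened drawing of arcs in the half-plane of the coordinates (x, level). *)
Lemma py_core j r l : (r < 6)%N -> py j r l 0 = eta * sv (pg j) * pz j r l.
Proof.
by case: r => [|[|[|[|[|[|//]]]]]] _; rewrite /py /pz /mid /NY /NZ /ys /yt /=; ring.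
Qed.

Lemma sv_neq0 p : eta * sv p != 0.
Proof.
apply: mulf_neq0; first by rewrite gt_eqF.
by rewrite -normr_eq0 (suv_norm p).2 oner_eq0.
Qed.

Lemma zero_half : `|0 : R| <= w / 2. Proof. by rewrite normr0 divr_ge0 // ltW. Qed.

Lemma pz_range j r l : (r < 6)%N -> 0 <= l <= 1 -> lo j <= pz j r l <= hi j.
Proof.
move=> r6 l01; have [b1 b2 b3 b4] : [/\ lo j <= s j, lo j <= t j, s j <= hi j & t j <= hi j].
  by rewrite /lo /hi !ge_min !le_max !lexx !orbT.
apply/andP; split; rewrite /pz /NZ.
  by case: r r6 => [|[|[|[|[|[|//]]]]]] _ /=; apply: mid_ge => //; lra.
by case: r r6 => [|[|[|[|[|[|//]]]]]] _ /=; apply: mid_le => //; lra.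
Qed.

(** The drawn level is constant on the outgoing and on the returning arm and strictly monotone on
    the tip. An arc nested inside has levels strictly between the two arms, and its whole drawing
    ends before the outer tip. *)
Lemma core_same_page j j' r r' l l' : pg j = pg j' -> (r < 6)%N -> (r' < 6)%N ->
  0 <= l <= 1 -> 0 <= l' <= 1 -> pt j r l 0 = pt j' r' l' 0 ->
  j = j' /\ r%:R + l = r'%:R + l'.
Proof.
move=> pjj r6 r6' l01 l01' Ep; have [Ex Ey] := pt_same_page pjj Ep.
have Ez : pz j r l = pz j' r' l'.
  by apply: (mulfI (sv_neq0 (pg j))); rewrite -py_core // Ey py_core // pjj.
have zh := zero_half.
have H i i' k k' m m' : pg i = pg i' -> (k < 6)%N -> (k' < 6)%N ->
    0 <= m <= 1 -> 0 <= m' <= 1 -> px i k m 0 = px i' k' m' 0 -> pz i k m = pz i' k' m' ->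
    lo i < lo i' -> hi i' < hi i -> False.
  move=> pii hk hk' m01 m01' ex ez l1 l2; have [n1 n2] := X_nested pii l1 l2.
  have /andP[p1 p2] := pz_range i' hk' m01'.
  have hk2 : k = 2%N \/ k = 3%N.
    have nst z : (z = s i \/ z = t i) -> pz i k m = z -> False.
      move=> hz e; have hz2 : z = lo i \/ z = hi i.
        by rewrite /lo /hi; case: (leP (s i) (t i)) => _; case: hz; [left|right|right|left].
      by move: p1 p2; rewrite -ez e; case: hz2 => ->; lra.
    case: k hk ex ez nst => [|[|[|[|[|[|//]]]]]] _ ex ez nst; try (by left); try (by right); exfalso.
    - by apply: (nst (s i)); [left|rewrite /pz /mid /NZ /=; ring].
    - by apply: (nst (s i)); [left|rewrite /pz /mid /NZ /=; ring].
    - by apply: (nst (t i)); [right|rewrite /pz /mid /NZ /=; ring].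
    - by apply: (nst (t i)); [right|rewrite /pz /mid /NZ /=; ring].
  have := @px_fold i k m 0 (X i' + T * (w / 2)) hk2 m01 zh n1 n2.
  by rewrite ex ltNge px_upper.
have [jj|jj] := eqVneq j j'; last first.
  have /andP[p1 p2] := pz_range j r6 l01; have /andP[p3 p4] := pz_range j' r6' l01'.
  exfalso; have [h|h|[h1 h2]|[h1 h2]] := nested jj pjj.
  - by have := le_lt_trans p2 (lt_le_trans h p3); rewrite Ez ltxx.
  - by have := le_lt_trans p4 (lt_le_trans h p1); rewrite Ez ltxx.
  - exact: (H j j' r r' l l').
  - by apply: (H j' j r' r l' l).
split => //; rewrite -{}jj in Ex Ez {pjj Ep Ey}.
have zi k : (2 <= k < 4)%N -> updn j * NZ j k < updn j * NZ j k.+1.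
  have G := arc_gap j; have g0 := g_gt0; move: G; rewrite /NZ /updn; case: ltP => h G.
    by case: k => [|[|[|[|//]]]] //= _; rewrite !mul1r; lra.
  by case: k => [|[|[|[|//]]]] //= _; rewrite !mulN1r; lra.
have zE k (m : R) : mid m (updn j * NZ j k) (updn j * NZ j k.+1) = updn j * pz j k m.
  by rewrite /pz /mid; ring.
have [Xb1 Xb2] := X_big j; have Tw : 0 < T * (w / 2) by rewrite mulr_gt0 // divr_gt0.
have [x0 _ x1 _] := nodes_bound j; have hq := half_w_lt_q.
have w20 : 0 < w / 2 by rewrite divr_gt0.
have xsq : xs j < q by move: x0; rewrite ler_norml => /andP[? ?]; lra.
have xtq : xt j < q by move: x1; rewrite ler_norml => /andP[? ?]; lra.
have xi k : (0 <= k < 2)%N -> NX j 0 k < NX j 0 k.+1.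
  by case: k => [|[|//]] _; rewrite /NX /= ?mulr0; lra.
have xd k : (4 <= k < 6)%N -> - NX j 0 k < - NX j 0 k.+1.
  by case: k => [|[|[|[|[|[|//]]]]]] //= _; rewrite /NX /= ?mulr0; lra.
have xE k (m : R) : mid m (- NX j 0 k) (- NX j 0 k.+1) = - px j k m 0.
  by rewrite /px /mid; ring.
have grp k : (k < 6)%N -> [\/ (0 <= k < 2)%N, (2 <= k < 4)%N | (4 <= k < 6)%N].
  by case: k => [|[|[|[|[|[|//]]]]]] _; [apply: Or31|apply: Or31|apply: Or32|apply: Or32|apply: Or33|apply: Or33].
have zA k (m : R) : (0 <= k < 2)%N -> pz j k m = s j.
  by case: k => [|[|//]] _; rewrite /pz /mid /NZ /=; ring.
have zC k (m : R) : (4 <= k < 6)%N -> pz j k m = t j.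
  by case: k => [|[|[|[|[|[|//]]]]]] //= _; rewrite /pz /mid /NZ /=; ring.
have zst : s j <> t j by apply/eqP; exact: s_neq_t.
have AB k k' (m m' : R) : (0 <= k < 2)%N -> (2 <= k' < 4)%N -> 0 <= m <= 1 -> 0 <= m' <= 1 ->
    px j k m 0 = px j k' m' 0 -> pz j k m = pz j k' m' -> k%:R + m = k'%:R + m'.
  move=> hk hk' m01 m01' ex ez.
  have [k2 mz] : k' = 2%N /\ m' = 0.
    move: ez; rewrite zA // => /(congr1 (fun z => updn j * z)); rewrite -zE => ez.
    case: k' hk' ex ez => [|[|[|[|//]]]] // _ ex ez.
      split => //; apply: (mid_eq_left _ (zi 2%N isT)); first by case/andP: m01'.
      by rewrite -ez.
    have i2 := zi 2%N isT; have i3 := zi 3%N isT.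
    have i23 := lt_trans i2 i3.
    by have := mid_gt m01' i2 i23; rewrite -ez {1}/NZ /= ltxx.
  have pX : px j 2 0 0 = X j by rewrite /px /mid /NX /=; ring.
  move: ex; rewrite k2 mz pX => ex.
  case: k hk ex {ez} => [|[|//]] _ ex.
    by exfalso; have [c1 _] := @px_center j 0 m 0 (or_introl erefl) m01 zh; lra.
  have m1 : m = 1; last by rewrite m1 addr0.
  apply: (mid_eq_right _ (xi 1%N isT)); first by case/andP: m01.
  by rewrite -/(px j 1 m 0) ex /NX /= mulr0 addr0.
have BC k k' (m m' : R) : (2 <= k < 4)%N -> (4 <= k' < 6)%N -> 0 <= m <= 1 -> 0 <= m' <= 1 ->
    px j k m 0 = px j k' m' 0 -> pz j k m = pz j k' m' -> k%:R + m = k'%:R + m'.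
  move=> hk hk' m01 m01' ex ez.
  have [k3 mz] : k = 3%N /\ m = 1.
    move: ez; rewrite (zC k') // => /(congr1 (fun z => updn j * z)); rewrite -zE => ez.
    case: k hk ex ez => [|[|[|[|//]]]] // _ ex ez.
      have i2 := zi 2%N isT; have i3 := zi 3%N isT.
      have i23 := lt_trans i2 i3.
      by have := mid_lt m01 i23 i3; rewrite ez {1}/NZ /= ltxx.
    split => //; apply: (mid_eq_right _ (zi 3%N isT)); first by case/andP: m01.
    by rewrite ez.
  have pX : px j 3 1 0 = X j by rewrite /px /mid /NX /=; ring.
  move: ex; rewrite k3 mz pX => /esym ex.
  case: k' hk' ex {ez} => [|[|[|[|[|[|//]]]]]] // _ ex; last first.
    by exfalso; have [c1 _] := @px_center j 5 m' 0 (or_intror erefl) m01' zh; lra.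
  have m0 : m' = 0; last by rewrite m0 addr0 natr1.
  apply: (mid_eq_left _ (xd 4%N isT)); first by case/andP: m01'.
  by rewrite xE ex /NX /= mulr0 subr0.
have [hr|hr|hr] := grp r r6; have [hr'|hr'|hr'] := grp r' r6'.
- by apply: (mid_nodes_inj xi).
- exact: AB.
- by case: zst; rewrite -(zA _ l hr) Ez zC.
- by apply/esym; apply: AB.
- by apply: (mid_nodes_inj zi) => //; rewrite !zE Ez.
- exact: BC.
- by case: zst; rewrite -(zA _ l' hr') -Ez zC.
- by apply/esym; apply: BC.
- by apply: (mid_nodes_inj xd) => //; rewrite !xE Ex.
Qed.

Lemma lt1W (l : R) : 0 <= l < 1 -> 0 <= l <= 1.
Proof. by move=> /andP[-> /ltW]. Qed.

Lemma xs_lt_q j : xs j < q /\ xt j < q.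
Proof.
have [x0 _ x1 _] := nodes_bound j; have hq := half_w_lt_q.
have w20 : 0 < w / 2 by rewrite divr_gt0.
by move: x0 x1; rewrite !ler_norml => /andP[? ?] /andP[? ?]; split; lra.
Qed.

(** A panel of the centre starts at x = q, out of reach of the other strip, or at a corner of the
    core. The sideways coordinate of a corner determines its level in every page, so only the two
    arcs meeting there pass through it. *)
Lemma core_meet_center j j' r r' l l' : pg j != pg j' -> r = 0%N \/ r = 5%N ->
  r' = 0%N \/ r' = 5%N -> 0 <= l < 1 -> 0 <= l' < 1 -> pt j r l 0 = pt j' r' l' 0 ->
  odd (pg j) != odd (pg j') -> 0 < l.
Proof.
move=> pjj hr hr' l01 l01' Ep opp.
have r6 : (r < 6)%N by case: hr => ->. have r6' : (r' < 6)%N by case: hr' => ->.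
have zh := zero_half; have [e1 e2] := pt_eqP Ep.
have := l01 => /andP[l0 l1]; rewrite lt_neqAle l0 andbT eq_sym; apply/eqP => lz.
have := py_bound j' r6' (lt1W l01') zh; rewrite ltr_norml => /andP[h2 h3].
have [[op _ _ _ _]|[_ d1 y1 _]] := frame_diff pjj e1 e2; first by rewrite op eqxx in opp.
have hdet : det (pg j) (pg j') = 1 \/ det (pg j) (pg j') = -1.
  move: d1; case: (leP 0 (det (pg j) (pg j'))) => hd; first by rewrite ger0_norm //; left.
  by rewrite ltr0_norm // => hh; right; rewrite -hh opprK.
case: hr => hr; last first.
  have px5 : px j r l 0 = q by rewrite hr lz /px /mid /NX /=; ring.
  by move: h2 h3; rewrite y1 px5; case: hdet => ->; rewrite ?opprK ?mul1r ?mulN1r ltxx.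
have px0 : px j r l 0 = eta * su (pg j) * s j by rewrite hr lz /px /mid /NX /= /xs; ring.
have py0 : py j r l 0 = eta * sv (pg j) * s j by rewrite hr lz /py /mid /NY /= /ys; ring.
have [ex ey] : px j' r' l' 0 = eta * su (pg j') * s j /\ py j' r' l' 0 = eta * sv (pg j') * s j.
  by apply: (@frame_center (pg j)); rewrite -px0 -py0.
case: hr' => hr'.
  have : py j' r' l' 0 = eta * sv (pg j') * s j' by rewrite hr' /py /mid /NY /= /ys; ring.
  rewrite ey => /(mulfI (sv_neq0 _))/s_inj jj.
  by rewrite jj eqxx in pjj.
have : py j' r' l' 0 = eta * sv (pg j') * t j' by rewrite hr' /py /mid /NY /= /yt; ring.
rewrite ey => /(mulfI (sv_neq0 _)) st.
have [_ tq] := xs_lt_q j'.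
have pE : px j' r' l' 0 = xt j' + (1 - l') * (q - xt j').
  by rewrite hr' /px /mid /NX /=; ring.
have xtE : eta * su (pg j') * s j = xt j' by rewrite /xt st.
case/andP: l01' => _ l1'.
have p : 0 < (1 - l') * (q - xt j') by apply: mulr_gt0; rewrite subr_gt0.
by move: ex p; rewrite pE xtE -[RHS]addr0 => /addrI ->; rewrite ltxx.
Qed.

(** Cores in opposite pages have equal drawn levels at a common point, so they belong to consecutive
    arcs and touch only at their common corner. Only perpendicular pages can produce crossings. *)
Lemma core_diff_page j j' r r' l l' : pg j != pg j' -> (r < 6)%N -> (r' < 6)%N ->
  0 <= l < 1 -> 0 <= l' < 1 -> pt j r l 0 = pt j' r' l' 0 ->
  [/\ odd (pg j) != odd (pg j'), r = 0%N \/ r = 5%N, r' = 0%N \/ r' = 5%N, 0 < l & 0 < l'].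
Proof.
move=> pjj r6 r6' l01 l01' Ep; have zh := zero_half.
have hr := diff_page_center pjj r6 r6' (lt1W l01) (lt1W l01') zh zh Ep.
have pjj' : pg j' != pg j by rewrite eq_sym.
have hr' := diff_page_center pjj' r6' r6 (lt1W l01') (lt1W l01) zh zh (esym Ep).
have [op|op] := eqVneq (odd (pg j)) (odd (pg j')); last first.
  split => //; first exact: core_meet_center Ep op.
  by apply: core_meet_center (esym Ep) _ => //; rewrite eq_sym.
exfalso; have [e1 e2] := pt_eqP Ep.
have [[_ x1 y1 suE svE]|[op' _ _ _]] := frame_diff pjj e1 e2; last by rewrite op eqxx in op'.
have zE : pz j r l = pz j' r' l'.
  apply: (mulfI (sv_neq0 (pg j))); rewrite -py_core // y1 py_core // svE; ring.
have H i i' (m m' : R) : su (pg i') = - su (pg i) -> 0 <= m < 1 -> 0 <= m' < 1 ->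
    s i = t i' -> px i 0 m 0 = - px i' 5 m' 0 -> False.
  move=> se /andP[m0 m1] /andP[m0' m1'] st ex.
  have [sq _] := xs_lt_q i; have [_ tq] := xs_lt_q i'.
  have E1 : px i 0 m 0 = xs i + m * (q - xs i) by rewrite /px /mid /NX /=; ring.
  have E2 : px i' 5 m' 0 = xt i' + (1 - m') * (q - xt i') by rewrite /px /mid /NX /=; ring.
  have E3 : xt i' = - xs i by rewrite /xt /xs se -st; ring.
  have p1 : 0 <= m * (q - xs i) by rewrite mulr_ge0 // subr_ge0 ltW.
  have p2 : 0 < (1 - m') * (q - xt i') by apply: mulr_gt0; rewrite subr_gt0.
  move: ex p1 p2; rewrite E1 E2 E3 opprD opprK => /addrI ->.
  by rewrite oppr_ge0 leNgt => /negbTE ->.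
case: hr => hr; case: hr' => hr'; rewrite hr hr' in zE x1.
- have : j = j' by apply: s_inj; move: zE; rewrite /pz /mid /NZ /=; lra.
  by move=> e; rewrite e eqxx in pjj.
- apply: (H j j' l l') => //; move: zE; rewrite /pz /mid /NZ /=; lra.
- apply: (H j' j l' l) => //.
  + by rewrite suE opprK.
  + by move: zE; rewrite /pz /mid /NZ /=; lra.
  + by rewrite x1 opprK.
- have : nx j = nx j' by apply: s_inj; rewrite -!tE; move: zE; rewrite /pz /mid /NZ /=; lra.
  by move=> /nx_inj e; rewrite e eqxx in pjj.
Qed.

(** In the centre the core keeps its sideways coordinate, and for perpendicular pages this
    coordinate is x in the other frame up to sign; x is strictly monotone along a panel. *)
Lemma core_meet_uniq j j' r r' l l' m m' : pg j != pg j' -> (r < 6)%N -> (r' < 6)%N ->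
  0 <= l < 1 -> 0 <= l' < 1 -> 0 <= m < 1 -> 0 <= m' < 1 ->
  pt j r l 0 = pt j' r' l' 0 -> pt j r m 0 = pt j' r' m' 0 -> l = m.
Proof.
move=> pjj r6 r6' l01 l01' m01 m01' El Em.
have [opp hr hr' _ _] := core_diff_page pjj r6 r6' l01 l01' El.
have [e1 e2] := pt_eqP El; have [f1 f2] := pt_eqP Em.
have [[op _ _ _ _]|[_ d1 y1 _]] := frame_diff pjj e1 e2; first by rewrite op eqxx in opp.
have [[op _ _ _ _]|[_ _ y2 _]] := frame_diff pjj f1 f2; first by rewrite op eqxx in opp.
have yc : py j' r' l' 0 = py j' r' m' 0 by case: hr' => ->; rewrite /py /mid /NY /=; ring.
have dn : - det (pg j) (pg j') != 0 by rewrite oppr_eq0 -normr_eq0 d1 oner_eq0.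
have : px j r l 0 = px j r m 0 by apply: (mulfI dn); rewrite -y1 -y2.
have [sq tq] := xs_lt_q j.
case: hr => ->; rewrite /px /mid /NX /= !mulr0 ?addr0 ?subr0 => E.
  have /eqP : (l - m) * (q - xs j) = 0 by lra.
  by rewrite mulf_eq0 !subr_eq0 (gt_eqF sq) orbF => /eqP.
have /eqP : (l - m) * (xt j - q) = 0 by lra.
by rewrite mulf_eq0 !subr_eq0 (lt_eqF tq) orbF => /eqP.
Qed.

(** * The panels as rigid pieces of strips *)

Hypothesis tilt_len_big : forall j, 2 * T ^+ 2 * w < eta * `|t j - s j| * (1 - T ^+ 2).

(* (- tcos, tsin j) and (tcos, tsin j) are the directions of the core in the two middle
   panels of the tip; PD and PN are the frames of the panels in page coordinates. *)
Definition tcos : R := (1 - T ^+ 2) / (1 + T ^+ 2).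
Definition tsin j : R := 2 * tilt j / (1 + T ^+ 2).

Definition PD j r : R * R :=
  nth 0 [:: (1, 0); (1, 0); (- tcos, tsin j); (tcos, tsin j); (-1, 0); (-1, 0)] r.
Definition PN j r : R * R :=
  nth 0 [:: (0, 1); (0, 1); (tsin j, tcos); (- tsin j, tcos); (0, 1); (0, 1)] r.
Definition Pslope j r : R :=
  nth 0 [:: c0 j; 0; tilt j; 2 * tilt j / (1 - T ^+ 2); tilt j; 0; c6 j] r.
Definition Plen j r : R :=
  nth 0 [:: q - xs j; X j - q; tilt_len j; tilt_len j; X j - q; q - xt j] r.

Let T2 : T ^+ 2 < 1. Proof. by rewrite expr_lt1 // ltW. Qed.
Let T2ge := sqr_ge0 T.
Let tilt2 j : tilt j ^+ 2 = T ^+ 2.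
Proof. by rewrite -[LHS]real_normK ?num_real // tilt_norm. Qed.

(** This computes the starting crease of a panel from the frame of the panel, and [node_next] does
    so for its final crease. Together they show that the explicitly given quadrilateral is a rigid
    image of a piece of the strip. *)
Lemma node_line j a r : (r < 6)%N ->
  NX j a r = NX j 0 r + Pslope j r * a * (PD j r).1 + a * (PN j r).1 /\
  NY j a r = NY j 0 r + Pslope j r * a * (PD j r).2 + a * (PN j r).2.
Proof.
have h1 : 1 + T ^+ 2 != 0 by rewrite gt_eqF // ltr_wpDr.
have h2 : 1 - T ^+ 2 != 0 by rewrite gt_eqF // subr_gt0.
have t2 := tilt2 j; have [T20 T21] := (T2, T2ge).
case: r => [|[|[|[|[|[|//]]]]]] _; rewrite /NX /NY /Pslope /PD /PN /= /tcos /tsin /kap;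
 move: (tilt j) t2 => x t2; split; try ring; rewrite -t2 in h1 h2 *; by field; rewrite ?h1 ?h2.
Qed.

Let setbackE j : setback j = tilt_len j * tcos.
Proof.
have h1 : 1 + T ^+ 2 != 0 by rewrite gt_eqF // ltr_wpDr.
by rewrite /setback /tilt_len /tcos; field; rewrite h1 gt_eqF.
Qed.

Let yt_tilt j : yt j = ys j + 2 * (tsin j * tilt_len j).
Proof.
have h1 : 1 + T ^+ 2 != 0 by rewrite gt_eqF // ltr_wpDr.
have -> : yt j = ys j + eta * sv (pg j) * (t j - s j) by rewrite /yt /ys; ring.
rewrite updn_sub /tsin /tilt_len /rise /tilt; field; by rewrite h1 gt_eqF.
Qed.

Lemma node_next j a r : (r < 6)%N ->
  NX j a r.+1 = NX j 0 r + (Plen j r + Pslope j r.+1 * a) * (PD j r).1 + a * (PN j r).1 /\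
  NY j a r.+1 = NY j 0 r + (Plen j r + Pslope j r.+1 * a) * (PD j r).2 + a * (PN j r).2.
Proof.
have h1 : 1 + T ^+ 2 != 0 by rewrite gt_eqF // ltr_wpDr.
have h2 : 1 - T ^+ 2 != 0 by rewrite gt_eqF // subr_gt0.
have t2 := tilt2 j; have [T20 T21] := (T2, T2ge).
have sE := setbackE j; have yE := yt_tilt j.
case: r => [|[|[|[|[|[|//]]]]]] _; rewrite /NX /NY /Pslope /Plen /PD /PN /= ?sE ?yE; clear sE yE;
  rewrite /tsin /tcos /kap; move: (tilt j) (tilt_len j) t2 => x y t2; split; try ring;
  rewrite -t2 in h1 h2 *; by field; rewrite ?h1 ?h2.
Qed.

(** Passing straight into the opposite page, the frame makes a half turn while the strip keeps its
    direction, so the transverse coordinate changes sign. Across a diagonal fold it does not. *)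
Definition corner_sign j : R := (-1) ^+ (c6 j == 0).

Lemma node_corner j a : page_frame (pg j) (NX j a 6, NY j a 6) =
  page_frame (pg (nx j)) (NX (nx j) (corner_sign j * a) 0, NY (nx j) (corner_sign j * a) 0).
Proof.
rewrite /NX /NY /= /corner_sign /c0 /c6 invF_f /xt /yt /xs /ys tE /page_frame /=.
have := pg_nx j; move: (pg j) (pg (nx j)); apply: dirP; apply: dirP => //= _;
  rewrite /det /su /sv /dir /= ?mulr0 ?mul0r ?mulr1 ?mul1r ?subr0 ?addr0 ?sub0r ?add0r ?oppr0 ?mulN1r ?opprK ?eqxx
   ?oppr_eq0 ?oner_eq0 ?expr0 ?expr1 ?mul1r ?mulN1r; apply: (f_equal2 pair); ring.
Qed.

Let B := (J * 'I_6)%type.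

Definition next_panel (b : B) : B := if (b.2 < 5)%N then (b.1, inord b.2.+1) else (nx b.1, ord0).

Variant next_panel_spec (b : B) : B -> Prop :=
  | NextSame (r : 'I_6) of (b.2 < 5)%N & r = b.2.+1 :> nat : next_panel_spec b (b.1, r)
  | NextArc of b.2 = 5 :> nat : next_panel_spec b (nx b.1, ord0).

Lemma next_panelP b : next_panel_spec b (next_panel b).
Proof.
rewrite /next_panel; case: ltnP => h; first by constructor; rewrite // inordK.
by constructor; apply/eqP; rewrite eqn_leq h -ltnS ltn_ord.
Qed.

Lemma next_panel_inj : injective next_panel.
Proof.
move=> [j r] [j' r']; case: next_panelP => /= [x x5 xE|r5]; case: next_panelP => /= [y y5 yE|r5'].
- by move=> [-> xy]; congr pair; apply/val_inj/succn_inj; rewrite -xE -yE xy.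
- by move=> [_ xy]; rewrite xy in xE.
- by move=> [_ xy]; rewrite -xy in yE.
- by move=> [/nx_inj ->]; congr pair; apply/val_inj; rewrite /= r5 r5'.
Qed.

Definition panel_origin (b : B) := page_frame (pg b.1) (NX b.1 0 b.2, NY b.1 0 b.2).
Definition panel_dir (b : B) := page_frame (pg b.1) (PD b.1 b.2).
Definition panel_normal (b : B) := page_frame (pg b.1) (PN b.1 b.2).
Definition panel_len (b : B) := Plen b.1 b.2.
Definition panel_slope (b : B) := Pslope b.1 b.2.
Definition panel_level (b : B) := NH b.1 b.2.
Definition panel_flip (b : B) := (b.2 == 5 :> nat) && (c6 b.1 == 0).

Lemma next_slope (b : B) : (-1) ^+ panel_flip b * panel_slope (next_panel b) = Pslope b.1 b.2.+1.
Proof.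
rewrite /panel_slope /panel_flip; case: next_panelP => /= [r r5 rE|r5].
  by rewrite ltn_eqF // expr0 mul1r rE.
rewrite r5 eqxx /Pslope /= /c0 invF_f -/(c6 b.1).
have [->|] := eqVneq (c6 b.1) 0; first by rewrite mulr0.
by rewrite expr0 mul1r.
Qed.

Lemma next_level (b : B) : panel_level (next_panel b) = NH b.1 b.2.+1.
Proof.
rewrite /panel_level; case: next_panelP => /= [r r5 rE|r5]; first by rewrite rE.
by rewrite r5 /NH /= tE.
Qed.

Lemma next_node (b : B) a : page_frame (pg b.1) (NX b.1 a b.2.+1, NY b.1 a b.2.+1) =
  page_frame (pg (next_panel b).1) (NX (next_panel b).1 ((-1) ^+ panel_flip b * a) (next_panel b).2,
    NY (next_panel b).1 ((-1) ^+ panel_flip b * a) (next_panel b).2).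
Proof.
rewrite /panel_flip; case: next_panelP => /= [r r5 rE|r5].
  by rewrite ltn_eqF // expr0 mul1r rE.
by rewrite r5 eqxx /= node_corner.
Qed.

Lemma next_origin (b : B) : panel_origin (next_panel b) =
  ((panel_origin b).1 + panel_len b * (panel_dir b).1,
   (panel_origin b).2 + panel_len b * (panel_dir b).2).
Proof.
have := next_node b 0; rewrite mulr0 => e; rewrite [LHS]/panel_origin -e.
have [-> ->] := node_next b.1 0 (ltn_ord b.2).
by rewrite /panel_origin /panel_dir /panel_len /page_frame /=; apply: (f_equal2 pair); ring.
Qed.

Lemma next_corner (b : B) : let eps := (-1) ^+ panel_flip b in
  eps * panel_slope (next_panel b) * (panel_dir b).1 + (panel_normal b).1 =
  eps * (panel_slope (next_panel b) * (panel_dir (next_panel b)).1 + (panel_normal (next_panel b)).1) /\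
  eps * panel_slope (next_panel b) * (panel_dir b).2 + (panel_normal b).2 =
  eps * (panel_slope (next_panel b) * (panel_dir (next_panel b)).2 + (panel_normal (next_panel b)).2).
Proof.
move=> eps; have := next_node b 1; have := next_node b 0.
rewrite mulr0 mulr1 -/eps.
have [e1 e2] := node_next b.1 1 (ltn_ord b.2).
have [f1 f2] := node_next b.1 0 (ltn_ord b.2).
have [g1 g2] := node_line (next_panel b).1 eps (ltn_ord (next_panel b).2).
rewrite e1 e2 f1 f2 g1 g2 next_slope /panel_dir /panel_normal /panel_slope /page_frame /=.
move=> /(proj1 (pair_equal_spec _ _ _ _))[h1 h2] /(proj1 (pair_equal_spec _ _ _ _))[h3 h4].
by split; lra.
Qed.

Lemma panel_pointE (b : B) l a : panel_point next_panel panel_origin panel_dir panel_normal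
  panel_len panel_slope panel_flip b l a = pt b.1 b.2 l a.
Proof.
rewrite /panel_point /panel_gap next_slope /pt /px /py.
have [e1 e2] := node_next b.1 a (ltn_ord b.2).
have [g1 g2] := node_line b.1 a (ltn_ord b.2).
rewrite e1 e2 g1 g2 /panel_origin /panel_dir /panel_normal /panel_slope /panel_len /page_frame /mid /=.
by apply: (f_equal2 pair); ring.
Qed.

Lemma panel_levelE (b : B) l : mid l (panel_level b) (panel_level (next_panel b)) = ph b.1 b.2 l.
Proof. by rewrite next_level. Qed.

Lemma panel_frame (b : B) : [/\ (panel_dir b).1 ^+ 2 + (panel_dir b).2 ^+ 2 = 1,
  (panel_normal b).1 ^+ 2 + (panel_normal b).2 ^+ 2 = 1 &
  (panel_dir b).1 * (panel_normal b).1 + (panel_dir b).2 * (panel_normal b).2 = 0].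
Proof.
have cs : tcos ^+ 2 + tsin b.1 ^+ 2 = 1.
  have h1 : 1 + T ^+ 2 != 0 by rewrite gt_eqF // ltr_wpDr.
  rewrite [X in _ + X](_ : _ = 4 * tilt b.1 ^+ 2 / (1 + T ^+ 2) ^+ 2); last by rewrite /tsin; field.
  by rewrite tilt2 /tcos; field.
have [d1 n1 dn] : [/\ (PD b.1 b.2).1 ^+ 2 + (PD b.1 b.2).2 ^+ 2 = 1,
  (PN b.1 b.2).1 ^+ 2 + (PN b.1 b.2).2 ^+ 2 = 1 &
  (PD b.1 b.2).1 * (PN b.1 b.2).1 + (PD b.1 b.2).2 * (PN b.1 b.2).2 = 0].
  case: b.2 => [[|[|[|[|[|[|//]]]]]] /= _]; rewrite /PD /PN /= ?sqrrN; split; try ring; lra.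
have u1 : (dir (pg b.1)).1 ^+ 2 + (dir (pg b.1)).2 ^+ 2 = 1 :> R.
  by move: (pg b.1); apply: dirP; rewrite /dir /=; ring.
rewrite /panel_dir /panel_normal /page_frame /=.
move: (PD _ _) (PN _ _) (dir _) d1 n1 dn u1 => [x y] [x' y'] [c d] /= d1 n1 dn u1.
split.
- rewrite [LHS](_ : _ = (x ^+ 2 + y ^+ 2) * (c ^+ 2 + d ^+ 2)); last by ring.
  by rewrite d1 u1 mulr1.
- rewrite [LHS](_ : _ = (x' ^+ 2 + y' ^+ 2) * (c ^+ 2 + d ^+ 2)); last by ring.
  by rewrite n1 u1 mulr1.
- rewrite [LHS](_ : _ = (x * x' + y * y') * (c ^+ 2 + d ^+ 2)); last by ring.
  by rewrite dn mul0r.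
Qed.

Lemma panel_gap_gt0 (b : B) a : `|a| <= w / 2 ->
  0 < panel_gap next_panel panel_len panel_slope panel_flip b a.
Proof.
move=> aw; rewrite /panel_gap next_slope /panel_len /panel_slope.
have [h1 h2 _ _] := nodes_bound b.1; have hq := half_w_lt_q; have [_ _ h3 _] := nodes_bound b.1.
have [hX _] := X_big b.1.
have ta := tilt_bound b.1 aw.
have : `|c0 b.1 * a| <= w / 2 /\ `|c6 b.1 * a| <= w / 2.
  by split; apply: slope_bound => //; rewrite /c0 /c6 det_bound.
move: h1 h3 ta; rewrite !ler_norml => /andP[? ?] /andP[? ?] /andP[? ?] [/andP[? ?] /andP[? ?]].
(* The tip panels are the delicate ones: their creases have different slopes, which costs up to k T
   w / 2 of their length. [tilt_len_big] is this bound rewritten; the second tip panel is the first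
   one with [a] negated. *)
have tl : forall c : R, `|c| <= w / 2 -> 0 < tilt_len b.1 + (2 * tilt b.1 / (1 - T ^+ 2) - tilt b.1) * c.
  move=> c cw; set k := (1 + T ^+ 2) / (1 - T ^+ 2).
  have k0 : 0 < k by rewrite divr_gt0 ?subr_gt0 ?T2 // ltr_wpDr.
  have T0 : T != 0 by rewrite gt_eqF.
  have n2 : 1 - T ^+ 2 != 0 by rewrite gt_eqF // subr_gt0 T2.
  have e1 : (2 * tilt b.1 / (1 - T ^+ 2) - tilt b.1) * c = k * (tilt b.1 * c) by rewrite /k; field.
  have e2 : tilt_len b.1 = k / (4 * T) * (eta * `|t b.1 - s b.1| * (1 - T ^+ 2)).
    by rewrite /tilt_len /rise /k; field; rewrite T0.
  have e3 : k * (T * (w / 2)) = k / (4 * T) * (2 * T ^+ 2 * w) by field.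
  have := tilt_bound b.1 cw; rewrite ler_norml => /andP[n3 _].
  have : - (k * (T * (w / 2))) <= k * (tilt b.1 * c) by rewrite -mulrN ler_pM2l.
  have : k * (T * (w / 2)) < tilt_len b.1.
    by rewrite e3 e2 ltr_pM2l ?tilt_len_big // divr_gt0 // mulr_gt0.
  by rewrite e1; lra.
have tl1 := tl _ aw; have := tl (- a); rewrite normrN => /(_ aw) tl2.
by case: b.2 => [[|[|[|[|[|[|//]]]]]] /= _]; rewrite /Plen /Pslope /=; lra.
Qed.

Lemma arcs_ribbon : exists k (S : 'I_k -> folded_strip R),
  [/\ forall i, flat_folded w (S i), layered w S, regular_core S,
    core_link S = [set p | exists j r l, [/\ (r < 6)%N, 0 <= l < 1 & p = (pt j r l 0, ph j r l)]] &
    ribbon_length S = \sum_j (2 * X j - xs j - xt j + 2 * tilt_len j)].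
Proof.
have inj (b b' : B) l l' a a' : 0 <= l < 1 -> 0 <= l' < 1 -> `|a| <= w / 2 -> `|a'| <= w / 2 ->
    panel_point next_panel panel_origin panel_dir panel_normal panel_len panel_slope panel_flip b l a =
    panel_point next_panel panel_origin panel_dir panel_normal panel_len panel_slope panel_flip b' l' a' ->
    mid l (panel_level b) (panel_level (next_panel b)) =
    mid l' (panel_level b') (panel_level (next_panel b')) -> [/\ b = b', l = l' & a = a'].
  move=> l01 l01' aw aw'; rewrite !panel_pointE !panel_levelE => e h.
  have [j1 r1 -> ->] := patch_inj (ltn_ord b.2) (ltn_ord b'.2) l01 l01' aw aw' e h.
  by split=> //; rewrite (surjective_pairing b) (surjective_pairing b') j1 (val_inj r1).
have meet (b b' : B) l l' : 0 <= l < 1 -> 0 <= l' < 1 ->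
    panel_point next_panel panel_origin panel_dir panel_normal panel_len panel_slope panel_flip b l 0 =
    panel_point next_panel panel_origin panel_dir panel_normal panel_len panel_slope panel_flip b' l' 0 ->
    b = b' /\ l = l' \/ [/\ odd (pg b.1) <> odd (pg b'.1), 0 < l & 0 < l'].
  move=> l01 l01'; rewrite !panel_pointE => e.
  have [pp|pp] := eqVneq (pg b.1) (pg b'.1).
    have [j1 rl] := core_same_page pp (ltn_ord b.2) (ltn_ord b'.2) (lt1W l01) (lt1W l01') e.
    have [r1 ll] := nat_frac_inj l01 l01' rl; left; split=> //.
    by rewrite (surjective_pairing b) (surjective_pairing b') j1 (val_inj r1).
  by have [/eqP ? _ _ ? ?] := core_diff_page pp (ltn_ord b.2) (ltn_ord b'.2) l01 l01' e; right.
have uniq (b b' : B) l l' u u' : 0 <= l < 1 -> 0 <= l' < 1 -> 0 <= u < 1 -> 0 <= u' < 1 ->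
    odd (pg b.1) <> odd (pg b'.1) ->
    panel_point next_panel panel_origin panel_dir panel_normal panel_len panel_slope panel_flip b l 0 =
    panel_point next_panel panel_origin panel_dir panel_normal panel_len panel_slope panel_flip b' l' 0 ->
    panel_point next_panel panel_origin panel_dir panel_normal panel_len panel_slope panel_flip b u 0 =
    panel_point next_panel panel_origin panel_dir panel_normal panel_len panel_slope panel_flip b' u' 0 ->
    l = u /\ l' = u'.
  move=> l01 l01' u01 u01' op; rewrite !panel_pointE => e f.
  have pp : pg b.1 != pg b'.1 by apply/eqP => pp; apply: op; rewrite pp.
  have pp' : pg b'.1 != pg b.1 by rewrite eq_sym.
  split; first exact: core_meet_uniq pp (ltn_ord b.2) (ltn_ord b'.2) l01 l01' u01 u01' e f.
  exact: core_meet_uniq pp' (ltn_ord b'.2) (ltn_ord b.2) l01' l01 u01' u01 (esym e) (esym f).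
exists #|froots next_panel|, (@component_strips R w B next_panel panel_origin panel_dir panel_normal
  panel_len panel_slope panel_level panel_flip); split.
- by move=> i; exact: (component_flat panel_level w_gt0 next_panel_inj next_origin next_corner panel_frame panel_gap_gt0).
- exact: (component_layered w_gt0 next_panel_inj next_origin next_corner panel_gap_gt0 inj).
- exact: (@component_regular R w B next_panel panel_origin panel_dir panel_normal panel_len
    panel_slope panel_level panel_flip w_gt0 next_panel_inj next_origin next_corner panel_gap_gt0
    (fun b => odd (pg b.1)) meet uniq).
- rewrite (component_core_link panel_level w_gt0 next_panel_inj next_origin next_corner panel_gap_gt0).
  apply/seteqP; split=> p.
    move=> [b [l [l01 ->]]]; exists b.1, b.2, l; split=> //.
    by rewrite panel_pointE panel_levelE.
  move=> [j [r [l [r6 l01 ->]]]]; exists (j, Ordinal r6), l; split=> //.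
  by rewrite panel_pointE panel_levelE.
- rewrite (@component_length R w B next_panel panel_origin panel_dir panel_normal panel_len
    panel_slope panel_level panel_flip next_panel_inj).
  rewrite -(pair_big xpredT xpredT (fun j (r : 'I_6) => Plen j r)) /=.
  apply: eq_bigr => j _; rewrite !big_ord_recl big_ord0 /Plen /=; ring.
Qed.


(** * From the core back to the given arcs *)

Hypothesis eta_small : (#|J|%:R + 1) * (eta * M) <= w / 8.
Variables (xA zA : J -> R -> R).
Hypotheses (cxA : forall j, continuous (xA j)) (czA : forall j, continuous (zA j)).
Hypothesis injA : forall j j' (u u' : R), pg j = pg j' -> u \in `[0, 1] -> u' \in `[0, 1] ->
  xA j u = xA j' u' -> zA j u = zA j' u' -> j = j' /\ u = u'.
Hypothesis xA_ge0 : forall j (u : R), u \in `[0, 1] -> 0 <= xA j u.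
Hypothesis xA_eq0 : forall j (u : R), u \in `[0, 1] -> (xA j u = 0 <-> u = 0 \/ u = 1).
Hypotheses (zA0 : forall j, zA j 0 = s j) (zA1 : forall j, zA j 1 = t j).

(* A step function of the height equal to eta * s i near the level s i: the plane
   at that level is translated so that the corner of the core moves to the axis. *)
Definition level_shift (z : R) : R := \sum_i clamp (2 - 4 * `|z - s i| / g) * (eta * s i).

Lemma level_shift_cont : continuous level_shift.
Proof.
move=> z; rewrite /continuous_at /level_shift; apply: cvg_sumr => i; apply: cvgM; last exact: cvg_cst.
apply: (continuous_cvg _ (@clamp_cont _ _)); apply: cvgB; first exact: cvg_cst.
apply: cvgM; last exact: cvg_cst.
by apply: cvgM; [exact: cvg_cst|apply: cvg_norm; cts].
Qed.

(** The plateau of each bump reaches to g / 4, the height spanned by a panel of the centre, and the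
    bump is 0 from g / 2 on, so at levels g apart no two interfere. *)
Lemma level_shift_near i z : `|z - s i| <= g / 4 -> level_shift z = eta * s i.
Proof.
move=> zi; have g0 := g_gt0; rewrite /level_shift (bigD1 i) //= clamp_ge1 ?mul1r.
  rewrite big1 ?addr0 // => k ki; rewrite clamp_le0 ?mul0r // subr_le0 ler_pdivlMr //.
  have := gap ki; have := ler_distD z (s k) (s i); rewrite (distrC (s k) z); lra.
have : 4 * `|z - s i| / g <= 1 by rewrite ler_pdivrMr //; lra.
lra.
Qed.

Lemma level_shift_bound z : `|level_shift z| <= #|J|%:R * (eta * M).
Proof.
rewrite /level_shift; apply: le_trans (ler_norm_sum _ _ _) _.
rewrite -sum1_card natr_sum mulr_suml; apply: ler_sum => i _; rewrite !normrM mul1r.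
have := clamp_in (2 - 4 * `|z - s i| / g); rewrite in_itv /= => /andP[c0' c1].
rewrite (ger0_norm c0') (gtr0_norm eta_gt0) -[leRHS]mul1r; apply: ler_pM => //.
  by rewrite mulr_ge0 // ltW.
by rewrite ler_pM2l.
Qed.

Lemma shear_isotopic : isotopic_to_id (fun p : space3 R => p + ((- level_shift p.2, - level_shift p.2), 0)).
Proof.
have E (r : R) (p : space3 R) : p + r *: ((- level_shift p.2, - level_shift p.2), 0) =
    ((p.1.1 - r * level_shift p.2, p.1.2 - r * level_shift p.2), p.2).
  case: p => [[x y] z]; apply: (f_equal2 pair).
    by apply: (f_equal2 pair); [exact: (f_equal (+%R x) (mulrN r _))|exact: (f_equal (+%R y) (mulrN r _))].
  exact: etrans (f_equal (+%R z) (mulr0 r)) (addr0 z).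
apply: (@isotopic_to_id_straight _ (fun p : space3 R => ((- level_shift p.2, - level_shift p.2), 0))
  (fun r p => ((p.1.1 + r * level_shift p.2, p.1.2 + r * level_shift p.2), p.2))).
  move=> p; have cs : level_shift q.2 @[q --> p] --> level_shift p.2.
    by apply: (continuous_cvg _ (@level_shift_cont _)); cts.
  by rewrite /continuous_at; apply: cvg_space3 => /=; [exact: cvgN|exact: cvgN|exact: cvg_cst].
move=> r _; split.
- move=> p; have cs : level_shift q.2 @[q --> p] --> level_shift p.2.
    by apply: (continuous_cvg _ (@level_shift_cont _)); cts.
  rewrite /continuous_at; apply: cvg_space3 => /=; last by cts.
    by apply: cvgD; [cts|apply: cvgM; [exact: cvg_cst|exact: cs]].
  by apply: cvgD; [cts|apply: cvgM; [exact: cvg_cst|exact: cs]].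
- by move=> p; rewrite E /= !subrK -!surjective_pairing.
- by move=> p; rewrite E /= !addrK -!surjective_pairing.
Qed.

Lemma unit_time (N : nat) (x : R) : (0 < N)%N -> 0 <= x <= N%:R ->
  exists r l, [/\ (r < N)%N, 0 <= l <= 1 & x = r%:R + l].
Proof.
case: N => // N _; elim: N => [|N IH] /andP[x0 x1].
  by exists 0%N, x; rewrite x0 x1 add0r.
have [h|h] := leP x N.+1%:R.
  by have [|r [l [rN l01 xE]]] := IH; [rewrite x0 h|exists r, l; split=> //; exact: ltnW].
exists N.+1, (x - N.+1%:R); split=> //; last by rewrite addrC subrK.
by rewrite subr_ge0 (ltW h) lerBlDl natr1.
Qed.

Let xx j (u : R) : R := plin (V := R^o) (NX j 0) 6 (6 * u).
Let yy j (u : R) : R := plin (V := R^o) (NY j 0) 6 (6 * u).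
Let zB j (u : R) : R := plin (V := R^o) (NH j) 6 (6 * u).
Let xB j u := xx j u - su (pg j) * level_shift (zB j u).
Let yB j u := yy j u - sv (pg j) * level_shift (zB j u).
(** The cut-off w / 4 only keeps the quotient continuous at the axis: the numerator vanishes in the
    centre, and outside the centre the denominator is [xB] itself. *)
Let tB j u := yB j u / Num.max (xB j u) (w / 4).

Let paths_at j u r l : (r < 6)%N -> 0 <= l <= 1 -> 6 * u = r%:R + l ->
  [/\ xx j u = px j r l 0, yy j u = py j r l 0 & zB j u = ph j r l].
Proof.
by move=> r6 l01 uE; rewrite /xx /yy /zB uE !plin_seg.
Qed.

Let plin_cont6 (v : nat -> R) : continuous (fun u : R => plin (V := R^o) v 6 (6 * u)).
Proof. by move=> u; apply: (continuous_cvg _ (@plin_cont R R^o v 6 _)); cts. Qed.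
Let czB j : continuous (zB j). Proof. exact: plin_cont6. Qed.
Let csB j u : level_shift (zB j x) @[x --> u] --> level_shift (zB j u).
Proof. exact: (continuous_cvg _ (@level_shift_cont _) (@czB j u)). Qed.
Let cxB j : continuous (xB j).
Proof.
by move=> u; apply: cvgB; [exact: plin_cont6|apply: cvgM; [exact: cvg_cst|exact: csB]].
Qed.
Let cyB j : continuous (yB j).
Proof.
by move=> u; apply: cvgB; [exact: plin_cont6|apply: cvgM; [exact: cvg_cst|exact: csB]].
Qed.
Let ctB j : continuous (tB j).
Proof.
move=> u; have w0 := w_gt0; apply: cvg_div; last by apply: cvg_maxr; [exact: cxB|exact: cvg_cst].
  by rewrite gt_eqF // lt_max divr_gt0 ?orbT.
exact: cyB.
Qed.

Let time6 (u : R) : u \in `[0, 1] -> exists r l, [/\ (r < 6)%N, 0 <= l <= 1 & 6 * u = r%:R + l].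
Proof.
rewrite in_itv /= => /andP[u0 u1]; apply: unit_time => //.
by rewrite mulr_ge0 //= -[leRHS]mulr1 ler_pM2l.
Qed.

Let M_ge0 (j : J) : 0 <= M. Proof. exact: le_trans (normr_ge0 _) (s_bound j). Qed.

Let path_center j u r l : r = 0%N \/ r = 5%N -> 0 <= l <= 1 -> 6 * u = r%:R + l ->
  xB j u = (if r == 0%N then l * (q - xs j) else (1 - l) * (q - xt j)) /\ yB j u = 0.
Proof.
move=> hr l01 uE; have r6 : (r < 6)%N by case: hr => ->.
have [xE yE zE] := paths_at j r6 l01 uE; rewrite /xB /yB xE yE zE; have /andP[l0 l1] := l01.
have g0 := g_gt0; have g4 : 0 <= g / 4 by lra.
case: hr => ->.
  rewrite ph_start (@level_shift_near j); last first.
    by rewrite addrC addKr normrM (ger0_norm l0) (ger0_norm g4) -[leRHS]mul1r ler_wpM2r.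
  by rewrite /px /py /NX /NY /mid /xs /ys /=; split; ring.
rewrite ph_end (@level_shift_near (nx j)); last first.
  rewrite tE addrC addKr normrN normrM (ger0_norm g4) -[leRHS]mul1r ler_wpM2r //.
  by rewrite ger0_norm ?subr_ge0 // lerBlDr lerDl.
by rewrite -tE /px /py /NX /NY /mid /xt /yt /=; split; ring.
Qed.

(** The slope of the core is at most 1 / 2 as a result, so the core lies inside the wedge of its
    page; [eta_small] bounds both the sideways coordinate and the shear. *)
Let path_tip j u r l : (1 <= r <= 4)%N -> 0 <= l <= 1 -> 6 * u = r%:R + l ->
  w / 4 < xB j u /\ `|yB j u| <= w / 8.
Proof.
move=> hr l01 uE; have r6 : (r < 6)%N by case/andP: hr => _ h; apply: leq_ltn_trans h _.
have [xE yE zE] := paths_at j r6 l01 uE; rewrite /xB /yB xE yE zE.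
have w0 := w_gt0; have M0 : 0 <= eta * M by rewrite mulr_ge0 ?(M_ge0 j) // ltW.
have nM : 0 <= #|J|%:R * (eta * M) by rewrite mulr_ge0.
have es : #|J|%:R * (eta * M) + eta * M <= w / 8 by rewrite -[X in _ + X]mul1r -mulrDl.
have [s1 s2] := suv_norm (pg j); have hb := level_shift_bound (ph j r l).
have sb (c : R) : `|c| = 1 -> `|c * level_shift (ph j r l)| <= #|J|%:R * (eta * M).
  by move=> c1; rewrite normrM c1 mul1r.
split.
  have [px1 _] := px_tip j hr l01 (zero_half); have hq := half_w_lt_q.
  by have := sb _ s1; rewrite ler_norml => /andP[_ ?]; lra.
rewrite py_core //; have /andP[z1 z2] := pz_range j r6 l01.
have pzM : `|pz j r l| <= M.
  have := s_bound j; have := t_bound j; rewrite !ler_norml => /andP[? ?] /andP[? ?].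
  apply/andP; split.
    by apply: le_trans z1; rewrite /lo le_min; apply/andP.
  by apply: le_trans z2 _; rewrite /hi ge_max; apply/andP.
have -> : eta * sv (pg j) * pz j r l = sv (pg j) * (eta * pz j r l) by ring.
apply: le_trans (ler_normB _ _) _; rewrite normrM s2 mul1r normrM (gtr0_norm eta_gt0).
have := sb _ s2; have : eta * `|pz j r l| <= eta * M by rewrite ler_pM2l.
lra.
Qed.

Let path_facts j (u : R) : u \in `[0, 1] ->
  [/\ 0 <= xB j u, xB j u = 0 <-> u = 0 \/ u = 1, `|tB j u| <= 1 / 2 & tB j u * xB j u = yB j u].
Proof.
move=> u01; have [r [l [r6 l01 uE]]] := time6 u01; have w0 := w_gt0.
have [hx0 hx1] := xs_lt_q j; have /andP[l0 l1] := l01.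
have [hr|hr] := panel_cases r6.
  have [xE yE] := path_center j hr l01 uE; rewrite /tB yE !mul0r normr0; split=> //.
  - by rewrite xE; case: ifP => _; rewrite mulr_ge0 ?subr_ge0 // ltW.
  - rewrite xE; case: hr uE => -> /= uE; split.
    + move/eqP; rewrite mulf_eq0 [_ - _ == 0]subr_eq0 (gt_eqF hx0) orbF => /eqP l0'; left.
      by apply: (@mulfI _ 6); rewrite ?pnatr_eq0 // uE l0' mulr0 addr0.
    + move=> uu; have -> : l = 0 by case: uu => uu; rewrite uu in uE; lra.
      by rewrite mul0r.
    + move/eqP; rewrite mulf_eq0 [_ - xt j == 0]subr_eq0 (gt_eqF hx1) orbF subr_eq0 => /eqP l0'; right.
      by apply: (@mulfI _ 6); rewrite ?pnatr_eq0 // uE -l0'; ring.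
    + move=> uu; have -> : l = 1 by case: uu => uu; rewrite uu in uE; lra.
      by rewrite subrr mul0r.
have [x1 y1] := path_tip j hr l01 uE.
have x0 : 0 < xB j u by apply: lt_trans x1; rewrite divr_gt0.
have mx : Num.max (xB j u) (w / 4) = xB j u by rewrite max_l // ltW.
rewrite /tB mx divfK ?gt_eqF //; split=> //; first exact: ltW.
  split=> [e|]; first by rewrite e ltxx in x0.
  have r1 : 1 <= r%:R :> R by rewrite ler1n; case/andP: hr.
  have r4 : r%:R <= 4 :> R by rewrite (ler_nat _ r 4); case/andP: hr.
  by case=> uu; rewrite uu in uE; lra.
rewrite normrM normfV (gtr0_norm x0) ler_pdivrMr //; lra.
Qed.

(** The shear depends on the height alone, so it cancels between points of equal height and the
    separation of the unsheared strips applies. *)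
Let injB j j' (u u' : R) : pg j = pg j' -> u \in `[0, 1] -> u' \in `[0, 1] ->
  xB j u = xB j' u' -> zB j u = zB j' u' -> j = j' /\ u = u'.
Proof.
move=> pp u01 u01'; have [r [l [r6 l01 uE]]] := time6 u01; have [r' [l' [r6' l01' uE']]] := time6 u01'.
have [xE _ zE] := paths_at j r6 l01 uE; have [xE' _ zE'] := paths_at j' r6' l01' uE'.
rewrite /xB => e ez; rewrite ez pp in e; move/addIr: e; rewrite xE xE' => e.
have w0 := zero_half; rewrite zE zE' in ez.
have [jj ll] := same_page_inj pp r6 r6' l01 l01' w0 w0 e ez; split=> //.
by apply: (@mulfI _ 6); rewrite ?pnatr_eq0 // uE uE'.
Qed.

Lemma core_isotopic :
  ambient_isotopic [set p | exists j r l, [/\ (r < 6)%N, 0 <= l < 1 & p = (pt j r l 0, ph j r l)]]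
    [set p | exists j (u : R), u \in `[0, 1] /\ p = (page_frame (pg j) (xA j u, 0), zA j u)].
Proof.
have zB0 j : zB j 0 = zA j 0.
  have [||_ _ ->] := @paths_at j 0 0 0 isT; rewrite ?lexx ?ler01 ?mulr0 ?addr0 //.
  by rewrite ph_start mul0r addr0 zA0.
have zB1 j : zB j 1 = zA j 1.
  have [||_ _ ->] := @paths_at j 1 5 1 isT; rewrite ?lexx ?ler01 //; first by ring.
  by rewrite ph_end subrr mul0r subr0 zA1.
have half0 : 0 < 1 / 2 :> R by lra.
have half1 : 1 / 2 < 1 :> R by lra.
have [f [fi fE]] := @wedges_isotopy R J pg xB zB tB xA zA (1 / 2) cxB czB ctB cxA czA injB injA
  (fun j u u01 => let: And4 h _ _ _ := path_facts j u01 in h) xA_ge0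
  (fun j u u01 => let: And4 _ h _ _ := path_facts j u01 in h) xA_eq0
  zB0 zB1 half0 half1 (fun j u u01 => let: And4 _ _ h _ := path_facts j u01 in h).
set C := [set p | _]; set A := [set p | _].
apply/ambient_isotopicE; exists (f \o (fun p : space3 R => p + ((- level_shift p.2, - level_shift p.2), 0))).
  exact: isotopic_to_id_comp shear_isotopic fi.
have page_frame_shift p (x y z : R) : page_frame p (x, y) + (- z, - z) = page_frame p (x - su p * z, y - sv p * z).
  by move: p; apply: dirP; rewrite /page_frame /su /sv /dir /=; apply: (f_equal2 pair) => /=; ring.
have image j r l : (r < 6)%N -> 0 <= l <= 1 ->
    f ((pt j r l 0, ph j r l) + ((- level_shift (ph j r l), - level_shift (ph j r l)), 0)) =
    (page_frame (pg j) (xA j ((r%:R + l) / 6), 0), zA j ((r%:R + l) / 6)).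
  move=> r6 l01; set u := (r%:R + l) / 6.
  have uE : 6 * u = r%:R + l by rewrite mulrC divfK.
  have u01 : u \in `[0, 1].
    have r5 : r%:R <= 5 :> R by rewrite (ler_nat _ r 5).
    by move: l01 => /andP[? ?]; rewrite in_itv /= divr_ge0 ?addr_ge0 // ler_pdivrMr //; lra.
  have [xE yE zE] := paths_at j r6 l01 uE; have [_ _ _ ty] := path_facts j u01.
  rewrite -fE // ty /xB /yB xE yE zE; congr f; apply: (f_equal2 pair); last by rewrite /= addr0.
  exact: page_frame_shift.
apply/seteqP; split=> [_ [_ [j [r [l [r6 l01 ->]]]] <-]|_ [j [u [u01 ->]]]].
  have l01' := lt1W l01; exists j, ((r%:R + l) / 6); split; last exact: image.
  have r5 : r%:R <= 5 :> R by rewrite (ler_nat _ r 5).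
  by move: l01' => /andP[? ?]; rewrite in_itv /= divr_ge0 ?addr_ge0 // ler_pdivrMr //; lra.
suff [j' [r [l [r6 l01 ->]]]] : exists j' r l, [/\ (r < 6)%N, 0 <= l < 1 &
    (page_frame (pg j) (xA j u, 0), zA j u) =
    (page_frame (pg j') (xA j' ((r%:R + l) / 6), 0), zA j' ((r%:R + l) / 6))].
  exists (pt j' r l 0, ph j' r l); first by exists j', r, l.
  by apply: image => //; exact: lt1W.
have [r [l [r6 /andP[l0 l1] uE]]] := time6 u01.
have {uE} -> : u = (r%:R + l) / 6 by rewrite -uE mulrC mulKf.
(* The core is described with l < 1, so the end of a panel is taken as the start of the next one,
   possibly on the next arc. *)
have [e|nl1] := eqVneq l 1; last by exists j, r, l; rewrite r6 l0 lt_neqAle nl1.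
have [r5|r5] := ltnP r 5; first by exists j, r.+1, 0; rewrite e addr0 natr1 lexx ltr01.
have -> : r = 5%N by apply/eqP; rewrite eqn_leq r5 -ltnS r6.
exists (nx j), 0%N, 0; rewrite lexx ltr01 e addr0 mul0r; split=> //.
have -> : (5%:R + 1) / 6 = 1 :> R by rewrite natr1 divff // pnatr_eq0.
have h0 : (0 : R) \in `[0, 1] by rewrite in_itv /= lexx ler01.
have h1 : (1 : R) \in `[0, 1] by rewrite in_itv /= lexx ler01.
rewrite zA0 zA1 tE (xA_eq0 j h1).2; last by right.
by rewrite (xA_eq0 (nx j) h0).2; [rewrite /page_frame /= !mul0r subrr addr0|left].
Qed.

End Patches.

(** * Short ribbons *)

Section ShortRibbons.
Context {R : realType}.

Lemma finite_bound (J : finType) (s : J -> R) : exists M, forall j, `|s j| <= M.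
Proof.
exists (\sum_j `|s j|) => j; rewrite (bigD1 j) //= lerDl.
by apply: sumr_ge0.
Qed.

Lemma finite_gap (J : finType) (s : J -> R) : injective s ->
  exists2 g, 0 < g & forall i j, i != j -> g <= `|s i - s j|.
Proof.
move=> s_inj; exists (\big[Num.min/1]_(p : J * J | p.1 != p.2) `|s p.1 - s p.2|).
  elim/big_ind: _ => // [x y x0 y0|p pp]; first by rewrite lt_min x0.
  by rewrite normr_gt0 subr_eq0 (inj_eq s_inj).
by move=> i j ij; rewrite (bigD1 (i, j)) //= ge_min lexx.
Qed.

Lemma small_scale (A B : R) : 0 <= A -> 0 <= B ->
  exists T, [/\ 0 < T, T <= 1 / 2, T * A <= 1 & T * B <= 1].
Proof.
move=> A0 B0; exists (2 + A + B)^-1.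
have h : 0 < 2 + A + B by lra.
split; first by rewrite invr_gt0.
- by rewrite div1r lef_pV2 ?posrE //; lra.
- by rewrite mulrC ler_pdivrMr //; lra.
- by rewrite mulrC ler_pdivrMr //; lra.
Qed.

(** All parameters depend on the single small number [T]. The tips need [eta] of order T ^ 2, and
    the reach [X] is w / 2 plus a term of order T that grows with the length of the level interval,
    because nested arcs have strictly shorter intervals. *)
Lemma ribbon_parameters (J : finType) (s t : J -> R) (g M w e : R) :
  0 < g -> 0 <= M -> 0 < w -> 0 < e ->
  (forall j, `|s j| <= M) -> (forall j, `|t j| <= M) -> (forall j, g <= `|t j - s j|) ->
  exists eta T q (X : J -> R),
  [/\ [/\ 0 < eta, 0 < T, T < 1 & eta * M + kap T * (w / 2) < q],
    forall j, q + T * (w / 2) < X j /\ q < X j - setback s t eta T j,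
    forall i j, `|t j - s j| + g <= `|t i - s i| ->
      X j + T * (w / 2) < X i - setback s t eta T i /\ X j + T * (w / 2) < X i - T * (w / 2),
    (forall j, 2 * T ^+ 2 * w < eta * `|t j - s j| * (1 - T ^+ 2)) /\
    (#|J|%:R + 1) * (eta * M) <= w / 8 &
    \sum_j (2 * X j + 2 * (eta * M) + 2 * tilt_len s t eta T j) <= #|J|%:R * w + e].
Proof.
move=> g0 M_ge0 w_gt0 e_gt0 sM tM ts.
pose m := M / g; have m0 : 0 <= m by rewrite divr_ge0 // ltW.
have mE : M = m * g by rewrite divfK // gt_eqF.
pose n : R := #|J|%:R; have n0 : 0 <= n by rewrite ler0n.
(* Bound for the excess of one arc over w in units of T w: twice the excess of [q], twice the extra
   reach, the tilted panels and the shift at the axis, with the ratio [d] at most 2 m. *)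
pose K : R := 2 * (4 * m + 1) + 4 * (4 * m + 2) * m + 16 * m + 8 * m.
have K0 : 0 <= K by rewrite /K; have mm := mulr_ge0 m0 m0; lra.
have A0 : 0 <= 32 * (n + 1) * m by rewrite mulr_ge0 //; lra.
have B0 : 0 <= n * w * K / e by apply: mulr_ge0; [apply: mulr_ge0 => //; apply: mulr_ge0 => //; exact: ltW|rewrite invr_ge0 ltW].
have [T [T0 T12 TA TB]] := small_scale A0 B0.
have TA' : 32 * T * (n + 1) * m <= 1 by lra.
have TB' : T * (n * w * K) <= e.
  by move: TB; rewrite mulrA ler_pdivrMr // mul1r.
clear A0 B0 TA TB.
(* The factor 8 meets [tilt_len_big] for T <= 1 / 2. In [q], 4 m + 1 absorbs the axis shift and the
   stretching by [kap]; in [X], 4 m + 2 exceeds the largest setback, at most 4 m T w, by more than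
   the half unit taken by the oblique crease. *)
pose eta := 8 * T ^+ 2 * w / g.
pose q := w / 2 + T * w * (4 * m + 1).
pose d j := `|t j - s j| / g.
pose X j := q + T * w * (4 * m + 2) * d j.
have T1 : T < 1 by lra.
have T2 : T ^+ 2 <= T / 2.
  by have : T * T <= T * (1 / 2); [rewrite ler_wpM2l // ltW|rewrite expr2; lra].
have T20 : 0 < T ^+ 2 by rewrite exprn_gt0.
have T21 : 0 < 1 - T ^+ 2 by lra.
have eta0 : 0 < eta by rewrite !mulr_gt0 // ?invr_gt0 ?exprn_gt0.
have etaM : eta * M = 8 * T ^+ 2 * w * m by rewrite /eta mE; field; rewrite gt_eqF.
have Tw0 : 0 < T * w by rewrite mulr_gt0.
have T2w : T ^+ 2 * w <= T * w / 2 by have := ler_wpM2r (ltW w_gt0) T2; lra.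
have T2wm : T ^+ 2 * w * m <= T * w / 2 * m by rewrite ler_wpM2r.
have Twm : 0 <= T * w * m by rewrite mulr_ge0 // ltW.
have q_big : eta * M + kap T * (w / 2) < q.
  have kT : kap T <= 1 + 8 / 3 * T ^+ 2.
    rewrite /kap ler_pdivrMr //.
    by have := ler_wpM2l (ltW T20) (le_trans T2 (ler_wpM2r _ T12 : T * 2^-1 <= _)); lra.
  have := ler_wpM2r (ltW (divr_gt0 w_gt0 (ltr0n _ 2))) kT; rewrite etaM /q; lra.
have dE j : `|t j - s j| = d j * g by rewrite divfK // gt_eqF.
have d1 j : 1 <= d j by rewrite ler_pdivlMr // mul1r.
have d2 j : d j <= 2 * m.
  rewrite ler_pdivrMr // -mulrA -mE.
  by have := ler_normB (t j) (s j); have := sM j; have := tM j; lra.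
have setbackE j : setback s t eta T j = 2 * T * w * d j * (1 - T ^+ 2).
  by rewrite /setback /rise dE /eta; field; rewrite !gt_eqF.
have tiltE j : tilt_len s t eta T j = 2 * T * w * d j * (1 + T ^+ 2).
  by rewrite /tilt_len /rise dE /eta; field; rewrite !gt_eqF.
have Twd j : 0 < T * w * d j by rewrite mulr_gt0 //; apply: lt_le_trans (d1 j).
have setback_lt j : setback s t eta T j < 2 * (T * w * d j).
  have : T * w * d j * (1 - T ^+ 2) < T * w * d j * 1 by rewrite ltr_pM2l //; lra.
  by rewrite setbackE; lra.
have Twmd j : 0 <= T * w * m * d j by rewrite mulr_ge0 // (le_trans ler01).
have Twdg j : T * w <= T * w * d j by rewrite ler_peMr // ltW.
have X_big j : q + T * (w / 2) < X j /\ q < X j - setback s t eta T j.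
  by have := (setback_lt j, Twmd j, Twdg j); rewrite /X => -[[? ?] ?]; split; lra.
have X_nested i j : `|t j - s j| + g <= `|t i - s i| ->
    X j + T * (w / 2) < X i - setback s t eta T i /\ X j + T * (w / 2) < X i - T * (w / 2).
  rewrite !dE -[X in _ + X <= _]mul1r -mulrDl ler_pM2r // => dd.
  have h1 : T * w * (4 * m + 2) * (d j + 1) <= T * w * (4 * m + 2) * d i.
    by rewrite ler_wpM2l // mulr_ge0 ?(ltW Tw0) //; lra.
  have h2 : T * w * d i <= T * w * (2 * m) by rewrite ler_pM2l.
  by have := setback_lt i; rewrite /X => h3; split; lra.
have tlb j : 2 * T ^+ 2 * w < eta * `|t j - s j| * (1 - T ^+ 2).
  have -> : eta * `|t j - s j| * (1 - T ^+ 2) = 8 * (T ^+ 2 * w) * (d j * (1 - T ^+ 2)).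
    by rewrite dE /eta; field; rewrite gt_eqF.
  have p0 : 0 < T ^+ 2 * w by rewrite mulr_gt0.
  have : 1 * (1 - T ^+ 2) <= d j * (1 - T ^+ 2) by rewrite ler_pM2r.
  rewrite mul1r => h; have := ler_wpM2l (ltW p0) h.
  by have := ler_wpM2l (ltW p0) (le_trans T2 (ler_wpM2r _ T12 : T * 2^-1 <= _)); lra.
have small : (#|J|%:R + 1) * (eta * M) <= w / 8.
  rewrite etaM -/n; have h1 : (n + 1) * (T ^+ 2 * w * m) <= (n + 1) * (T * w / 2 * m).
    by rewrite ler_wpM2l //; lra.
  by have := ler_wpM2r (ltW w_gt0) TA'; lra.
exists eta, T, q, X; split=> //.
apply: le_trans (_ : \sum_(j : J) (w + T * w * K) <= _); last first.
  rewrite sumr_const -[_ *+ _]mulr_natl mulrDr lerD2l.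
  by apply: le_trans TB'; rewrite -/n; lra.
apply: ler_sum => j _; rewrite tiltE etaM.
have h1 : T * w * (4 * m + 2) * d j <= T * w * (4 * m + 2) * (2 * m).
  by rewrite ler_wpM2l // mulr_ge0 ?(ltW Tw0) //; lra.
have h2 : T * w * d j <= T * w * (2 * m) by rewrite ler_pM2l.
have h3 : T * w * d j * T ^+ 2 <= T * w * d j * 1 by rewrite ler_pM2l //; lra.
by rewrite /X /q /K; lra.
Qed.

Variables (J : finType) (pg : J -> 'I_4) (s t : J -> R) (nx : J -> J).
Hypothesis nx_inj : injective nx.
Hypothesis tE : forall j, t j = s (nx j).
Hypothesis s_inj : injective s.
Hypothesis pg_nx : forall j, pg (nx j) != pg j.
Hypothesis nested : forall i j, i != j -> pg i = pg j ->
  [\/ hi s t i < lo s t j, hi s t j < lo s t i, lo s t i < lo s t j /\ hi s t j < hi s t i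
    | lo s t j < lo s t i /\ hi s t i < hi s t j].
Variables (xA zA : J -> R -> R).
Hypotheses (cxA : forall j, continuous (xA j)) (czA : forall j, continuous (zA j)).
Hypothesis injA : forall j j' (u u' : R), pg j = pg j' -> u \in `[0, 1] -> u' \in `[0, 1] ->
  xA j u = xA j' u' -> zA j u = zA j' u' -> j = j' /\ u = u'.
Hypothesis xA_ge0 : forall j (u : R), u \in `[0, 1] -> 0 <= xA j u.
Hypothesis xA_eq0 : forall j (u : R), u \in `[0, 1] -> (xA j u = 0 <-> u = 0 \/ u = 1).
Hypotheses (zA0 : forall j, zA j 0 = s j) (zA1 : forall j, zA j 1 = t j).
Variables (w e : R).
Hypotheses (w_gt0 : 0 < w) (e_gt0 : 0 < e).

Lemma short_ribbon : exists k (S : 'I_k -> folded_strip R),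
  [/\ forall i, flat_folded w (S i), layered w S, regular_core S,
    ambient_isotopic (core_link S)
      [set p | exists j (u : R), u \in `[0, 1] /\ p = (page_frame (pg j) (xA j u, 0), zA j u)] &
    ribbon_length S <= #|J|%:R * w + e].
Proof.
have [M0 sM0] := finite_bound s; have [g g0 gap] := finite_gap s_inj.
pose M := `|M0|; have M_ge0 : 0 <= M by exact: normr_ge0.
have sM j : `|s j| <= M by apply: le_trans (sM0 j) (ler_norm _).
have tM j : `|t j| <= M by rewrite tE.
have level_gap i j : s i <> s j -> g <= `|s i - s j|.
  by move=> h; apply: gap; apply/eqP => ij; apply: h; rewrite ij.
have st j : g <= `|t j - s j|.
  by rewrite tE; apply: level_gap => /s_inj h; have := pg_nx j; rewrite h eqxx.
have [eta [T [q [X [[eta0 T0 T1 q_big] X_big X_far [tlb small] total]]]]] :=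
  ribbon_parameters g0 M_ge0 w_gt0 e_gt0 sM tM st.
have X_nested i j : pg i = pg j -> lo s t i < lo s t j -> hi s t j < hi s t i ->
    X j + T * (w / 2) < X i - setback s t eta T i /\ X j + T * (w / 2) < X i - T * (w / 2).
  move=> pij l1 l2; apply: X_far.
  have lev k : exists a b, [/\ lo s t k = s a, hi s t k = s b & `|t k - s k| = hi s t k - lo s t k].
    rewrite /lo /hi; case: ltP => h.
      by exists k, (nx k); rewrite -tE ger0_norm // subr_ge0 ltW.
    by exists (nx k), k; rewrite -tE distrC ger0_norm // subr_ge0.
  have [a [b [a1 b1 i1]]] := lev i; have [a' [b' [a1' b1' j1]]] := lev j.
  have h1 : g <= lo s t j - lo s t i.
    have : g <= `|lo s t j - lo s t i|.
      by rewrite a1 a1'; apply: level_gap; rewrite -a1 -a1' => h; rewrite h ltxx in l1.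
    by rewrite ger0_norm // subr_ge0 ltW.
  have h2 : g <= hi s t i - hi s t j.
    have : g <= `|hi s t i - hi s t j|.
      by rewrite b1 b1'; apply: level_gap; rewrite -b1 -b1' => h; rewrite h ltxx in l2.
    by rewrite ger0_norm // subr_ge0 ltW.
  by rewrite i1 j1; lra.
have [k [S [S1 S2 S3 S4 S5]]] := @arcs_ribbon R J pg s t nx nx_inj tE s_inj pg_nx nested g M w eta T q X
  g0 w_gt0 eta0 T0 T1 gap sM q_big X_big X_nested tlb.
exists k, S; split=> //.
  rewrite S4; exact: (core_isotopic nx_inj tE s_inj pg_nx nested g0 w_gt0 eta0 T0 T1 gap sM q_big X_big X_nested
    small cxA czA injA xA_ge0 xA_eq0 zA0 zA1).
rewrite S5; apply: le_trans total; apply: ler_sum => j _; rewrite lerD2r.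
have [x1 _ x2 _] := nodes_bound pg tE eta0 sM j.
by move: x1 x2; rewrite !ler_norml => /andP[x1 _] /andP[x2 _]; lra.
Qed.

End ShortRibbons.

(** * Ribbons for links presented in the coordinate pages *)

Section PagePaths.
Context {R : realType}.
Notation E3 := (space3 R).

Lemma page_meet (p p' : 'I_4) (q : E3) : p != p' -> page (dir p) q -> page (dir p') q -> axis q.
Proof.
move: q => [[x y] z] pp [r /= r0 [x1 y1]] [r' r'0 /= [x2 y2]]; rewrite /axis /=.
have [] : x = 0 /\ y = 0; last by move=> -> ->.
move: p p' pp x1 y1 x2 y2; apply: dirP; apply: dirP => // _; rewrite /dir /= => x1 y1 x2 y2; split; lra.
Qed.

Lemma page_frame_coord (p : 'I_4) (q : E3) : page (dir p) q ->
  0 <= (page_coord p q.1).1 /\ q = (page_frame p ((page_coord p q.1).1, 0), q.2).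
Proof.
move=> [r r0 qE]; have qt : q.1 = page_frame p (r, 0) by rewrite qE /page_frame /=; apply: (f_equal2 pair); ring.
by rewrite qt page_frameK /= -qt -surjective_pairing.
Qed.

Variables (J : finType) (pg : J -> 'I_4) (L : set E3) (a : J -> R -> E3).
Hypothesis ca : forall j, continuous (a j).
Hypothesis ainj : forall j (t t' : R), t \in `[0, 1] -> t' \in `[0, 1] -> a j t = a j t' -> t = t'.
Hypothesis LE : forall x, L x <-> exists j, exists2 t : R, t \in `[0, 1] & a j t = x.
Hypothesis a_page : forall j (u : R), u \in `[0, 1] -> page (dir (pg j)) (a j u).
Hypothesis a_axis : forall j (u : R), u \in `[0, 1] -> (axis (a j u) <-> u = 0 \/ u = 1).
Hypothesis a_disj : forall i j (u u' : R), pg i = pg j -> u \in `[0, 1] -> u' \in `[0, 1] ->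
  a i u = a j u' -> i = j.
Hypothesis lineL : locally_line L.

Let aint j j' (t t' : R) : t \in `]0, 1[ -> t' \in `[0, 1] -> a j t = a j' t' -> j = j' /\ t = t'.
Proof.
move=> t01 t'01 e; have tc : t \in `[0, 1].
  by move: t01; rewrite !in_itv /= => /andP[/ltW -> /ltW ->].
have [pp|pp] := eqVneq (pg j) (pg j').
  by have jj := a_disj pp tc t'01 e; split=> //; rewrite -jj in e; exact: ainj e.
have /(a_axis _ tc)[] : axis (a j t).
  by apply: page_meet pp _ _; [exact: a_page|rewrite e; exact: a_page].
  by move=> t0; rewrite t0 in_itv /= ltxx in t01.
by move=> t1; rewrite t1 in_itv /= ltxx andbF in t01.
Qed.

Let h0 : (0 : R) \in `[0, 1]. Proof. by rewrite in_itv /= lexx ler01. Qed.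
Let h1 : (1 : R) \in `[0, 1]. Proof. by rewrite in_itv /= lexx ler01. Qed.
Let rev01 (u : R) : u \in `[0, 1] -> 1 - u \in `[0, 1].
Proof. by rewrite !in_itv /= => /andP[? ?]; apply/andP; split; lra. Qed.

(** The pairing of ends orients the arcs, so that each begins at the level where its predecessor
    stops. Being disjoint, the arcs of one page cannot have interleaved endpoints, which gives the
    nesting on which the layering rests. *)
Lemma page_paths_ribbon (w e : R) : 0 < w -> 0 < e ->
  exists k (S : 'I_k -> folded_strip R),
    folded_ribbon w L S /\ ribbon_length S <= #|J|%:R * w + e.
Proof.
move=> w0 e0.
have [|b0 [nx [nx_inj nxE b0_inj]]] :=
  @orient_arcs J E3 (fun e => from_end a e 0) _ (end_pairs ca ainj LE aint lineL).
  by move=> j; rewrite /from_end /= subr0 => /(ainj h0 h1)/eqP; rewrite eq_sym oner_eq0.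
pose o j (u : R) := from_end a (j, b0 j) u.
have o01 j (u : R) : u \in `[0, 1] -> (if b0 j then 1 - u else u) \in `[0, 1].
  by move=> u01; case: (b0 j) => //; exact: rev01.
have co j : continuous (o j) by exact: from_end_cont.
have oinj j (u u' : R) : u \in `[0, 1] -> u' \in `[0, 1] -> o j u = o j u' -> u = u'.
  exact: from_end_inj.
have o_page j (u : R) : u \in `[0, 1] -> page (dir (pg j)) (o j u).
  by move=> u01; apply: a_page; exact: o01.
have o_axis j (u : R) : u \in `[0, 1] -> (axis (o j u) <-> u = 0 \/ u = 1).
  move=> u01; rewrite /o /from_end /=; have := a_axis j (o01 j _ u01); case: (b0 j) => // h.
  by rewrite h; split=> -[] uu; [right|left|right|left]; lra.
have o_disj i j (u u' : R) : pg i = pg j -> u \in `[0, 1] -> u' \in `[0, 1] -> o i u = o j u' -> i = j.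
  by move=> pp u01 u01'; apply: a_disj => //; exact: o01.
pose s j := (o j 0).2; pose t j := (o j 1).2.
have o0 j : o j 0 = ((0, 0), s j).
  by rewrite (surjective_pairing (o j 0)) ((o_axis j 0 h0).2 (or_introl erefl)).
have o1 j : o j 1 = ((0, 0), t j).
  by rewrite (surjective_pairing (o j 1)) ((o_axis j 1 h1).2 (or_intror erefl)).
have o1E j : o j 1 = from_end a (j, ~~ b0 j) 0.
  by rewrite /o /from_end /=; case: (b0 j); rewrite /= ?subrr ?subr0.
have onx j : o (nx j) 0 = o j 1 by rewrite o1E -nxE.
have tE j : t j = s (nx j) by rewrite /s onx.
have s_inj : injective s by move=> j j' ss; apply: b0_inj; rewrite -/(o j 0) -/(o j' 0) !o0 ss.
(* Arcs of one page are disjoint including their endpoints, so consecutive arcs lie in different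
   pages. *)
have pg_nx j : pg (nx j) != pg j.
  apply/eqP => pp; have nj := o_disj _ _ _ _ pp h0 h1 (onx j).
  have := onx j; rewrite nj => /(oinj _ _ _ h0 h1)/eqP; by rewrite eq_sym oner_eq0.
pose xA j u := (page_coord (pg j) (o j u).1).1; pose zA j u := (o j u).2.
have oE j u : u \in `[0, 1] -> o j u = (page_frame (pg j) (xA j u, 0), zA j u).
  by move=> /(o_page j)/page_frame_coord[].
have cxA j : continuous (xA j).
  move=> u; have c1 := cvg_fst_of (co j u).
  by rewrite /continuous_at /xA /page_coord /=; apply: cvgD; apply: cvgM;
    solve [exact: cvg_cst|exact: cvg_fst_of|exact: cvg_snd_of].
have czA j : continuous (zA j) by move=> u; exact: cvg_snd_of (co j u).
have injA j j' (u u' : R) : pg j = pg j' -> u \in `[0, 1] -> u' \in `[0, 1] ->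
    xA j u = xA j' u' -> zA j u = zA j' u' -> j = j' /\ u = u'.
  move=> pp u01 u01' ex ez; have ee : o j u = o j' u' by rewrite !oE // ex ez pp.
  by have jj := o_disj _ _ _ _ pp u01 u01' ee; split=> //; rewrite -jj in ee; exact: oinj ee.
have xA_ge0 j (u : R) : u \in `[0, 1] -> 0 <= xA j u by move=> /(o_page j)/page_frame_coord[].
have xA_eq0 j (u : R) : u \in `[0, 1] -> (xA j u = 0 <-> u = 0 \/ u = 1).
  move=> u01; rewrite -(o_axis j) //; split=> [x0|]; last first.
    by rewrite /axis /= /xA => ->; rewrite /page_coord /= !mul0r addr0.
  have oj := oE j u u01; rewrite x0 in oj.
  by rewrite oj /axis /page_frame /= !mul0r subrr addr0.
have nested i j : i != j -> pg i = pg j ->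
  [\/ hi s t i < lo s t j, hi s t j < lo s t i, lo s t i < lo s t j /\ hi s t j < hi s t i
    | lo s t j < lo s t i /\ hi s t i < hi s t j].
  pose up j u : R := if s j < t j then u else 1 - u.
  have up01 k u : u \in `[0, 1] -> up k u \in `[0, 1] by rewrite /up; case: ifP => // _; exact: rev01.
  have cup k : continuous (up k) by move=> u; rewrite /continuous_at /up; case: ifP => _; cts.
  have zl k : zA k (up k 0) = lo s t k /\ zA k (up k 1) = hi s t k.
    by rewrite /up /lo /hi /zA -/(s k) -/(t k); case: ltP; rewrite ?subrr ?subr0.
  have xl k : xA k (up k 0) = 0 /\ xA k (up k 1) = 0.
    split; apply/xA_eq0; rewrite ?up01 //; rewrite /up; case: ifP => _; rewrite ?subrr ?subr0;
      by [left|right].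
  (* With both arcs run from their lower to their upper end, interleaved levels are the situation of
     [crossing_paths]. *)
  have cross k l : k != l -> pg k = pg l -> lo s t k < lo s t l -> lo s t l < hi s t k ->
      hi s t k < hi s t l -> False.
    move=> kl pp l1 l2 l3; have [zk0 zk1] := zl k; have [zl0 zl1] := zl l.
    have [xk0 xk1] := xl k; have [xl0 xl1] := xl l.
    rewrite -zk0 -zk1 -zl0 -zl1 in l1 l2 l3.
    have [u [u' [u01 u01' ex ez]]] := @crossing_paths R (xA k \o up k) (zA k \o up k) (xA l \o up l)
      (zA l \o up l)
      (fun u => continuous_comp (@cup k u) (@cxA k _)) (fun u => continuous_comp (@cup k u) (@czA k _))
      (fun u => continuous_comp (@cup l u) (@cxA l _)) (fun u => continuous_comp (@cup l u) (@czA l _))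
      (fun u h => xA_ge0 k _ (up01 k _ h)) (fun u h => xA_ge0 l _ (up01 l _ h)) xk0 xk1 xl0 xl1 l1 l2 l3.
    by have [kl'] := injA _ _ _ _ pp (up01 k _ u01) (up01 l _ u01') ex ez; rewrite kl' eqxx in kl.
  move=> ij pp.
  have neq z z' : z = s i \/ z = t i -> z' = s j \/ z' = t j -> z != z'.
    have tt k l : pg k = pg l -> s k <> t l.
      by move=> pkl; rewrite tE => /s_inj h; have := pg_nx l; rewrite -h pkl eqxx.
    case=> ->; case=> ->; apply/eqP.
    - by move/s_inj/eqP; apply/negP.
    - exact: tt.
    - by move/esym; apply: tt.
    - by rewrite !tE => /s_inj/nx_inj/eqP; apply/negP.
  have loE k : lo s t k = s k \/ lo s t k = t k by rewrite /lo; case: ltP; [left|right].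
  have hiE k : hi s t k = s k \/ hi s t k = t k by rewrite /hi; case: ltP; [right|left].
  have n1 := neq _ _ (loE i) (loE j); have n2 := neq _ _ (hiE i) (hiE j).
  have n3 := neq _ _ (loE i) (hiE j); have n4 := neq _ _ (hiE i) (loE j).
  have ji : j != i by rewrite eq_sym.
  move: n1 n2 n3 n4; rewrite !neq_lt.
  have [c1|_] := boolP (hi s t i < lo s t j); first by constructor 1.
  have [c2|_] := boolP (hi s t j < lo s t i); first by constructor 2.
  rewrite /= !orbF => /orP[n1|n1] /orP[n2|n2] n3 n4.
  - by case: (cross i j).
  - by constructor 3.
  - by constructor 4.
  - by case: (cross j i).
have [k [S [S1 S2 S3 S4 S5]]] := short_ribbon nx_inj tE s_inj pg_nx nested cxA czA injA xA_ge0 xA_eq0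
  (fun j => erefl) (fun j => erefl) w0 e0.
exists k, S; split=> //; split=> //.
suff <- : [set p | exists j (u : R), u \in `[0, 1] /\ p = (page_frame (pg j) (xA j u, 0), zA j u)] = L by [].
apply/seteqP; split=> p.
  by move=> [j [u [u01 ->]]]; rewrite -oE //; apply/LE; exists j, (if b0 j then 1 - u else u); first exact: o01.
move=> /LE[j [u u01 <-]]; exists j, (if b0 j then 1 - u else u); split; first exact: o01.
rewrite -oE ?o01 // /o /from_end /=; case: (b0 j) => //; congr a; ring.
Qed.

End PagePaths.

(** * Arbitrary four-page presentations *)

Section FourPages.
Context {R : realType}.
Notation E3 := (space3 R).

Lemma isotopic_continuous (f : E3 -> E3) : isotopic_to_id f -> continuous f.
Proof.
move=> [H [G [[_ h _] <-]]]; have in1 : (1 : R) \in `[0, 1] by rewrite in_itv /= ler01 lexx.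
by have [] := h 1 in1.
Qed.

Lemma four_page_ribbon (L : set E3) n w e : locally_line L -> four_page_arcs L n ->
  0 < w -> 0 < e -> exists k (S : 'I_k -> folded_strip R),
    folded_ribbon w L S /\ ribbon_length S <= n%:R * w + e.
Proof.
move=> lineL [u [pg0 [A [[u_inj u1] _ arcs A_disj LA]]]] w0 e0.
have [f [sp [fi sp_inj f_axis f_page]]] := normalise_pages u_inj u1.
have f_inj := isotopic_inj fi.
have /choice[c cP] := arcs.
(* Continuity of the arcs is known only within [0, 1]; clamping the parameter makes them continuous
   on the whole line. *)
pose a j (x : R) : E3 := f (c j (clamp x)).
have ci : (forall j (x : R), x \in `[0, 1] -> A j (c j x)) /\ forall j p, A j p -> exists2 x : R, x \in `[0, 1] & c j x = p.
  split=> [j x x01|j p]; have [_ _ AE _ _] := cP j; rewrite AE; first by exists x.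
  by move=> [x x01 <-]; exists x.
have [ci1 ci2] := ci.
have aE j x : x \in `[0, 1] -> a j x = f (c j x) by move=> x01; rewrite /a clamp_id.
have fL : ambient_isotopic L (f @` L) by exact: isotopic_ambient.
have [|||||||k [S [[S1 S2 S3 S4] S5]]] := @page_paths_ribbon R 'I_n (fun j => sp (pg0 j)) (f @` L) a
  _ _ _ _ _ _ _ w e w0 e0.
- move=> j x; have [cc _ _ _ _] := cP j.
  have cl : {within setT, continuous (c j \o clamp)}.
    apply: (within_continuous_comp _ cc); first exact/continuous_subspaceT/clamp_cont.
    by move=> _ [y _ <-]; exact: clamp_in.
  apply: (continuous_comp (f := c j \o clamp)); last exact: isotopic_continuous fi _.
  have {}cl : continuous (c j \o clamp) by apply/continuous_subspace_setT.
  exact: cl.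
- move=> j x y x01 y01; rewrite !aE // => /f_inj cxy.
  by have [_ cinj _ _ _] := cP j; exact: cinj.
- move=> p; rewrite LA; split=> [[q [j _ /ci2[x x01 <-]] <-]|[j [x x01 <-]]].
    by exists j, x => //; rewrite aE.
  by rewrite aE //; exists (c j x) => //; exists j => //; exact: ci1.
- move=> j x x01; rewrite aE //; apply: f_page.
  by have [_ _ _ Ap _] := cP j; apply: Ap; exact: ci1.
- move=> j x x01; rewrite aE //; have [_ _ _ _ cax] := cP j; rewrite -cax //; split.
    move=> ax; have /f_inj <- // := f_axis _ ax.
  by move=> ax; rewrite f_axis.
- move=> i j x y /sp_inj pp x01 y01; rewrite !aE // => /f_inj cxy; apply: contrapT => ij.
  have /seteqP[/(_ (c i x)) + _] := A_disj i j ij pp; apply; split; first exact: ci1.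
  by rewrite cxy; exact: ci1.
- exact: locally_line_isotopic lineL.
exists k, S; rewrite -[n]card_ord; split=> //; split=> //.
by apply: ambient_isotopic_trans S4 _; exact: ambient_isotopic_sym.
Qed.

End FourPages.

Theorem theorem1 (R : realType) (w : R) (K : set (space3 R))
    (w_gt0 : 0 < w) (K_link : is_link K) :
  (ribbonlength w K <= four_page_index K)%E.
Proof.
apply: le_ereal_inf_tmp => _ [n [L LK arcs] <-].
(* The presentation is isotopic to [K] and thereby to a polygon, whose local structure it
   inherits. *)
have lineL : locally_line L.
  have [P polyP PK] := K_link; apply: locally_line_isotopic (locally_line_polygonal polyP).
  by apply: ambient_isotopic_trans PK _; exact: ambient_isotopic_sym.
(* An error [e] in the quotient by the width allows an error [e * w] in the length. *)
apply/lee_addgt0Pr => e e0; have ew0 : 0 < e * w by rewrite mulr_gt0.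
have [k [S [[S1 S2 S3 S4] S5]]] := four_page_ribbon lineL arcs w_gt0 ew0.
apply: (@le_trans _ _ (ribbon_length S / w)%:E).
  apply: ereal_inf_lbound; exists k, S; split=> //; split=> //.
  exact: ambient_isotopic_trans S4 LK.
by rewrite -EFinD lee_fin ler_pdivrMr // mulrDl.
Qed.
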